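(* There exists $\overline{R}>0$ such that for every $R$ with $0<R<\overline{R}$ there exists a set $E_0\in\mathcal{K}_R^1$ that is not a ball and minimizes the shape functional $$\mathcal{F}(E)=\frac{D(E)}{\lambda_{\mathcal{H}}^2(E)}$$ among all subsets of $\mathbb{R}^2$ belonging to $\mathcal{K}_R^1$, the ball excluded; that is, $\mathcal{F}(E_0)\le\mathcal{F}(E)$ for every $E\in\mathcal{K}_R^1$ that is not a ball.
   Context: All sets are subsets of $\mathbb{R}^2$; $|E|$ denotes Lebesgue measure (area) and $P(E)$ denotes the perimeter. $B_r(z)$ is the closed ball (disc) with center $z$ and radius $r>0$, and $B_r=B_r(0)$. Isoperimetric deficit: for $E$ with $|E|=\pi r^2$, $r>0$, $$D(E)=\frac{P(E)-P(B_r)}{P(B_r)}.$$ Deviation from the spherical shape: for $E$ with $|E|=\pi r^2$, $0<r<\infty$, $$\lambda_{\mathcal{H}}(E)=\min_{z\in\mathbb{R}^2}\frac{d_{\mathcal{H}}(E,B_r(z))}{r},$$ where $$d_{\mathcal{H}}(E,F)=\max\left\{\sup_{x\in F}\operatorname{dist}(x,E),\ \sup_{y\in E}\operatorname{dist}(y,F)\right\}$$ is the Hausdorff distance. Spherical sector: for $x\in\mathbb{R}^2$, $\rho>0$, $\theta\in(0,\pi)$ and a unit vector $\nu\in\mathbb{S}^1$, $$S^{\theta,\rho}_{x,\nu}=\{y\in\mathbb{R}^2: |y-x|<\rho,\ \langle y-x,\nu\rangle>\cos(\theta/2)\,|y-x|\}.$$ A closed set $E$ satisfies the interior cone condition at the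 boundary with radius $\rho>0$ and aperture $\theta$ if for every $x\in\partial E$ there exists $\nu_x\in\mathbb{S}^1$ such that $S^{\theta,\rho}_{x,\nu_x}\subset E$. For $R>0$, $\mathcal{K}_R^1$ is the class of closed convex sets $E\subset\mathbb{R}^2$ with $|E|=\pi$ that satisfy the interior cone condition at the boundary with radius $R$ and aperture $\pi/2$. *)

(* Defs.v *)
From HB Require Import structures.
From mathcomp Require Import all_boot all_order all_algebra.
From mathcomp Require Import all_classical all_reals all_analysis.
Set Implicit Arguments.
Unset Strict Implicit.
Unset Printing Implicit Defensive.
Import Order.TTheory GRing.Theory Num.Theory.
Import numFieldNormedType.Exports.

Local Open Scope classical_set_scope.
Local Open Scope ring_scope.

Section plane.
Variable R : realType.
Implicit Types (E F : set (R * R)) (x y z v : R * R) (r rho theta : R).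

(* The library norm of R * R is the sup norm; it induces the usual topology,
   but all metric notions below use the Euclidean norm. *)
Definition edot x y : R := x.1 * y.1 + x.2 * y.2.
Definition enorm x : R := Num.sqrt (edot x x).

Definition cball z r : set (R * R) := [set x | enorm (x - z) <= r].

Definition is_cball E := exists z r, 0 < r /\ E = cball z r.

Definition area :
    {measure set (measurableTypeR R * measurableTypeR R)%type -> \bar R} :=
  (@lebesgue_measure R \x @lebesgue_measure R)%E.

Definition boundary E : set (R * R) := closure E `\` E^°.

Definition C1 (f : R * R -> R * R) :=
  (forall x, differentiable f x) /\ (forall v, continuous ('D_v f)).

Definition compactly_supported (f : R * R -> R * R) :=
  compact (closure [set x | f x != 0]).

Definition divergence (f : R * R -> R * R) x : R :=
  ('D_(1, 0) f x).1 + ('D_(0, 1) f x).2.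

(* De Giorgi's distributional perimeter. *)
Definition perimeter E : \bar R :=
  ereal_sup [set (\int[area]_(x in E) (divergence f x)%:E)%E | f in
    [set f : R * R -> R * R | [/\ C1 f, compactly_supported f &
                                  forall x, enorm (f x) <= 1]]].

(* For E of finite area, the only r >= 0 such that |E| = pi r^2. *)
Definition eqradius E : R := Num.sqrt (fine (area E) / pi).

Definition deficit E : \bar R :=
  let PB := perimeter (cball 0 (eqradius E)) in
  ((perimeter E - PB) / PB)%E.

Definition edist_set x E : \bar R :=
  ereal_inf [set (enorm (x - y))%:E | y in E].

Definition hausdorff_dist E F : \bar R :=
  Order.max (ereal_sup [set edist_set x E | x in F])
            (ereal_sup [set edist_set y F | y in E]).

(* An infimum, attained for bounded nonempty E. *)
Definition lambdaH E : \bar R :=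
  ereal_inf [set (hausdorff_dist E (cball z (eqradius E))
                  / (eqradius E)%:E)%E | z in [set: R * R]].

(* The division of \bar R sends 1 / 0 to +oo; lambdaH E is positive and finite
   when E is a compact set of positive area which is not a ball. *)
Definition shape_functional E : \bar R := (deficit E / lambdaH E ^+ 2)%E.

Definition sector x v theta rho : set (R * R) :=
  [set y | enorm (y - x) < rho /\
           cos (theta / 2) * enorm (y - x) < edot (y - x) v].

Definition interior_cone rho theta E :=
  forall x, boundary E x ->
    exists v, enorm v = 1 /\ sector x v theta rho `<=` E.

Definition KR1 rho : set (set (R * R)) :=
  [set E | [/\ closed E, convex_set (E : set (convex_lmodType (R * R)%type)),
               area E = pi%:E & interior_cone rho (pi / 2) E]].

End plane.

(* Main.v *)
(* A plane convex set of area pi and perimeter at most 2 pi + s^2 is within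
   Hausdorff distance 7 s of a unit disc. Indeed, if E lies in |x| <= a and
   touches both lines x = a and x = -a, one integrates the divergence of a
   field which on E is essentially (p(x/a), sgn(y - L(x)) sqrt(1 - p(x/a)^2)),
   where L is the chord joining the two contact points and
   p(t) = t + eta (1 - t^2). For eta = 0 this bounds the width of E by
   perimeter and area; for small eta of both signs it also compares the
   midpoint of the projection of E with the projection of its centroid.
   Hence the support function of E, centred at the centroid, is 1 up to O(s)
   in every direction.

   Consequently F >= 1/400 asymptotically along sets converging to the disc,
   while a long thin rectangle, which is admissible when the cone radius is
   small, has F < 1/400: a minimising sequence stays away from the disc.
   After a translation, the cone condition puts a disc of fixed radius around
   the origin inside E, so convexity and the area bound the diameter, and the
   sets converge in the Hausdorff distance along an ultrafilter. Area, the cone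
   condition and the deviation from the disc pass to the limit, and the
   perimeter is lower semicontinuous. *)
From HB Require Import structures.
Require Import Defs.
From mathcomp Require Import all_boot all_order all_algebra.
From mathcomp Require Import all_classical all_reals all_analysis.
From mathcomp Require Import measurable_realfun ring lra.
Set Implicit Arguments.
Unset Strict Implicit.
Unset Printing Implicit Defensive.
Import Order.TTheory GRing.Theory Num.Theory.
Import numFieldNormedType.Exports.
Local Open Scope classical_set_scope.
Local Open Scope ring_scope.

(** * Area in the plane *)

(** Since the perimeter is a supremum over fields, a lower bound needs a single field and
    semicontinuity only needs the flux of each fixed field to converge. Upper bounds are required
    for the unit disc and for rectangles alone, where integration along slices suffices. The
    Bonnesen field is built to have a linear term in eta. Its horizontal part has a divergence
    affine in x, which sees area and centroid; its jump across the chord contributes 2 sqrt(1 - p^2)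
    on each vertical line, whatever the shape of E. The part of this jump linear in eta is odd and
    integrates to zero, so the offset of the centroid enters at order eta against losses of order
    eta^2, and eta = s, -s balance the two. The threshold 1/400 comes from 7 s: a perimeter excess
    s^2 means D = s^2 / (2 pi), and 2 pi 7^2 < 400. The disc around the origin also turns Hausdorff
    closeness into inclusion up to a dilation of ratio 1 + d, so that areas and fluxes are compared
    directly. *)

Section PlaneMeasure.
Variable R : realType.
Local Notation plane := (measurableTypeR R * measurableTypeR R)%type.
Local Notation mu := (@lebesgue_measure R).

(** The sigma-algebra here is the product one, so an open set has to be a countable union of
    rectangles: squares with rational centre and radius 1 / (n + 1), those not inside U being
    replaced by the empty set. A radius below e / 2 keeps any two points of a square within e of
    each other. *)
Lemma open_measurable_plane (U : set (R * R)) :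
  open U -> measurable (U : set plane).
Proof.
move=> oU.
pose box (q : rat * rat * nat) : set (R * R) :=
  (ball (ratr q.1.1 : R) q.2.+1%:R^-1) `*` (ball (ratr q.1.2 : R) q.2.+1%:R^-1).
pose F q : set (R * R) := if pselect (box q `<=` U) then box q else set0.
have -> : U = \bigcup_q F q.
  apply/seteqP; split; last first.
    by move=> x [q _]; rewrite /F; case: pselect => // h; exact: h.
  move=> [x y] Uxy; have /nbhs_ballP[e /= e0 eU] := open_nbhs_nbhs (conj oU Uxy).
  have [n ne] : exists n : nat, n.+1%:R^-1 < e / 2.
    have e2 : 0 < e / 2 by rewrite divr_gt0.
    by have [n _ /(_ n (leqnn n))] := near_infty_natSinv_lt (PosNum e2); exists n.
  have n0 : 0 < n.+1%:R^-1 :> R by rewrite invr_gt0.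
  have approx (z : R) : exists q : rat, ball (ratr q : R) n.+1%:R^-1 z.
    have /rat_in_itvoo[q] : z - n.+1%:R^-1 < z + n.+1%:R^-1.
      by rewrite ltrD2l gtrN.
    rewrite in_itv/= => /andP[q1 q2]; exists q.
    by rewrite /ball/= ltr_distl q1 q2.
  have [p px] := approx x; have [q qy] := approx y.
  exists (p, q, n) => //; rewrite /F; case: pselect => //= h; exfalso; apply: h.
  have tri (z w : R) (r : rat) : ball (ratr r : R) n.+1%:R^-1 z ->
      ball (ratr r : R) n.+1%:R^-1 w -> ball z e w.
    rewrite /ball/= => h1 h2.
    rewrite (_ : z - w = (ratr r - w) - (ratr r - z)); last by ring.
    by rewrite (le_lt_trans (ler_normB _ _))// (splitr e) ltrD// (lt_trans _ ne).
  by move=> [z w] [/= hz hw]; apply: eU; split; [exact: (tri _ _ p)|exact: (tri _ _ q)].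
apply: countable_bigcupT_measurable => [|q]; first exact: countableP.
rewrite /F; case: pselect => h; last exact: measurable0.
by apply: measurableX; apply: open_measurable; exact: ball_open.
Qed.

Lemma closed_measurable_plane (A : set (R * R)) :
  closed A -> measurable (A : set plane).
Proof.
by move/closed_openC/open_measurable_plane/measurableC; rewrite setCK.
Qed.

Lemma continuous_measurable_plane (f : R * R -> R) :
  continuous f -> measurable_fun setT (f : plane -> measurableTypeR R).
Proof.
move=> /continuousP cf; apply: (measurability _ (RGenOpens.measurableE R)).
move=> _ [_ [a [b ->] <-]]; rewrite setTI; apply: open_measurable_plane.
exact/cf/interval_open.
Qed.

Lemma area_rect (a b c d : R) : a <= b -> c <= d ->
  @area R (`[a, b] `*` `[c, d]) = ((b - a) * (d - c))%:E.
Proof.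
move=> ab cd; rewrite [LHS](product_measure1E mu mu)//= !lebesgue_measure_itv/= !lte_fin.
have [ab'|ab'] := ltP a b; last first.
  have -> : b = a by apply/eqP; rewrite eq_le ab ab'.
  by rewrite subrr mul0r mul0e.
have [cd'|cd'] := ltP c d; last first.
  have -> : d = c by apply/eqP; rewrite eq_le cd cd'.
  by rewrite subrr mulr0 mule0.
by rewrite -!EFinD -EFinM.
Qed.


Lemma compact_bounded_plane (E : set (R * R)) : compact E ->
  exists2 M : R, 0 < M & forall x, E x -> `|x.1| <= M /\ `|x.2| <= M.
Proof.
move=> /compact_bounded[M [_ hM]]; exists (`|M| + 1); first by rewrite ltr_wpDl.
move=> x Ex; have : `|x| <= `|M| + 1.
  by apply: hM => //; rewrite ltr_pwDr// ler_norm.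
by rewrite prod_normE ge_max => /andP[].
Qed.

Lemma compact_measurable_plane (E : set (R * R)) : compact E ->
  measurable (E : set plane).
Proof.
move=> cE; apply: closed_measurable_plane; apply: compact_closed cE.
exact: norm_hausdorff.
Qed.

Lemma area_compact_lty (E : set (R * R)) : compact E -> (@area R E < +oo)%E.
Proof.
move=> cE; have [M M0 EM] := compact_bounded_plane cE.
apply: (@le_lt_trans _ _ (@area R (`[- M, M] `*` `[- M, M]))).
  apply: le_measure; rewrite ?inE.
  - exact: compact_measurable_plane.
  - exact: measurableX.
  - move=> [x y] /EM/= [hx hy]; rewrite /= !in_itv/=.
    by rewrite -!ler_norml hx hy.
by rewrite area_rect ?ltry//; lra.
Qed.

Lemma continuous_compact_integrable_plane (E : set (R * R)) (g : R * R -> R) :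
  compact E -> continuous g -> (@area R).-integrable E (EFin \o g).
Proof.
move=> cE cg; apply: measurable_bounded_integrable.
- exact: compact_measurable_plane.
- exact: area_compact_lty.
- by apply: measurable_funTS; exact: continuous_measurable_plane.
- have cEg : compact (g @` E).
    by apply: continuous_compact => //; exact: continuous_subspaceT.
  have [M [Mr hM]] := compact_bounded cEg.
  by exists M; split => // x /hM h y Ey; apply: h; exists y.
Qed.

End PlaneMeasure.

(** * Area under shears, rigid motions and dilations *)

Section PlaneMaps.
Variable R : realType.
Local Notation plane := (measurableTypeR R * measurableTypeR R)%type.
Local Notation mu := (@lebesgue_measure R).

(** The pushforward has the right value on half-open intervals, and these determine Lebesgue
    measure. *)
Lemma lebesgue_measure_shift (v : R) (A : set (measurableTypeR R)) :
  measurable A -> mu ((fun y : R => y + v) @^-1` A) = mu A.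
Proof.
have mf : measurable_fun setT ((fun y : R => y + v) : measurableTypeR R -> measurableTypeR R).
  by apply: continuous_measurable_fun => x; apply: cvgD => //; exact: cvg_cst.
move=> mA; transitivity (pushforward mu ((fun y : R => y + v) : _ -> measurableTypeR R) A) => //.
apply/esym/lebesgue_measure_unique => //= _ [[a b]] _ <-.
rewrite /pushforward (_ : _ @^-1` _ = `]a - v, b - v]%classic); last first.
  by apply/seteqP; split => y; rewrite /= !in_itv/= ltrBlDr lerBrDr.
rewrite !lebesgue_measure_itv/= !lte_fin ltrD2r -!EFinB.
by case: ifPn => // _; congr EFin; ring.
Qed.

Lemma lebesgue_measure_scale (t : R) (A : set (measurableTypeR R)) :
  0 < t -> measurable A ->
  mu A = (t%:E * mu ((fun y : R => t * y)%R @^-1` A))%E.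
Proof.
move=> t0.
have mf : measurable_fun setT ((fun y : R => t * y)%R : measurableTypeR R -> measurableTypeR R).
  by apply: continuous_measurable_fun => x; apply: cvgM => //; exact: cvg_cst.
move=> mA; pose m' := measure_function_pushforward__canonical__measure_function_Measure mu mf.
transitivity (mscale (NngNum (ltW t0)) m' A) => //; apply: lebesgue_measure_unique => //= _ [[a b]] _ <-.
rewrite /mscale/= /pushforward.
rewrite (_ : _ @^-1` _ = `]a / t, b / t]%classic); last first.
  by apply/seteqP; split => y; rewrite /= !in_itv/= ltr_pdivrMr// ler_pdivlMr// mulrC.
rewrite !lebesgue_measure_itv/= !lte_fin ltr_pM2r ?invr_gt0// -!EFinB.
case: ifPn => _; last by rewrite mule0.
by rewrite -EFinM; congr EFin; field; rewrite gt_eqF.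
Qed.

Lemma continuous_pair {T : topologicalType} (f g : T -> R) :
  continuous f -> continuous g -> continuous (fun x => (f x, g x)).
Proof. by move=> cf cg x; exact: (cvg_pair (cf x) (cg x)). Qed.

(** Continuity is part of the notion: it makes preimages measurable, which composition and change of
    variables both use. *)
Definition area_preserving (T : R * R -> R * R) :=
  continuous T /\
  forall A, measurable (A : set plane) -> @area R (T @^-1` A) = @area R A.

Lemma continuous_measurable_plane2 (T : R * R -> R * R) :
  continuous T -> measurable_fun setT (T : plane -> plane).
Proof.
move=> cT; apply/measurable_fun_pairP; split; apply: continuous_measurable_plane.
- by move=> x; apply: continuous_comp; [exact: cT|exact: cvg_fst].
- by move=> x; apply: continuous_comp; [exact: cT|exact: cvg_snd].
Qed.

Lemma measurable_preimage_plane (T : R * R -> R * R) (A : set (R * R)) :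
  continuous T -> measurable (A : set plane) ->
  measurable (T @^-1` A : set plane).
Proof.
by move=> /continuous_measurable_plane2 mT mA; rewrite -[X in measurable X]setTI; exact: mT.
Qed.

Lemma area_preserving_comp (T U : R * R -> R * R) :
  area_preserving T -> area_preserving U -> area_preserving (T \o U).
Proof.
move=> [cT aT] [cU aU]; split.
  by move=> x; apply: continuous_comp; [exact: cU|exact: cT].
move=> A mA; rewrite comp_preimage aU ?aT//.
exact: measurable_preimage_plane.
Qed.

(** [area] is defined by integrating over vertical slices; uniqueness of the product measure gives
    the other order, needed for horizontal shears. *)
Lemma area_ysection (A : set plane) : measurable A ->
  @area R A = (\int[mu]_y mu (ysection A y))%E.
Proof.
move=> mA; transitivity ((mu \x^ mu)%E A) => //.
apply: (@product_measure_unique _ _ _ _ R mu mu (mu \x^ mu)%E) => // B C mB mC.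
exact: product_measure2E.
Qed.

(** Each vertical slice is merely translated. *)
Lemma area_preserving_vshear (g : R -> R) : continuous g ->
  area_preserving (fun x => (x.1, x.2 + g x.1)).
Proof.
move=> cg; split.
  apply: continuous_pair => x; first exact: cvg_fst.
  apply: cvgD; first exact: cvg_snd.
  by apply: (continuous_comp (g := g)) (cg _); exact: cvg_fst.
move=> A mA; rewrite /area/= /product_measure1; apply: eq_integral => x _ /=.
rewrite -[RHS](lebesgue_measure_shift (g x)); last exact: measurable_xsection.
by congr (mu _); apply/seteqP; split => y/=; rewrite !xsectionE.
Qed.

Lemma area_preserving_hshear (g : R -> R) : continuous g ->
  area_preserving (fun x => (x.1 + g x.2, x.2)).
Proof.
move=> cg.
have cT : continuous (fun x : R * R => (x.1 + g x.2, x.2)).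
  apply: continuous_pair => x; last exact: cvg_snd.
  apply: cvgD; first exact: cvg_fst.
  by apply: (continuous_comp (g := g)) (cg _); exact: cvg_snd.
split=> // A mA.
rewrite (area_ysection mA) (area_ysection (measurable_preimage_plane cT mA)).
apply: eq_integral => y _ /=.
rewrite -[RHS](lebesgue_measure_shift (g y)); last exact: measurable_ysection.
by congr (mu _); apply/seteqP; split => x/=; rewrite !ysectionE.
Qed.

Lemma area_preserving_shift (v : R * R) : area_preserving (fun x => x + v).
Proof.
have -> : (fun x : R * R => x + v) =
    (fun x => (x.1, x.2 + cst v.2 x.1)) \o (fun x => (x.1 + cst v.1 x.2, x.2)).
  by apply/funext => -[x y] /=; case: v.
apply: area_preserving_comp.
- by apply: area_preserving_vshear; exact: cst_continuous.
- by apply: area_preserving_hshear; exact: cst_continuous.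
Qed.

Definition rotation (c s : R) (x : R * R) : R * R :=
  (c * x.1 - s * x.2, s * x.1 + c * x.2).

(* A rotation which is not the identity or the half turn is a product of three shears. *)
Lemma area_preserving_rotation (c s : R) : c ^+ 2 + s ^+ 2 = 1 ->
  area_preserving (rotation c s).
Proof.
have rotn0 (c' s' : R) : s' != 0 -> c' ^+ 2 + s' ^+ 2 = 1 -> area_preserving (rotation c' s').
  (* For the angle t, u = - tan (t / 2). The product of the shears u, s', u is the rotation because
     1 + u s' = c' and u (1 + c') = - s'. *)
  move=> s0 cs1; set u := (c' - 1) / s'.
  have -> : rotation c' s' = (fun x => (x.1 + u * x.2, x.2)) \o
     ((fun x => (x.1, x.2 + s' * x.1)) \o (fun x => (x.1 + u * x.2, x.2))).
    apply/funext => -[x y] /=; rewrite /rotation/=.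
    have us : u * s' = c' - 1 by rewrite /u divfK.
    have us2 : u * (1 + c') = - s'.
      apply: (mulIf s0); rewrite mulrAC us.
      transitivity (c' ^+ 2 - 1); first by ring.
      by rewrite -cs1; ring.
    congr pair.
      transitivity ((1 + u * s') * x + (u * (1 + (1 + u * s'))) * y); last by ring.
      by rewrite us (_ : 1 + (1 + (c' - 1)) = 1 + c') ?us2; ring.
    transitivity (s' * x + (1 + u * s') * y); last by ring.
    by rewrite us; ring.
  have cM (k : R) : continuous (fun x : R => k * x).
    by move=> x; apply: cvgM => //; exact: cvg_cst.
  apply: area_preserving_comp; first exact: area_preserving_hshear.
  by apply: area_preserving_comp; [exact: area_preserving_vshear|exact: area_preserving_hshear].
move=> cs1; have [s0|] := eqVneq s 0; last by move=> s0; exact: rotn0.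
have := cs1; rewrite s0 expr0n addr0 => /eqP; rewrite sqrf_eq1 => /orP[]/eqP->.
  have -> : rotation 1 0 = idfun by apply/funext => -[x y]; rewrite /rotation/=; congr pair; ring.
  by split=> // x; exact: cvg_id.
(* The half turn is the square of a quarter turn, to which the three shears apply. *)
have -> : rotation (-1) 0 = rotation 0 1 \o rotation 0 1.
  by apply/funext => -[x y]; rewrite /rotation/=; congr pair; ring.
by apply: area_preserving_comp; apply: rotn0; rewrite ?oner_eq0//; ring.
Qed.

Lemma area_preserving_integral (T : R * R -> R * R) (E : set (R * R)) (h : R * R -> R) :
  area_preserving T -> compact E -> compact (T @^-1` E) -> continuous h ->
  (\int[@area R]_(x in T @^-1` E) (h (T x))%:E = \int[@area R]_(x in E) (h x)%:E)%E.
Proof.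
move=> [cT aT] cE cTE ch.
have mT := continuous_measurable_plane2 cT.
have mE := compact_measurable_plane cE.
transitivity (\int[pushforward (@area R) (T : plane -> plane)]_(x in E) (h x)%:E)%E; last first.
  by apply: eq_measure_integral => // A mA _; exact: aT.
rewrite integral_pushforward//.
- by apply/measurable_EFinP; exact: continuous_measurable_plane.
- apply: (continuous_compact_integrable_plane (g := h \o T)) => //.
  by move=> x; apply: continuous_comp; [exact: cT|exact: ch].
Qed.

(** The pushforward multiplied by t^2 is a measure with the right value on products of measurable
    sets, by the one-dimensional scaling in each factor. *)
Lemma area_scale (t : R) (A : set (R * R)) : 0 < t -> measurable (A : set plane) ->
  @area R A = ((t ^+ 2)%:E * @area R ((fun x => t *: x) @^-1` A))%E.
Proof.
move=> t0 mA.
have cT : continuous (fun x : R * R => t *: x) by move=> x; exact: scaler_continuous.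
have mT := continuous_measurable_plane2 cT.
pose m' := measure_function_pushforward__canonical__measure_function_Measure (@area R) mT.
apply: (@product_measure_unique _ _ _ _ R mu mu
  (mscale (NngNum (exprn_ge0 2 (ltW t0))) m')) => //= B C mB mC.
rewrite /mscale/= /pushforward.
rewrite (_ : _ @^-1` _ = ((fun x : R => t * x) @^-1` B) `*` ((fun x : R => t * x) @^-1` C)); last first.
  by apply/seteqP; split => -[x y].
have mS (D : set (measurableTypeR R)) : measurable D ->
    measurable ((fun x : R => t * x) @^-1` D : set (measurableTypeR R)).
  move=> mD; rewrite -[X in measurable X]setTI.
  apply: (continuous_measurable_fun (f := fun x : R => t * x)) => //.
  by move=> x; apply: cvgM => //; exact: cvg_cst.
rewrite [X in (_ * X)%E](product_measure1E mu mu)//; [|exact: mS|exact: mS].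
rewrite (lebesgue_measure_scale t0 mB) (lebesgue_measure_scale t0 mC).
by rewrite expr2 EFinM muleACA.
Qed.

End PlaneMaps.

(** * Test fields and rigid motions *)

Section PlaneCalculus.
Variable R : realType.

(** The partial derivatives are explicit arguments, so that unification assembles them along sums,
    products and compositions, and the divergence of a composite field can be read off. *)
Definition gradient (g gx gy : R * R -> R) :=
  [/\ forall x, is_diff x g (fun v => gx x * v.1 + gy x * v.2),
      continuous gx & continuous gy].

Lemma gradient_fst : gradient (fun x => x.1) (cst 1) (cst 0).
Proof.
split; [|exact: cst_continuous|exact: cst_continuous] => x.
have cf : continuous (fst : {linear (R * R)%type -> R}) by move=> y; exact: cvg_fst.
apply: DiffDef; first exact: linear_differentiable.
rewrite (diff_lin (f := (fst : {linear (R * R)%type -> R}))) //.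
by apply/funext => v /=; rewrite mul1r mul0r addr0.
Qed.

Lemma gradient_snd : gradient (fun x => x.2) (cst 0) (cst 1).
Proof.
split; [|exact: cst_continuous|exact: cst_continuous] => x.
have cf : continuous (snd : {linear (R * R)%type -> R}) by move=> y; exact: cvg_snd.
apply: DiffDef; first exact: linear_differentiable.
rewrite (diff_lin (f := (snd : {linear (R * R)%type -> R}))) //.
by apply/funext => v /=; rewrite mul1r mul0r add0r.
Qed.

Lemma gradient_cst a : gradient (cst a) (cst 0) (cst 0).
Proof.
split; [|exact: cst_continuous|exact: cst_continuous] => x.
apply: is_diff_eq; apply/funext => v /=.
by rewrite !mul0r addr0.
Qed.

Lemma gradient_continuous g gx gy : gradient g gx gy -> continuous g.
Proof.
by move=> [dg _ _] x; apply: differentiable_continuous; have [] := dg x.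
Qed.

Lemma gradientD g gx gy h hx hy : gradient g gx gy -> gradient h hx hy ->
  gradient (fun x => g x + h x) (fun x => gx x + hx x) (fun x => gy x + hy x).
Proof.
move=> [dg cgx cgy] [dh chx chy]; split=> x; last 2 first.
- by apply: cvgD; [exact: cgx|exact: chx].
- by apply: cvgD; [exact: cgy|exact: chy].
apply: (is_diff_eq (is_diffD (dg x) (dh x))).
by apply/funext => v /=; rewrite !fctE; ring.
Qed.

Lemma gradientM g gx gy h hx hy : gradient g gx gy -> gradient h hx hy ->
  gradient (fun x => g x * h x) (fun x => gx x * h x + g x * hx x)
    (fun x => gy x * h x + g x * hy x).
Proof.
move=> gg gh; have cg := gradient_continuous gg.
have ch := gradient_continuous gh.
case: gg gh => [dg cgx cgy] [dh chx chy]; split=> x; last 2 first.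
- apply: cvgD; apply: cvgM; [exact: cgx|exact: ch|exact: cg|exact: chx].
- apply: cvgD; apply: cvgM; [exact: cgy|exact: ch|exact: cg|exact: chy].
apply: (is_diff_eq (is_diffM (dg x) (dh x))).
by apply/funext => v /=; rewrite !fctE /= /GRing.scale/=; ring.
Qed.

Lemma is_diff_is_derive (phi : R -> R) (t a : R) :
  is_diff t phi (fun h => a * h) -> is_derive t 1 phi a.
Proof.
move=> [df dE]; apply: DeriveDef; first exact/derivable1_diffP.
by rewrite deriveE// dE mulr1.
Qed.

Lemma is_derive_is_diff (phi : R -> R) (t a : R) :
  is_derive t 1 phi a -> is_diff t phi (fun h => a * h).
Proof.
move=> [df dE]; apply: DiffDef; first exact/derivable1_diffP.
by rewrite deriv1E// derive1E dE; apply/funext => h; rewrite /GRing.scale/= mulrC.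
Qed.

Lemma gradient_comp (phi phi' : R -> R) g gx gy :
  (forall t : R, is_derive t 1 phi (phi' t)) -> continuous phi' -> gradient g gx gy ->
  gradient (fun x => phi (g x)) (fun x => phi' (g x) * gx x)
    (fun x => phi' (g x) * gy x).
Proof.
move=> dphi cphi gg; have cg := gradient_continuous gg.
have cpg : continuous (phi' \o g).
  by move=> x; apply: continuous_comp; [exact: cg|exact: cphi].
case: gg => [dg cgx cgy]; split=> x; last 2 first.
- by apply: cvgM; [exact: cpg|exact: cgx].
- by apply: cvgM; [exact: cpg|exact: cgy].
apply: (is_diff_eq (is_diff_comp (dg x) (is_derive_is_diff (dphi (g x))))).
by apply/funext => v /=; ring.
Qed.

Lemma gradient_pair f fx fy g gx gy : gradient f fx fy -> gradient g gx gy ->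
  C1 (fun x => (f x, g x)) /\
  divergence (fun x => (f x, g x)) = (fun x => fx x + gy x).
Proof.
move=> [df cfx cfy] [dg cgx cgy].
have dfg x : is_diff x (fun x => (f x, g x))
    (fun v => (fx x * v.1 + fy x * v.2, gx x * v.1 + gy x * v.2)).
  exact: is_diff_pair (df x) (dg x).
have DE v : 'D_v (fun x => (f x, g x)) =
    (fun x => (fx x * v.1 + fy x * v.2, gx x * v.1 + gy x * v.2)).
  by apply/funext => x; have [d dE] := dfg x; rewrite deriveE// dE.
split; first split.
- by move=> x; have [] := dfg x.
- move=> v; rewrite DE; apply: continuous_pair => x.
  + by apply: cvgD; apply: cvgM; [exact: cfx|exact: cvg_cst|exact: cfy|exact: cvg_cst].
  + by apply: cvgD; apply: cvgM; [exact: cgx|exact: cvg_cst|exact: cgy|exact: cvg_cst].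
apply/funext => x.
have E1 := congr1 (fun h => (h x).1) (DE (1, 0)).
have E2 := congr1 (fun h => (h x).2) (DE (0, 1)).
rewrite /divergence; transitivity ((fx x * 1 + fy x * 0) + (gx x * 0 + gy x * 1)); last by ring.
by congr (_ + _); [exact: E1|exact: E2].
Qed.

Lemma continuous_fst_comp {T : topologicalType} (f : T -> R * R) :
  continuous f -> continuous (fun x => (f x).1).
Proof. by move=> cf x; apply: (continuous_comp (g := fst)); [exact: cf|exact: cvg_fst]. Qed.

Lemma continuous_snd_comp {T : topologicalType} (f : T -> R * R) :
  continuous f -> continuous (fun x => (f x).2).
Proof. by move=> cf x; apply: (continuous_comp (g := snd)); [exact: cf|exact: cvg_snd]. Qed.

Lemma divergence_continuous (f : R * R -> R * R) : C1 f -> continuous (divergence f).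
Proof.
move=> [_ cD]; have h1 := continuous_fst_comp (cD (1, 0)).
have h2 := continuous_snd_comp (cD (0, 1)).
by move=> x; exact: (cvgD (h1 x) (h2 x)).
Qed.

(** This is what allows the fundamental theorem of calculus on vertical slices. *)
Lemma C1_derive_vert (f : R * R -> R * R) (x y : R) : C1 f ->
  is_derive y 1 (fun y => (f (x, y)).2) ('D_(0, 1) f (x, y)).2.
Proof.
move=> [df _]; apply: is_diff_is_derive.
have d1 : is_diff y (fun y : R => (x, y)) (fun h => (0, h)).
  exact: (is_diff_pair (is_diff_cst x y) (is_diff_id y)).
have d2 : is_diff (f (x, y)) (snd : R * R -> R) snd.
  have [/(_ (f (x, y)))[d dE] _ _] := gradient_snd.
  apply: DiffDef => //; rewrite dE; apply/funext => v /=.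
  by rewrite mul0r mul1r add0r.
have := is_diff_comp (is_diff_comp d1 (differentiableP (df (x, y)))) d2.
move=> h; apply: (is_diff_eq h).
apply/funext => h' /=.
rewrite deriveE// (_ : (0, h') = h' *: (0, 1) :> R * R); last first.
  by rewrite /GRing.scale/= /scale_pair; congr pair; rewrite /GRing.scale/= ?mulr0 ?mulr1.
by rewrite linearZ/= mulrC.
Qed.

Lemma enorm_ge0 (x : R * R) : 0 <= enorm x.
Proof. exact: sqrtr_ge0. Qed.

Lemma edot_ge0 (x : R * R) : 0 <= edot x x.
Proof. by rewrite /edot addr_ge0// -expr2 sqr_ge0. Qed.

Lemma enorm_sqr (x : R * R) : enorm x ^+ 2 = x.1 ^+ 2 + x.2 ^+ 2.
Proof. by rewrite sqr_sqrtr ?edot_ge0// /edot !expr2. Qed.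

Lemma enorm_le (x : R * R) (r : R) : 0 <= r ->
  (enorm x <= r) = (x.1 ^+ 2 + x.2 ^+ 2 <= r ^+ 2).
Proof. by move=> r0; rewrite -enorm_sqr ler_pXn2r// nnegrE enorm_ge0. Qed.

Definition test_field (f : R * R -> R * R) :=
  [/\ C1 f, compactly_supported f & forall x, enorm (f x) <= 1].

Lemma perimeter_ge (E : set (R * R)) f : test_field f ->
  (\int[@area R]_(x in E) (divergence f x)%:E <= perimeter E)%E.
Proof. by move=> tf; apply: ereal_sup_ubound; exists f. Qed.

Lemma perimeter_le (E : set (R * R)) M :
  (forall f, test_field f -> (\int[@area R]_(x in E) (divergence f x)%:E <= M)%E) ->
  (perimeter E <= M)%E.
Proof. by move=> h; apply: ub_ereal_sup => _ [f tf <-]; exact: h. Qed.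

Definition rigid (c s : R) (b : R * R) (x : R * R) : R * R := rotation c s x + b.

Section Rigid.
Variables (c s : R) (b : R * R).
Hypothesis cs1 : c ^+ 2 + s ^+ 2 = 1.

Lemma area_preserving_rigid : area_preserving (rigid c s b).
Proof.
apply: (area_preserving_comp (T := fun x => x + b)); first exact: area_preserving_shift.
exact: area_preserving_rotation.
Qed.

Lemma is_diff_rigid x : is_diff x (rigid c s b) (rotation c s).
Proof.
have [d1 _ _] := gradientD
  (gradientD (gradientM (gradient_cst c) gradient_fst)
  (gradientM (gradient_cst (- s)) gradient_snd)) (gradient_cst b.1).
have [d2 _ _] := gradientD
  (gradientD (gradientM (gradient_cst s) gradient_fst)
  (gradientM (gradient_cst c) gradient_snd)) (gradient_cst b.2).
have -> : rigid c s b = (fun x => (c * x.1 + - s * x.2 + b.1, s * x.1 + c * x.2 + b.2)).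
  by apply/funext => -[u v]; rewrite /rigid /rotation/=; congr pair; rewrite mulNr.
apply: (is_diff_eq (is_diff_pair (d1 x) (d2 x))).
by apply/funext => v; rewrite /rotation/=; congr pair; ring.
Qed.

Lemma rotK : cancel (rotation c s) (rotation c (- s)).
Proof.
move=> [u v]; rewrite /rotation/=; congr pair => /=; rewrite /rotation/=.
- transitivity ((c ^+ 2 + s ^+ 2) * u); first by ring.
  by rewrite cs1 mul1r.
- transitivity ((c ^+ 2 + s ^+ 2) * v); first by ring.
  by rewrite cs1 mul1r.
Qed.

Lemma rotVK : cancel (rotation c (- s)) (rotation c s).
Proof.
move=> [u v]; rewrite /rotation/=; congr pair => /=; rewrite /rotation/=.
- transitivity ((c ^+ 2 + s ^+ 2) * u); first by ring.
  by rewrite cs1 mul1r.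
- transitivity ((c ^+ 2 + s ^+ 2) * v); first by ring.
  by rewrite cs1 mul1r.
Qed.

Definition rigidV (y : R * R) : R * R := rotation c (- s) (y - b).

Lemma rigidVK : cancel rigidV (rigid c s b).
Proof. by move=> y; rewrite /rigid /rigidV rotVK subrK. Qed.

Lemma rigidK : cancel (rigid c s b) rigidV.
Proof. by move=> y; rewrite /rigid /rigidV addrK rotK. Qed.

Lemma rigidVE y : rigidV y = rigid c (- s) (rotation c (- s) (- b)) y.
Proof. by rewrite /rigidV /rigid /rotation/=; congr pair => /=; ring. Qed.

Lemma enorm_rot (x : R * R) : enorm (rotation c s x) = enorm x.
Proof.
rewrite /enorm; congr Num.sqrt; rewrite /edot /rotation/=.
by rewrite -[RHS]mul1r -cs1; ring.
Qed.

Lemma continuous_rigid : continuous (rigid c s b).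
Proof. by have [] := area_preserving_rigid. Qed.

End Rigid.

Lemma continuous_rigidV c s b : c ^+ 2 + s ^+ 2 = 1 -> continuous (rigidV c s b).
Proof.
move=> cs1; rewrite (_ : rigidV c s b = rigid c (- s) (rotation c (- s) (- b))).
  by apply: continuous_rigid; rewrite sqrrN.
by apply/funext => y; exact: rigidVE.
Qed.

Lemma rigid_preimage c s b (E : set (R * R)) : c ^+ 2 + s ^+ 2 = 1 ->
  rigid c s b @^-1` E = rigidV c s b @` E.
Proof.
move=> cs1; apply/seteqP; split => [x Ex|_ [y Ey <-]] /=.
  by exists (rigid c s b x) => //; rewrite rigidK.
by rewrite rigidVK.
Qed.

Lemma compact_rigid_preimage c s b (E : set (R * R)) : c ^+ 2 + s ^+ 2 = 1 ->
  compact E -> compact (rigid c s b @^-1` E).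
Proof.
move=> cs1 cE; rewrite rigid_preimage//; apply: continuous_compact => //.
by apply: continuous_subspaceT; exact: continuous_rigidV.
Qed.

(** Conjugating by a rotation preserves lengths, and it preserves the divergence because that is the
    trace of the differential. *)
Lemma test_field_rigid c s b f : c ^+ 2 + s ^+ 2 = 1 -> test_field f ->
  let g := rotation c (- s) \o f \o rigid c s b in
  test_field g /\ divergence g = divergence f \o rigid c s b.
Proof.
move=> cs1 [[df cD] sf f1] g.
have cs1' : c ^+ 2 + (- s) ^+ 2 = 1 by rewrite sqrrN.
have dr (y : R * R) : is_diff y (rotation c (- s)) (rotation c (- s)).
  have := is_diff_rigid c (- s) 0 y.
  by rewrite (_ : rigid c (- s) 0 = rotation c (- s))//; apply/funext => z; rewrite /rigid addr0.
have dg x : is_diff x g (rotation c (- s) \o ('d f (rigid c s b x) \o rotation c s)).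
  have h := is_diff_comp (is_diff_rigid c s b x) (differentiableP (df (rigid c s b x))).
  exact: (is_diff_comp h (dr (f (rigid c s b x)))).
have DE v : 'D_v g = (rotation c (- s) \o 'D_(rotation c s v) f \o rigid c s b).
  apply/funext => x; have [d dE] := dg x.
  by rewrite deriveE// dE /= deriveE.
have cT : continuous (rigid c s b) := continuous_rigid cs1.
have crot : continuous (rotation c (- s)).
  by have [] := area_preserving_rotation cs1'.
split.
  split.
  - split; first by move=> x; have [] := dg x.
    move=> v; rewrite DE => x; apply: continuous_comp; first exact: cT.
    by apply: continuous_comp; [exact: cD|exact: crot].
  - rewrite /compactly_supported.
    apply: (@subclosed_compact _ _ (rigid c s b @^-1` closure [set x | f x != 0])).
    - exact: closed_closure.
    - exact: compact_rigid_preimage.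
    have : closed (rigid c s b @^-1` closure [set x | f x != 0]).
      by apply: closed_comp => [x _|]; [exact: cT|exact: closed_closure].
    move=> /closure_id ->; apply: closure_subset => x /=.
    move=> gx; apply: subset_closure => /=; apply: contra gx => /eqP fx.
    by rewrite /g /= fx /rotation/=; apply/eqP; congr pair; rewrite !mulr0 ?subr0 ?addr0.
  - by move=> x; rewrite /g/= enorm_rot.
apply/funext => x; have DEx v : 'D_v g x = _ := congr1 (@^~ x) (DE v).
rewrite /divergence !DEx /=.
have D1 : 'D_(rotation c s (1, 0)) f (rigid c s b x) =
    c *: 'D_(1, 0) f (rigid c s b x) + s *: 'D_(0, 1) f (rigid c s b x).
  rewrite !deriveE// -!linearZ -linearD; congr ('d f _ _).
  by apply: injective_projections; rewrite /= /GRing.scale /=; ring.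
have D2 : 'D_(rotation c s (0, 1)) f (rigid c s b x) =
    (- s) *: 'D_(1, 0) f (rigid c s b x) + c *: 'D_(0, 1) f (rigid c s b x).
  rewrite !deriveE// -!linearZ -linearD; congr ('d f _ _).
  by apply: injective_projections; rewrite /= /GRing.scale /=; ring.
rewrite D1 D2.
case: ('D_(1, 0) f _) => u1 u2; case: ('D_(0, 1) f _) => v1 v2.
rewrite /= /rotation /= /GRing.scale /=.
transitivity ((c ^+ 2 + s ^+ 2) * (u1 + v2)); last by rewrite cs1 mul1r.
by ring.
Qed.

(** Every test field is carried to the moved set with the same flux. The reverse inequality is the
    same statement for the inverse motion. *)
Lemma perimeter_rigid c s b (E : set (R * R)) : c ^+ 2 + s ^+ 2 = 1 ->
  compact E -> (perimeter E <= perimeter (rigid c s b @^-1` E))%E.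
Proof.
move=> cs1 cE; apply: perimeter_le => f tf.
have [tg dg] := test_field_rigid b cs1 tf.
have := perimeter_ge (rigid c s b @^-1` E) tg; rewrite dg; apply: le_trans.
rewrite le_eqVlt; apply/orP; left; apply/eqP/esym.
have cdf : continuous (divergence f) by apply: divergence_continuous; case: tf.
have cTE := @compact_rigid_preimage c s b E cs1 cE.
have h := @area_preserving_integral R (rigid c s b) E (divergence f)
  (@area_preserving_rigid c s b cs1) cE cTE cdf.
exact: h.
Qed.

End PlaneCalculus.

(** * One-dimensional integrals *)

Section LineIntegrals.
Variable R : realType.
Local Notation mu := (@lebesgue_measure R).

Lemma continuous_after {T U V : topologicalType} (f : T -> U) (g : U -> V) :
  continuous f -> continuous g -> continuous (fun x => g (f x)).
Proof. by move=> cf cg x; apply: continuous_comp; [exact: cf|exact: cg]. Qed.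

Lemma continuous_add {T : topologicalType} (f g : T -> R) :
  continuous f -> continuous g -> continuous (fun x => f x + g x).
Proof. by move=> cf cg x; apply: cvgD; [exact: cf|exact: cg]. Qed.

Lemma continuous_mul {T : topologicalType} (f g : T -> R) :
  continuous f -> continuous g -> continuous (fun x => f x * g x).
Proof. by move=> cf cg x; apply: cvgM; [exact: cf|exact: cg]. Qed.

Lemma continuous_neg {T : topologicalType} (f : T -> R) :
  continuous f -> continuous (fun x => - f x).
Proof. by move=> cf x; apply: cvgN; exact: cf. Qed.

Lemma continuous_const {T : topologicalType} (a : R) : continuous (fun _ : T => a).
Proof. by move=> x; exact: cvg_cst. Qed.

Lemma continuous_idR : continuous (fun x : R => x).
Proof. by move=> x; exact: cvg_id. Qed.

Lemma continuous_itv_integrable (g : R -> R) (a b : R) : continuous g ->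
  mu.-integrable `[a, b] (EFin \o g).
Proof.
move=> cg; apply: continuous_compact_integrable; first exact: segment_compact.
exact: continuous_subspaceT.
Qed.

Lemma integral_derive (F f : R -> R) (a b : R) : a <= b ->
  {within `[a, b], continuous F} -> (forall x, x \in `]a, b[ -> is_derive x 1 F (f x)) ->
  continuous f ->
  (\int[mu]_(x in `[a, b]) (f x)%:E = (F b - F a)%:E)%E.
Proof.
rewrite le_eqVlt => /predU1P[<- _ _ _|ab cF dF cf].
  by rewrite set_itv1 integral_set1 subrr.
rewrite EFinB; apply: continuous_FTC2 => //.
- exact: continuous_subspaceT.
- have [_ cFa cFb] := (continuous_within_itvP F ab).1 cF.
  by split => // x xab; have [] := dF x xab.
- by move=> x xab; rewrite derive1E; have [] := dF x xab.
Qed.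

Lemma integral_deriveT (F f : R -> R) (a b : R) : a <= b ->
  (forall x : R, is_derive x 1 F (f x)) -> continuous f ->
  (\int[mu]_(x in `[a, b]) (f x)%:E = (F b - F a)%:E)%E.
Proof.
move=> ab dF cf; apply: integral_derive => //.
apply: continuous_subspaceT => x; apply: differentiable_continuous.
by apply/derivable1_diffP; have [] := dF x.
Qed.

(** The primitive is the integral from c, so its derivative is asserted only to the right of c; this
    is the origin of the strict lower bounds asked for below. *)
Lemma primitive_exists (G : R -> R) (c : R) : continuous G ->
  exists Phi : R -> R, forall x : R, c < x -> is_derive x 1 Phi (G x).
Proof.
move=> cG; exists (fun x => (\int[mu]_(t in [set` `[c, x]]) (G t))%R) => x cx.
have xx1 : x < x + 1 by rewrite ltrDl.
have iG := continuous_itv_integrable c (x + 1) cG.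
have [d dE] := continuous_FTC1_closed xx1 iG cx (cG x).
exact: (DeriveDef d (etrans (esym (derive1E _ _)) dE)).
Qed.

(** Both sides are differences of values of one primitive, so only the end values of phi enter. The
    two orientations serve sin, which increases on [0, pi / 2], and cos, which decreases there. *)
Lemma integral_subst (G phi phi' : R -> R) (c p q : R) : p <= q -> continuous G ->
  (forall t, c < phi t) -> (forall t : R, is_derive t 1 phi (phi' t)) -> continuous phi' ->
  ((phi p <= phi q)%R ->
    \int[mu]_(x in `[phi p, phi q]) (G x)%:E =
    \int[mu]_(t in `[p, q]) (G (phi t) * phi' t)%:E)%E /\
  ((phi q <= phi p)%R ->
    \int[mu]_(x in `[phi q, phi p]) (G x)%:E =
    \int[mu]_(t in `[p, q]) (G (phi t) * - phi' t)%:E)%E.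
Proof.
move=> pq cG cphi dphi cphi'; have [Phi dPhi] := primitive_exists c cG.
have cphi0 : continuous phi.
  move=> x; apply: differentiable_continuous.
  by apply/derivable1_diffP; have [] := dphi x.
have cGphi : continuous (fun t => G (phi t)).
  by move=> t; apply: continuous_comp; [exact: cphi0|exact: cG].
have dcomp (t : R) : is_derive t 1 (Phi \o phi) (G (phi t) * phi' t).
  exact: (is_derive1_comp (dPhi _ (cphi t)) (dphi t)).
have segm (x y : R) : c < x -> x <= y ->
    (\int[mu]_(x in `[x, y]) (G x)%:E = (Phi y - Phi x)%:E)%E.
  move=> cx xy; apply: integral_derive => //; last first.
    by move=> z; rewrite in_itv/= => /andP[xz _]; apply: dPhi; exact: lt_trans xz.
  apply: derivable_within_continuous => z; rewrite in_itv/= => /andP[xz _].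
  by have [] := dPhi z (lt_le_trans cx xz).
split=> h; rewrite segm//.
  symmetry; apply: (integral_deriveT (F := Phi \o phi)) => // t.
  by apply: cvgM; [exact: cGphi|exact: cphi'].
symmetry; transitivity (- Phi (phi q) - - Phi (phi p))%:E; last by rewrite opprK addrC.
apply: (integral_deriveT (F := fun t => - (Phi \o phi) t)) => //.
- by move=> t; rewrite mulrN; exact: is_deriveN.
- by move=> t; apply: cvgM; [exact: cGphi|apply: cvgN; exact: cphi'].
Qed.

(** Folding onto [0, a] leaves a quarter circle to parametrise, where sin and cos are nonnegative
    and [semicircle] turns one into the other. *)
Lemma integral_fold (G : R -> R) (a : R) : 0 <= a -> continuous G ->
  (\int[mu]_(x in `[(- a)%R, a]) (G x)%:E =
   \int[mu]_(x in `[0%R, a]) (G x + G (- x)%R)%:E)%E.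
Proof.
move=> a0 cG; have [Phi dPhi] := primitive_exists (- a - 1) cG.
have cPhi x : - a <= x -> {for x, continuous Phi}.
  move=> ax; apply: differentiable_continuous; apply/derivable1_diffP.
  by have [] := dPhi x (lt_le_trans _ ax) => //; rewrite gtrBl.
transitivity (Phi a - Phi (- a))%:E.
  apply: integral_derive => //.
- by rewrite (le_trans _ a0)// oppr_le0.
- apply: derivable_within_continuous => z; rewrite in_itv/= => /andP[xz _].
  by have [] := dPhi z (lt_le_trans _ xz) => //; rewrite gtrBl.
- move=> x; rewrite in_itv/= => /andP[ax _]; apply: dPhi.
  by rewrite (lt_trans _ ax)// gtrBl.
have dPsi x : x <= a -> - a <= x -> is_derive x 1 (fun x => Phi x - Phi (- x)) (G x + G (- x)).
  move=> xa ax; have h1 := dPhi x (lt_le_trans _ ax).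
  have ltNx : - a - 1 < - x by lra.
  have dN : is_derive x 1 (fun x : R => - x) (- 1) by exact: is_deriveN.
  have h3 : is_derive x 1 (fun x => Phi (- x)) (G (- x) * -1).
    exact: (is_derive1_comp (dPhi _ ltNx) dN).
  have h4 : is_derive x 1 (fun x => Phi x - Phi (- x)) (G x - G (- x) * -1).
    by apply: is_deriveB => //; apply: h1; rewrite gtrBl.
  by rewrite (_ : G x + G (- x) = G x - G (- x) * -1)//; ring.
symmetry; transitivity ((Phi a - Phi (- a)) - (Phi 0 - Phi (- 0)))%:E; last first.
  by rewrite oppr0 subrr subr0.
apply: (integral_derive (F := fun x => Phi x - Phi (- x))) => //.
- apply: derivable_within_continuous => z; rewrite in_itv/= => /andP[xz za].
  by have [] := dPsi z za (le_trans _ xz) => //; rewrite oppr_le0.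
- move=> z; rewrite in_itv/= => /andP[xz za]; apply: dPsi; first exact: ltW.
  by rewrite (le_trans _ (ltW xz))// oppr_le0.
- move=> x; apply: cvgD; first exact: cG.
  apply: (continuous_comp (f := -%R) (g := G)); last exact: cG.
  exact: opp_continuous.
Qed.

Definition semicircle (x : R) : R := Num.sqrt (1 - x ^+ 2).

Lemma semicircle_continuous : continuous semicircle.
Proof.
move=> x; apply: (continuous_comp (f := fun x : R => 1 - x ^+ 2)); last exact: sqrt_continuous.
by apply: cvgB; [exact: cvg_cst|exact: exprn_continuous].
Qed.

Lemma semicircle_sin (t : R) : 0 <= t <= pi / 2 -> semicircle (sin t) = cos t.
Proof.
move=> /andP[t0 t1]; rewrite /semicircle -(cos2Dsin2 t) addrK sqrtr_sqr ger0_norm//.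
by apply: cos_ge0_pihalf; rewrite t1 andbT (le_trans _ t0)// oppr_le0 divr_ge0// pi_ge0.
Qed.

Lemma semicircle_cos (t : R) : 0 <= t <= pi / 2 -> semicircle (cos t) = sin t.
Proof.
move=> /andP[t0 t1]; rewrite /semicircle -(cos2Dsin2 t) addrAC subrr add0r sqrtr_sqr ger0_norm//.
apply: sin_ge0_pi; rewrite t0 (le_trans t1)// ler_pdivrMr// ler_peMr ?pi_ge0//.
by rewrite ler1n.
Qed.

Lemma semicircle_ge0 (x : R) : 0 <= semicircle x.
Proof. exact: sqrtr_ge0. Qed.

Lemma pihalf_ge0 : 0 <= pi / 2 :> R.
Proof. by rewrite divr_ge0// pi_ge0. Qed.

(** B is absent from the value because its term is odd; this cancellation removes the first order in
    eta from the vertical part of the Bonnesen flux. What remains is half the area of an ellipse. *)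
Lemma integral_semicircle (a A B : R) : 0 < a ->
  (\int[mu]_(x in `[(- a)%R, a]) (semicircle (x / a) * (A + B * x))%:E = (A * a * (pi / 2))%:E)%E.
Proof.
move=> a0; have a0' : a != 0 by rewrite gt_eqF.
have cs : continuous (fun x : R => semicircle (x / a)).
  move=> x; apply: (continuous_comp (f := fun x : R => x / a)); last exact: semicircle_continuous.
  by apply: cvgM => //; exact: cvg_cst.
have cG : continuous (fun x : R => semicircle (x / a) * (A + B * x)).
  move=> x; apply: cvgM; first exact: cs.
  by apply: cvgD; [exact: cvg_cst|apply: cvgM => //; exact: cvg_cst].
rewrite integral_fold ?ltW//.
have cG2 : continuous (fun x : R => 2 * A * semicircle (x / a)).
  by move=> x; apply: cvgM; [exact: cvg_cst|exact: cs].
transitivity (\int[mu]_(x in `[0%R, a]) (2 * A * semicircle (x / a))%:E)%E.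
  apply: eq_integral => x _; congr EFin.
  rewrite mulNr (_ : semicircle (- _) = semicircle (x / a)); last by rewrite /semicircle sqrrN.
  by ring.
have dphi (t : R) : is_derive t 1 (fun t => a * sin t) (a * cos t).
  by have := is_deriveZ a (is_derive_sin t).
have cphi' : continuous (fun t : R => a * cos t).
  by move=> t; apply: cvgM; [exact: cvg_cst|exact: continuous_cos].
have lb t : - a - 1 < a * sin t.
  rewrite (@lt_le_trans _ _ (- a))// ?gtrBl//.
  by rewrite -mulrN1 ler_pM2l// sin_geN1.
have [h _] := integral_subst pihalf_ge0 cG2 lb dphi cphi'.
rewrite sin0 sin_pihalf mulr0 mulr1 in h; rewrite h ?ltW//.
have cc : continuous (fun t : R => 2 * A * a * (cos t * cos t)).
  by move=> t; apply: cvgM; [exact: cvg_cst|apply: cvgM; exact: continuous_cos].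
transitivity (\int[mu]_(t in `[0%R, (pi / 2)%R]) (2 * A * a * (cos t * cos t))%:E)%E.
  apply: eq_integral => t; rewrite inE/= in_itv/= => t01; congr EFin.
  have -> : a * sin t / a = sin t by field.
  by rewrite semicircle_sin//; ring.
transitivity (A * a * (pi / 2 + sin (pi / 2) * cos (pi / 2)) - A * a * (0 + sin 0 * cos 0))%:E; last first.
  by congr EFin; rewrite sin0 cos_pihalf; ring.
apply: (integral_deriveT (F := fun t => A * a * (t + sin t * cos t))) => //.
- exact: pihalf_ge0.
- move=> t.
  have h1 : is_derive t 1 (fun t => sin t * cos t) (sin t * - sin t + cos t * cos t).
    exact: (is_derive_eq (is_deriveM (is_derive_sin t) (is_derive_cos t))).
  have h2 := is_deriveZ (A * a) (is_deriveD (is_derive_id t 1) h1).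
  apply: (is_derive_eq h2).
  rewrite /GRing.scale/= -[in X in _ * X](cos2Dsin2 t); ring.
Qed.

(** The two coordinates of a flux through the circle are integrated in different variables. With x =
    sin t in one and y = cos t in the other, both become integrals over the same quarter circle and
    can be bounded together at each point. *)
Lemma integral_circle_le (G H : R -> R) (M : R) : continuous G -> continuous H ->
  (forall t, 0 <= t <= pi / 2 ->
    (G (sin t) + G (- sin t)) * cos t + (H (cos t) + H (- cos t)) * sin t <= M) ->
  (\int[mu]_(x in `[(-1)%R, 1%R]) (G x)%:E + \int[mu]_(x in `[(-1)%R, 1%R]) (H x)%:E <=
   (M * (pi / 2))%:E)%E.
Proof.
move=> cG cH GH; rewrite (integral_fold ler01 cG) (integral_fold ler01 cH).
have cfold (K : R -> R) : continuous K -> continuous (fun x => K x + K (- x)).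
  move=> cK x; apply: cvgD; first exact: cK.
  by apply: (continuous_comp (f := -%R) (g := K)); [exact: opp_continuous|exact: cK].
(* [integral_subst] asks for a strict lower bound of the substituted function; -2 serves sin and cos
   alike. *)
have lbs t : (-2 : R) < sin t by rewrite (@lt_le_trans _ _ (-1))// ?sin_geN1//; lra.
have lbc t : (-2 : R) < cos t by rewrite (@lt_le_trans _ _ (-1))// ?cos_geN1//; lra.
have dcos (t : R) : is_derive t 1 cos (- sin t) by exact: is_derive_cos.
have cNsin : continuous (fun t : R => - sin t).
  by move=> t; apply: cvgN; exact: continuous_sin.
have [h1 _] := integral_subst pihalf_ge0 (cfold _ cG) lbs (@is_derive_sin R) (@continuous_cos R).
have [_ h2] := integral_subst pihalf_ge0 (cfold _ cH) lbc dcos cNsin.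
rewrite sin0 sin_pihalf in h1; rewrite cos0 cos_pihalf in h2.
have cI1 : continuous (fun t => (G (sin t) + G (- sin t)) * cos t).
  apply: continuous_mul; last exact: continuous_cos.
  exact: (continuous_after (@continuous_sin R) (cfold _ cG)).
have cI2 : continuous (fun t => (H (cos t) + H (- cos t)) * - - sin t).
  apply: continuous_mul; last exact: continuous_neg.
  exact: (continuous_after (@continuous_cos R) (cfold _ cH)).
rewrite h1// h2// -integralD//=; [|exact: (continuous_itv_integrable _ _ cI1)
  |exact: (continuous_itv_integrable _ _ cI2)].
apply: (@le_trans _ _ (\int[mu]_(t in `[0%R, (pi / 2)%R]) M%:E)%E).
  apply: le_integral => //.
  - exact: integrableD (continuous_itv_integrable _ _ cI1) (continuous_itv_integrable _ _ cI2).
  - exact: (continuous_itv_integrable _ _ (@cst_continuous _ _ M)).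
  - move=> t; rewrite inE/= in_itv/= => t01.
    by rewrite -EFinD lee_fin opprK; exact: GH.
rewrite integral_cst//= lebesgue_measure_itv/= lte_fin.
case: ltP => [_|h]; first by rewrite -EFinD subr0 -EFinM.
by have := pi_gt0 R; rewrite ltNge; move: h; rewrite ler_pdivrMr// mul0r => ->.
Qed.

End LineIntegrals.

(** * Perimeter of the disc and of rectangles *)

Section GaussGreen.
Variable R : realType.
Local Notation mu := (@lebesgue_measure R).

Lemma integral_slices (E : set (R * R)) (h : R * R -> R) : compact E -> continuous h ->
  (\int[@area R]_(z in E) (h z)%:E =
   \int[mu]_x \int[mu]_(y in [set y | E (x, y)]) (h (x, y))%:E)%E.
Proof.
move=> cE ch; have iE := continuous_compact_integrable_plane cE ch.
have mE := compact_measurable_plane cE.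
have iT : (@area R).-integrable setT ((EFin \o h) \_ E) by rewrite -integrable_mkcond.
rewrite integral_mkcond -(integral12_prod_meas1 iT).
apply: eq_integral => x _; rewrite /fubini_F [RHS]integral_mkcond.
by apply: eq_integral => y _; rewrite !patchE; congr (if _ then _ else _); rewrite !inE.
Qed.

Lemma area_slices (E : set (R * R)) : compact E ->
  @area R E = (\int[mu]_x mu [set y | E (x, y)])%E.
Proof.
move=> cE; apply: eq_integral => x _ /=; congr (mu _).
by apply/seteqP; split => y /=; rewrite xsectionE.
Qed.

Definition region (a b : R) (u v : R -> R) : set (R * R) :=
  [set z | a <= z.1 <= b /\ u z.1 <= z.2 <= v z.1].

Lemma region_slice a b u v x : a <= x <= b ->
  [set y | region a b u v (x, y)] = `[u x, v x]%classic.
Proof.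
by move=> ab; apply/seteqP; split => y /=; rewrite in_itv/=; [case|split].
Qed.

Lemma region_slice0 a b u v x : ~~ (a <= x <= b) ->
  [set y | region a b u v (x, y)] = set0.
Proof. by move=> /negP ab; apply/seteqP; split => y //= -[]. Qed.

Lemma integral_region a b u v (h : R * R -> R) : compact (region a b u v) ->
  continuous h ->
  (\int[@area R]_(z in region a b u v) (h z)%:E =
   \int[mu]_(x in `[a, b]) \int[mu]_(y in `[u x, v x]) (h (x, y))%:E)%E.
Proof.
move=> cE ch; rewrite integral_slices// [RHS]integral_mkcond.
apply: eq_integral => x _; rewrite patchE; case: ifPn => xab.
  by rewrite region_slice//; move: xab; rewrite inE/= in_itv.
by rewrite region_slice0 ?integral_set0//; move: xab; rewrite notin_setE/= in_itv/= => /negP.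
Qed.

Lemma area_region a b u v : compact (region a b u v) ->
  (forall x, a <= x <= b -> u x <= v x) ->
  (@area R (region a b u v) = \int[mu]_(x in `[a, b]) (v x - u x)%:E)%E.
Proof.
move=> cE uv; rewrite area_slices// [RHS]integral_mkcond.
apply: eq_integral => x _; rewrite patchE; case: ifPn => xab.
  have {}xab : a <= x <= b by move: xab; rewrite inE/= in_itv.
  rewrite region_slice// lebesgue_measure_itv/= lte_fin; case: ifPn => //.
  rewrite -leNgt => vu; have -> : v x = u x by apply/eqP; rewrite eq_le vu uv.
  by rewrite subrr.
by rewrite region_slice0 ?measure0//; move: xab; rewrite notin_setE/= in_itv/= => /negP.
Qed.

(** Each vertical slice is a segment, on which this is the fundamental theorem of calculus. *)
Lemma gauss_green_vert a b u v (f : R * R -> R * R) : compact (region a b u v) ->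
  (forall x, a <= x <= b -> u x <= v x) -> C1 f ->
  (\int[@area R]_(z in region a b u v) ('D_(0, 1) f z).2%:E =
   \int[mu]_(x in `[a, b]) ((f (x, v x)).2 - (f (x, u x)).2)%:E)%E.
Proof.
move=> cE uv Cf; have cD : continuous (fun z => ('D_(0, 1) f z).2).
  by apply: continuous_snd_comp; case: Cf.
rewrite integral_region//; apply: eq_integral => x; rewrite inE/= in_itv/= => xab.
apply: (integral_deriveT (F := fun y => (f (x, y)).2)); first exact: uv.
- by move=> y; exact: C1_derive_vert.
- apply: (continuous_after (f := fun y : R => (x, y)) (g := fun z => ('D_(0, 1) f z).2)) cD.
  by apply: continuous_pair => y; [exact: cvg_cst|exact: cvg_id].
Qed.

(** Conjugation by the quarter turn changes the horizontal derivative of the first component into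
    the vertical derivative of the second, so [gauss_green_vert] handles both halves of a
    divergence. *)
Definition qturn : R * R -> R * R := rigid 0 1 0.
Definition turned (f : R * R -> R * R) := rotation 0 (- 1) \o f \o qturn.

Lemma qturnE (z : R * R) : qturn z = (- z.2, z.1).
Proof. by rewrite /qturn /rigid /rotation addr0; congr pair; ring. Qed.

Lemma turnedE (f : R * R -> R * R) z : turned f z = ((f (- z.2, z.1)).2, - (f (- z.2, z.1)).1).
Proof. by rewrite /turned /= qturnE /rotation; congr pair; ring. Qed.

Lemma qturn_unit : (0 : R) ^+ 2 + 1 ^+ 2 = 1.
Proof. by ring. Qed.

Lemma integral_divergence (E : set (R * R)) (f : R * R -> R * R) :
  compact E -> test_field f ->
  (\int[@area R]_(z in E) (divergence f z)%:E =
   \int[@area R]_(z in E) ('D_(0, 1) f z).2%:E +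
   \int[@area R]_(z in qturn @^-1` E) ('D_(0, 1) (turned f) z).2%:E)%E.
Proof.
move=> cE tf; have [[df cD] _ _] := tf.
have [[[dg cDg] _ _] divg] := test_field_rigid 0 qturn_unit tf.
have c1 : continuous (fun z => ('D_(1, 0) f z).1) by exact: continuous_fst_comp.
have c2 : continuous (fun z => ('D_(0, 1) f z).2) by exact: continuous_snd_comp.
have cqE : compact (qturn @^-1` E) by exact: compact_rigid_preimage qturn_unit cE.
have aq := @area_preserving_rigid R 0 1 0 qturn_unit.
have -> : (\int[@area R]_(z in qturn @^-1` E) ('D_(0, 1) (turned f) z).2%:E =
    \int[@area R]_(z in E) ('D_(1, 0) f z).1%:E)%E.
  rewrite -(area_preserving_integral aq cE cqE c1).
  apply: eq_integral => z _; congr EFin.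
  have dq := is_diff_rigid 0 1 0 z.
  have dr : is_diff (f (qturn z)) (rotation 0 (- 1)) (rotation 0 (- 1)).
    have := is_diff_rigid 0 (- 1) 0 (f (qturn z)).
    have -> : rigid 0 (- 1) 0 = rotation 0 (- 1) :> (R * R -> R * R); last by [].
    by apply/funext => w; rewrite /rigid addr0.
  have [d dE] := is_diff_comp (is_diff_comp dq (differentiableP (df (qturn z)))) dr.
  rewrite (deriveE _ d).
  have := congr1 (fun F => (F (0, 1)).2) dE => /= e.
  rewrite [LHS]e (_ : rotation 0 1 (0, 1) = (-1) *: (1, 0)); last first.
    by apply: injective_projections; rewrite /= /GRing.scale /=; ring.
  rewrite linearZ /= -(deriveE _ (df (qturn z))).
  by case: ('D_(1, 0) f _) => p q; rewrite /rotation /= /GRing.scale/=; ring.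
rewrite [RHS]addeC.
have i1 := continuous_compact_integrable_plane cE c1.
have i2 := continuous_compact_integrable_plane cE c2.
exact: (integralD_EFin (compact_measurable_plane cE) i1 i2).
Qed.

Lemma unit_dot_le1 (w z : R * R) : enorm w <= 1 -> enorm z <= 1 ->
  w.1 * z.1 + w.2 * z.2 <= 1.
Proof.
rewrite !enorm_le ?ler01// expr1n => hw hz.
by have := sqr_ge0 (w.1 - z.1); have := sqr_ge0 (w.2 - z.2); nra.
Qed.

Lemma cball01_region : cball 0 1 = region (- 1) 1 (fun x => - semicircle x) (@semicircle R).
Proof.
apply/seteqP; split => -[x y]; rewrite /cball /region /= subr0 enorm_le ?ler01//= expr1n.
  move=> h; have hx : x ^+ 2 <= 1 by have := sqr_ge0 y; lra.
  rewrite -ler_norml -(ler_sqr (x := `|x|)) ?nnegrE// real_normK ?num_real// expr1n; split=> //.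
  rewrite -ler_norml -(ler_sqr (x := `|y|)) ?nnegrE ?semicircle_ge0//.
  by rewrite real_normK ?num_real// sqr_sqrtr; lra.
move=> [hx]; rewrite -!ler_norml => hy.
have hx2 : x ^+ 2 <= 1.
  move: hx; rewrite -ler_norml -(ler_sqr (x := `|x|)) ?nnegrE//.
  by rewrite real_normK ?num_real// expr1n.
move: hy; rewrite -(ler_sqr (x := `|y|)) ?nnegrE ?semicircle_ge0//.
by rewrite real_normK ?num_real// sqr_sqrtr; lra.
Qed.

Lemma edot_continuous : continuous (fun z : R * R => edot z z).
Proof.
apply: continuous_add; apply: continuous_mul => z; try exact: cvg_fst; exact: cvg_snd.
Qed.

Lemma enorm_continuous : continuous (@enorm R).
Proof. exact: (continuous_after edot_continuous (@sqrt_continuous R)). Qed.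

Lemma closed_bounded_compact_plane (E : set (R * R)) (M : R) : closed E ->
  (forall z, E z -> enorm z <= M) -> compact E.
Proof.
move=> cE EM; apply: (@subclosed_compact _ _ (`[- M, M]%classic `*` `[- M, M]%classic)) => //.
  by apply: compact_setX; exact: segment_compact.
move=> [x y] /EM h; have M0 : 0 <= M := le_trans (enorm_ge0 _) h.
move: h; rewrite enorm_le//= => h; rewrite !in_itv/= -!ler_norml.
split; rewrite -(ler_sqr) ?nnegrE// real_normK ?num_real//.
  by have := sqr_ge0 y; lra.
by have := sqr_ge0 x; lra.
Qed.

Lemma closed_cball (z : R * R) (r : R) : closed (cball z r).
Proof.
have cf : continuous (fun x : R * R => enorm (x - z)).
  apply: (continuous_after (f := fun x : R * R => x - z)); last exact: enorm_continuous.
  by move=> x; apply: cvgB; [exact: cvg_id|exact: cvg_cst].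
rewrite (_ : cball z r = (fun x => enorm (x - z)) @^-1` [set t | t <= r]) //.
by apply: closed_comp; [move=> x _; exact: cf|exact: closed_le].
Qed.

Lemma compact_cball0 (r : R) : compact (cball (0 : R * R) r).
Proof.
apply: (@closed_bounded_compact_plane _ r); first exact: closed_cball.
by move=> z; rewrite /cball/= subr0.
Qed.

Lemma area_cball01 : @area R (cball 0 1) = pi%:E.
Proof.
have := @compact_cball0 1; rewrite cball01_region => cB.
rewrite area_region//; last by move=> x _; have := semicircle_ge0 x; lra.
transitivity (2 * 1 * (pi / 2) : R)%:E; last by congr EFin; field.
rewrite -(integral_semicircle 2 0 ltr01).
by apply: eq_integral => x _; congr EFin; rewrite divr1; ring.
Qed.

Lemma qturn_cball : qturn @^-1` (cball 0 1) = cball 0 1.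
Proof.
by apply/seteqP; split => z; rewrite /cball /= !subr0 /qturn /rigid addr0 (enorm_rot qturn_unit).
Qed.

(** After folding, the integrand at t is the sum of f . n over the four reflected points with
    coordinates sin t and cos t up to sign. Each term is at most 1, and 4 (pi / 2) = 2 pi. *)
Lemma perimeter_cball01_le : (perimeter (@cball R 0%R 1%R) <= (2 * pi)%:E)%E.
Proof.
apply: perimeter_le => f tf; have cB := @compact_cball0 1.
rewrite integral_divergence// qturn_cball cball01_region.
rewrite cball01_region in cB.
have [Cf _ f1] := tf.
have [[Cg _ _] _] := test_field_rigid 0 qturn_unit tf.
have s0 (x : R) : - 1 <= x <= 1 -> - semicircle x <= semicircle x.
  by move=> _; have := semicircle_ge0 x; lra.
rewrite [X in (X + _)%E](gauss_green_vert cB s0 Cf) [X in (_ + X)%E](gauss_green_vert (f := turned f) cB s0 Cg).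
have cf2 (p : R -> R * R) : continuous p -> continuous (fun x => (f (p x)).2).
  move=> cp; apply: (continuous_after (g := fun z => (f z).2) cp); apply: continuous_snd_comp => z.
  by apply: differentiable_continuous; case: Cf.
have cf1 (p : R -> R * R) : continuous p -> continuous (fun x => (f (p x)).1).
  move=> cp; apply: (continuous_after (g := fun z => (f z).1) cp); apply: continuous_fst_comp => z.
  by apply: differentiable_continuous; case: Cf.
have cs := @semicircle_continuous R.
have cid := @continuous_idR R.
have cNs : continuous (fun x : R => - semicircle x) by exact: continuous_neg.
have -> : (2 * pi = 4 * (pi / 2) :> R) by field.
have -> : (\int[mu]_(x in `[(- 1)%R, 1%R]) ((turned f (x, semicircle x)).2 -
   (turned f (x, - semicircle x)).2)%:E = \int[mu]_(x in `[(- 1)%R, 1%R])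
   ((f (semicircle x, x)).1 - (f (- semicircle x, x)).1)%:E)%E.
  by apply: eq_integral => x _; congr EFin; rewrite !turnedE/= !opprK; ring.
apply: integral_circle_le.
- apply: continuous_add; last apply: continuous_neg; apply: cf2; exact: continuous_pair.
- apply: continuous_add; last apply: continuous_neg; apply: cf1; exact: continuous_pair.
move=> t t01.
have sN x : semicircle (- x) = semicircle x :> R by rewrite /semicircle sqrrN.
rewrite !sN semicircle_sin// semicircle_cos//.
have cs1 := cos2Dsin2 t.
have h (e1 e2 : R) : e1 ^+ 2 = 1 -> e2 ^+ 2 = 1 ->
  (f (e1 * sin t, e2 * cos t)).1 * (e1 * sin t) +
  (f (e1 * sin t, e2 * cos t)).2 * (e2 * cos t) <= 1.
  move=> h1 h2; apply: (unit_dot_le1 (z := (e1 * sin t, e2 * cos t))) => //.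
  by rewrite enorm_le ?ler01//= !exprMn h1 h2 !mul1r addrC cs1 expr1n.
have := h 1 1; have := h 1 (-1); have := h (-1) 1; have := h (-1) (-1).
rewrite !sqrrN !expr1n !mul1r !mulN1r.
move=> /(_ erefl erefl) h1 /(_ erefl erefl) h2 /(_ erefl erefl) h3 /(_ erefl erefl) h4.
by lra.
Qed.

Definition box (l w : R) : set (R * R) := `[- l, l] `*` `[- w, w].

Lemma compact_box (l w : R) : compact (box l w).
Proof. by apply: compact_setX; exact: segment_compact. Qed.

Lemma box_region (l w : R) : box l w = region (- l) l (fun=> - w) (fun=> w).
Proof. by apply/seteqP; split => -[x y]; rewrite /box /region /= !in_itv/=. Qed.

(** A pair of opposite sides of length 2 a contributes at most 4 a, since components of the field
    are at most 1; the quarter turn exchanges the two pairs. *)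
Lemma perimeter_box_le (l w : R) : 0 < l -> 0 < w ->
  (perimeter (box l w) <= (4 * (l + w))%:E)%E.
Proof.
move=> l0 w0; apply: perimeter_le => f tf.
rewrite integral_divergence//; last exact: compact_box.
have -> : qturn @^-1` (box l w) = box w l.
  rewrite (_ : qturn = fun z => (- z.2, z.1)); last by apply/funext => z; exact: qturnE.
  apply/seteqP; split => -[x y]; rewrite /box /= !in_itv/= => -[h1 h2]; split => //.
    by move: h1 h2 => /andP[h1 h3] /andP[h2 h4]; apply/andP; split; lra.
  by move: h1 h2 => /andP[h1 h3] /andP[h2 h4]; apply/andP; split; lra.
have side (g : R * R -> R * R) (a b : R) : 0 < a -> 0 < b -> test_field g ->
    (\int[@area R]_(z in box a b) ('D_(0, 1) g z).2%:E <= (4 * a)%:E)%E.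
  move=> a0 b0 [Cg _ g1]; have := @compact_box a b; rewrite box_region => cE.
  rewrite gauss_green_vert//; last by move=> x _; lra.
  have cg (c : R) : continuous (fun x => (g (x, c)).2).
    apply: (continuous_after (f := fun x : R => (x, c)) (g := fun z => (g z).2)).
      by apply: continuous_pair => x; [exact: cvg_id|exact: cvg_cst].
    by apply: continuous_snd_comp => z; apply: differentiable_continuous; case: Cg.
  apply: (@le_trans _ _ (\int[mu]_(x in `[(- a)%R, a]) 2%:E)%E).
    apply: le_integral => //.
    - apply: continuous_itv_integrable; apply: continuous_add; first exact: cg.
      by apply: continuous_neg; exact: cg.
    - by apply: continuous_itv_integrable; exact: continuous_const.
    - move=> x _; rewrite lee_fin.
      have abs z : `|(g z).2| <= 1.
        rewrite -(ler_sqr) ?nnegrE// real_normK ?num_real//.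
        by have := g1 z; rewrite enorm_le// expr1n; have := sqr_ge0 (g z).1; lra.
      have := abs (x, b); have := abs (x, - b); rewrite !ler_norml => /andP[h1 h2] /andP[h3 h4].
      by lra.
  rewrite integral_cst//= lebesgue_measure_itv/= lte_fin gtrN// -EFinB -EFinM lee_fin.
  by lra.
have [tg _] := test_field_rigid 0 qturn_unit tf.
rewrite mulrDr EFinD; apply: leeD; first exact: side.
exact: side.
Qed.

End GaussGreen.

(** * A refined Bonnesen inequality *)

Section Cutoffs.
Variable R : realType.

(** Test fields need only be C^1, and the squared positive part is a C^1 function vanishing on a
    half line; all cutoffs are made from it. *)
Definition possq (t : R) : R := Num.max 0 t ^+ 2.

Lemma possq_ge0 t : 0 <= possq t.
Proof. exact: sqr_ge0. Qed.

Lemma possq_pos t : 0 <= t -> possq t = t ^+ 2.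
Proof. by move=> t0; rewrite /possq max_r. Qed.

Lemma possq_neg t : t <= 0 -> possq t = 0.
Proof. by move=> t0; rewrite /possq max_l// expr0n. Qed.

Lemma is_derive_possq (t : R) : is_derive t 1 possq (2 * Num.max 0 t).
Proof.
have [t0|t0|->] := ltgtP t 0.
- rewrite mulr0.
  apply: (@near_eq_is_derive _ _ _ (cst 0)).
  by near=> x; rewrite possq_neg// ltW//; near: x; exact: lt_nbhsl.
- apply: (@near_eq_is_derive _ _ _ (fun x : R => x * x)).
    by near=> x; rewrite possq_pos// ltW//; near: x; exact: lt_nbhsr.
  have h := is_deriveM (is_derive_id t (1 : R)) (is_derive_id t (1 : R)).
  by apply: (is_derive_eq h); rewrite /GRing.scale/=; ring.
rewrite mulr0.
(* At the junction point the difference quotient is at most |h|. *)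
have cv : h^-1 *: ((possq \o shift 0) (h *: 1) - possq 0) @[h --> 0^'] --> (0 : R).
  apply/cvgr0Pnorm_lt => e e0; near=> h.
  rewrite /= addr0 (possq_neg (lexx 0)) subr0 /GRing.scale/= mulr1 normrM normfV.
  have h0 : h != 0 by near: h; exact: nbhs_dnbhs_neq.
  have he : `|h| < e by near: h; apply: dnbhs0_lt.
  have hp : `|possq h| <= `|h| ^+ 2.
    rewrite ger0_norm ?possq_ge0// real_normK ?num_real//.
    have [hh|hh] := lerP 0 h; first by rewrite possq_pos.
    by rewrite possq_neg ?sqr_ge0 ?ltW.
  rewrite (le_lt_trans _ he)// mulrC ler_pdivrMr ?normr_gt0//.
apply: DeriveDef; first by apply/cvg_ex; exists 0; exact: cv.
exact: cvg_lim cv.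
Unshelve. all: by end_near. Qed.

Lemma max0_continuous : continuous (fun t : R => Num.max 0 t).
Proof.
have -> : (fun t : R => Num.max 0 t) = (fun t => 2^-1 * (t + `|t|)).
  by apply/funext => t; have [t0|t0] := lerP 0 t; [rewrite ger0_norm//|rewrite ltr0_norm//]; field.
apply: continuous_mul; first exact: continuous_const.
by apply: continuous_add; [exact: continuous_idR|exact: norm_continuous].
Qed.

(** The one-variable analogue of [gradient]. The unsimplified [dhump], [dramp], [dprofile], [dhcomp]
    and [dvcomp] are the very terms produced by the rules below. *)
Definition C1R (f f' : R -> R) := (forall t : R, is_derive t 1 f (f' t)) /\ continuous f'.

Lemma C1R_continuous f f' : C1R f f' -> continuous f.
Proof.
by move=> [df _] t; apply: differentiable_continuous; apply/derivable1_diffP; have [] := df t.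
Qed.

Lemma C1R_possq : C1R possq (fun t => 2 * Num.max 0 t).
Proof.
split; first exact: is_derive_possq.
by apply: continuous_mul; [exact: continuous_const|exact: max0_continuous].
Qed.

Lemma C1R_cst c : C1R (fun=> c) (fun=> 0).
Proof. by split; [move=> t; exact: is_derive_cst|exact: continuous_const]. Qed.

Lemma C1R_id : C1R id (fun=> 1).
Proof. by split; [move=> t; exact: is_derive_id|exact: continuous_const]. Qed.

Lemma C1R_add f f' g g' : C1R f f' -> C1R g g' ->
  C1R (fun t => f t + g t) (fun t => f' t + g' t).
Proof.
move=> [df cf] [dg cg]; split; last exact: continuous_add.
by move=> t; exact: is_deriveD (df t) (dg t).
Qed.

Lemma C1R_mul f f' g g' : C1R f f' -> C1R g g' ->
  C1R (fun t => f t * g t) (fun t => f' t * g t + f t * g' t).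
Proof.
move=> Cf Cg; have cf := C1R_continuous Cf; have cg := C1R_continuous Cg.
case: Cf Cg => [df cf'] [dg cg']; split; last by apply: continuous_add; exact: continuous_mul.
move=> t; apply: (is_derive_eq (is_deriveM (df t) (dg t))).
by rewrite /GRing.scale/= addrC [g t * _]mulrC.
Qed.

Lemma C1R_comp f f' g g' : C1R f f' -> C1R g g' ->
  C1R (fun t => f (g t)) (fun t => f' (g t) * g' t).
Proof.
move=> [df cf] Cg; have cg := C1R_continuous Cg; case: Cg => dg cg'; split.
  by move=> t; exact: is_derive1_comp (df (g t)) (dg t).
by apply: continuous_mul => //; exact: continuous_after cf.
Qed.

Lemma C1R_sqrt f f' : C1R f f' -> (forall t, 0 < f t) ->
  C1R (fun t => Num.sqrt (f t)) (fun t => (2 * Num.sqrt (f t))^-1 * f' t).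
Proof.
move=> Cf f0; have cf := C1R_continuous Cf; case: Cf => df cf'; split.
  by move=> t; exact: is_derive1_comp (is_derive1_sqrt (f0 t)) (df t).
apply: continuous_mul => // t; apply: cvgV.
  by rewrite mulf_neq0// gt_eqF// sqrtr_gt0.
by apply: cvgM; [exact: cvg_cst|exact: (continuous_after cf (@sqrt_continuous R))].
Qed.

(** For d > 0 this is a C^1 cutoff, equal to 1 for |t| <= 1 + d and to 0 for |t| >= 1 + 2 d. The
    inner sum is the squared positive part of |t| - (1 + d), and the outer [possq] truncates at
    0. *)
Definition hump (d t : R) : R :=
  possq (1 + - d ^- 2 * (possq (t + - (1 + d)) + possq (-1 * t + - (1 + d)))).
Definition dhump (d t : R) : R :=
  2 * Num.max 0 (1 + - d ^- 2 * (possq (t + - (1 + d)) + possq (-1 * t + - (1 + d)))) *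
  (0 + (0 * (possq (t + - (1 + d)) + possq (-1 * t + - (1 + d))) + - d ^- 2 *
    (2 * Num.max 0 (t + - (1 + d)) * (1 + 0) +
     2 * Num.max 0 (-1 * t + - (1 + d)) * ((0 * t + -1 * 1) + 0)))).

Lemma C1R_hump d : C1R (hump d) (dhump d).
Proof.
have C1 := C1R_comp C1R_possq (C1R_add C1R_id (C1R_cst (- (1 + d)))).
have C2 := C1R_comp C1R_possq
  (C1R_add (C1R_mul (C1R_cst (-1)) C1R_id) (C1R_cst (- (1 + d)))).
exact: C1R_comp C1R_possq (C1R_add (C1R_cst 1) (C1R_mul (C1R_cst (- d ^- 2)) (C1R_add C1 C2))).
Qed.

Lemma hump1 d t : 0 < d -> `|t| <= 1 + d -> hump d t = 1 /\ dhump d t = 0.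
Proof.
move=> d0; rewrite ler_norml => /andP[h1 h2]; rewrite /hump /dhump.
have e1 : t + - (1 + d) <= 0 by lra.
have e2 : -1 * t + - (1 + d) <= 0 by lra.
rewrite (possq_neg e1) (possq_neg e2) !(max_l e1) !(max_l e2) addr0 mulr0 addr0.
by rewrite possq_pos// expr1n; split => //; ring.
Qed.

Lemma hump0 d t : 0 < d -> 1 + 2 * d <= `|t| -> hump d t = 0.
Proof.
move=> d0 h; rewrite /hump possq_neg//.
suff : d ^+ 2 <= possq (t + - (1 + d)) + possq (-1 * t + - (1 + d)).
  move: (_ + possq _) => S dS.
  have : 1 <= d ^- 2 * S by rewrite mulrC ler_pdivlMr ?exprn_gt0// mul1r.
  by lra.
have [t0|t0] := lerP 0 t.
  rewrite ger0_norm// in h; rewrite ler_wpDr ?possq_ge0// possq_pos; last lra.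
  by rewrite ler_pXn2r// ?nnegrE; lra.
rewrite ltr0_norm// in h; rewrite ler_wpDl ?possq_ge0// possq_pos; last lra.
by rewrite ler_pXn2r// ?nnegrE; lra.
Qed.

Lemma hump_itv d t : 0 <= hump d t <= 1.
Proof.
rewrite possq_ge0 /hump /=.
set u := 1 + _; have u1 : u <= 1.
  have : 0 <= d ^- 2 * (possq (t + - (1 + d)) + possq (-1 * t + - (1 + d))).
    by rewrite mulr_ge0 ?addr_ge0 ?possq_ge0// invr_ge0 sqr_ge0.
  by rewrite /u; lra.
have [u0|u0] := lerP 0 u; last by rewrite possq_neg ?ltW// ler01.
by rewrite possq_pos// expr_le1.
Qed.

(** A nondecreasing C^1 version of the sign, equal to -1 for t <= -1 and to 1 for t >= 1: the second
    difference of [possq], shifted by -1. *)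
Definition ramp (t : R) : R :=
  possq (t + 1) + -2 * possq t + possq (t + -1) + -1.
Definition dramp (t : R) : R :=
  2 * Num.max 0 (t + 1) * (1 + 0) + (0 * possq t + -2 * (2 * Num.max 0 t)) +
  2 * Num.max 0 (t + -1) * (1 + 0) + 0.

Lemma C1R_ramp : C1R ramp dramp.
Proof.
have C1 := C1R_comp C1R_possq (C1R_add C1R_id (C1R_cst 1)).
have C2 := C1R_comp C1R_possq (C1R_add C1R_id (C1R_cst (-1))).
exact: C1R_add (C1R_add (C1R_add C1 (C1R_mul (C1R_cst (-2)) C1R_possq)) C2) (C1R_cst (-1)).
Qed.

Lemma dramp_ge0 t : 0 <= dramp t.
Proof.
rewrite /dramp.
have [h1|h1] := lerP 0 (t + 1); have [h2|h2] := lerP 0 t; have [h3|h3] := lerP 0 (t + -1); lra.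
Qed.

Lemma ramp_itv t : -1 <= ramp t <= 1.
Proof.
rewrite /ramp /possq.
have [h1|h1] := lerP 0 (t + 1); have [h2|h2] := lerP 0 t; have [h3|h3] := lerP 0 (t + -1);
  rewrite ?expr0n/=; apply/andP; split; nra.
Qed.

Lemma ramp1 : ramp 1 = 1.
Proof. by rewrite /ramp !possq_pos; [ring|lra..]. Qed.

Lemma rampN1 : ramp (-1) = -1.
Proof. by rewrite /ramp !possq_neg; [ring|lra..]. Qed.

End Cutoffs.

(** * The test field: unit length, support, divergence *)

Section BonnesenField.
Variable R : realType.
Local Notation mu := (@lebesgue_measure R).
Variables (eta a d e l0 l1 M : R).

Let sg := (1 + 7 * d)^-1.

Definition profile (t : R) : R := t + eta * (1 + -1 * (t * t)).
Definition dprofile (t : R) : R := 1 + (0 * (1 + -1 * (t * t)) +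
  eta * (0 + (0 * (t * t) + -1 * (1 * t + t * 1)))).

Lemma C1R_profile : C1R profile dprofile.
Proof.
exact: C1R_add (@C1R_id R) (C1R_mul (C1R_cst eta) (C1R_add (C1R_cst 1)
  (C1R_mul (C1R_cst (-1)) (C1R_mul (@C1R_id R) (@C1R_id R))))).
Qed.

(* The factor [sg] keeps the horizontal component below 1 on the support of
   the cutoff [hump], where [profile] exceeds 1. *)
Definition hcomp (x : R) : R := sg * (hump d (x * a^-1) * profile (x * a^-1)).
Definition dhcomp (x : R) : R := 0 * (hump d (x * a^-1) * profile (x * a^-1)) +
  sg * (dhump d (x * a^-1) * (1 * a^-1 + x * 0) * profile (x * a^-1) +
    hump d (x * a^-1) * (dprofile (x * a^-1) * (1 * a^-1 + x * 0))).

Lemma C1R_hcomp : C1R hcomp dhcomp.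
Proof.
have Cs := C1R_mul (@C1R_id R) (C1R_cst a^-1).
exact: C1R_mul (C1R_cst sg) (C1R_mul (C1R_comp (C1R_hump d) Cs) (C1R_comp C1R_profile Cs)).
Qed.

Lemma sg_gt0 : 0 < d -> 0 < sg.
Proof. by move=> d0; rewrite invr_gt0; lra. Qed.

(** With p the profile, 1 - p = (1 - t) (1 - eta (1 + t)) and 1 + p = (1 + t) (1 + eta (1 - t)), and
    all factors are nonnegative. *)
Lemma profile_le1 t : `|eta| <= 1 / 4 -> `|t| <= 1 -> `|profile t| <= 1.
Proof.
rewrite !ler_norml /profile => /andP[h1 h2] /andP[t1 t2].
have e1 : 0 <= 1 + eta * (1 - t) by nra.
have e2 : 0 <= 1 - eta * (1 + t) by nra.
have : 0 <= (1 + t) * (1 + eta * (1 - t)) by rewrite mulr_ge0//; lra.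
have : 0 <= (1 - t) * (1 - eta * (1 + t)) by rewrite mulr_ge0//; lra.
by move=> h3 h4; apply/andP; split; lra.
Qed.

(** What counts is to stay strictly below 1 + 7 d, the inverse of [sg]: then [hcomp] is less than 1
    in modulus, and [vcomp], as the root of a positive function, is C^1. *)
Lemma profile_le t : `|eta| <= 1 / 4 -> 0 < d -> d <= 1 ->
  `|t| <= 1 + 2 * d -> `|profile t| <= 1 + 6 * d.
Proof.
move=> eta4 d0 d1; have [t1 _|t1 h] := lerP `|t| 1.
  by rewrite (le_trans (profile_le1 eta4 t1))//; lra.
rewrite /profile (le_trans (ler_normD _ _))// normrM.
have t2 : `|t * t| = `|t| * `|t| by rewrite normrM.
have : `|1 + -1 * (t * t)| <= 8 * d.
  have tt : 1 <= t * t.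
    have : 0 <= t * t by rewrite -expr2 sqr_ge0.
    by move=> /ger0_norm <-; rewrite t2; nra.
  rewrite ler0_norm; last lra.
  have : t * t = `|t| * `|t| by rewrite -t2 ger0_norm//; lra.
  by move=> ->; nra.
by move=> h2; have := normr_ge0 eta; nra.
Qed.

Hypotheses (eta4 : `|eta| <= 1 / 4) (a0 : 0 < a) (d0 : 0 < d) (d1 : d <= 1)
  (e0 : 0 < e) (M0 : 0 < M).

Lemma hcomp_lt1 x : hcomp x ^+ 2 < 1.
Proof.
have sg0 := sg_gt0 d0; have d0' := d0; rewrite /hcomp.
have [h|h] := lerP (1 + 2 * d) `|x * a^-1|.
  by rewrite hump0// mul0r mulr0 expr0n ltr01.
have sgE : sg * (1 + 7 * d) = 1 by rewrite /sg mulVf// gt_eqF//; lra.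
rewrite -real_normK ?num_real// expr_lt1// normrM (gtr0_norm sg0) normrM.
have /andP[b0 b1] := hump_itv d (x * a^-1); rewrite (ger0_norm b0).
have := profile_le eta4 d0 d1 (ltW h); set p := `|_|; have p0 : 0 <= p by exact: normr_ge0.
move=> hp; have : hump d (x * a^-1) * p <= 1 + 6 * d by nra.
by move=> hb; nra.
Qed.

Definition vcomp (x : R) : R := Num.sqrt (1 + -1 * (hcomp x * hcomp x)).
Definition dvcomp (x : R) : R := (2 * Num.sqrt (1 + -1 * (hcomp x * hcomp x)))^-1 *
  (0 + (0 * (hcomp x * hcomp x) + -1 * (dhcomp x * hcomp x + hcomp x * dhcomp x))).

Lemma C1R_vcomp : C1R vcomp dvcomp.
Proof.
apply: C1R_sqrt => [|t]; last by have := hcomp_lt1 t; lra.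
exact: C1R_add (C1R_cst 1) (C1R_mul (C1R_cst (-1)) (C1R_mul C1R_hcomp C1R_hcomp)).
Qed.

Lemma hcomp_vcomp x : hcomp x ^+ 2 + vcomp x ^+ 2 = 1.
Proof. by have := hcomp_lt1 x => h; rewrite /vcomp sqr_sqrtr; [ring|lra]. Qed.

Lemma vcomp_ge0 x : 0 <= vcomp x. Proof. exact: sqrtr_ge0. Qed.

(** Where the cutoff is 1, the horizontal part of the divergence is affine in x, so its integral
    over E involves only the area and the first moment. *)
Lemma dhcompE x : `|x| <= (1 + d) * a ->
  dhcomp x = sg * a^-1 * (1 - 2 * eta * (x / a)).
Proof.
move=> xa; have h : `|x * a^-1| <= 1 + d.
  by rewrite normrM normfV (gtr0_norm a0) ler_pdivrMr.
by have [b1 db0] := hump1 d0 h; rewrite /dhcomp b1 db0 /dprofile; ring.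
Qed.

(** With t = x / a and p the profile, 1 - p^2 = (1 - t^2) (1 - 2 eta t - eta^2 (1 - t^2)). The root
    of the last factor is 1 - eta t up to order eta^2, and 5 eta^2 absorbs the error when |eta| <=
    1/4. The factor [sg] <= 1 only enlarges [vcomp]. *)
Lemma vcomp_ge x : `|x| <= a ->
  semicircle (x / a) * (1 - 5 * eta ^+ 2 - eta * (x / a)) <= vcomp x.
Proof.
move=> xa; have t1 : `|x / a| <= 1 by rewrite normrM normfV (gtr0_norm a0) ler_pdivrMr ?mul1r.
have h : `|x * a^-1| <= 1 + d by have := d0; lra.
have [b1 _] := hump1 d0 h; rewrite /vcomp /hcomp b1 mul1r.
rewrite /semicircle; move: (x / a) t1 {h b1 xa} => t; rewrite ler_norml => /andP[t1 t2].
have ht : 0 <= 1 - t ^+ 2 by nra.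
set r := _ - eta * t; rewrite (le_trans (ler_norm _))// normrM (ger0_norm (sqrtr_ge0 _)).
rewrite -sqrtr_sqr -sqrtrM//; apply: ler_wsqrtr.
have sg1 : sg <= 1 by have d0' := d0; rewrite /sg invf_le1; lra.
have sg0 := sg_gt0 d0.
have : (sg * profile t) * (sg * profile t) <= profile t ^+ 2.
  rewrite mulrACA -!expr2 ler_piMl ?sqr_ge0//; nra.
suff : (1 - t ^+ 2) * r ^+ 2 <= 1 - profile t ^+ 2 by lra.
have -> : 1 - profile t ^+ 2 = (1 - t ^+ 2) * (1 - 2 * eta * t - eta ^+ 2 * (1 - t ^+ 2)).
  by rewrite /profile; ring.
apply: ler_wpM2l => //; rewrite -subr_ge0 /r.
have -> : 1 - 2 * eta * t - eta ^+ 2 * (1 - t ^+ 2) - (1 - 5 * eta ^+ 2 - eta * t) ^+ 2 =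
  eta ^+ 2 * (9 - 10 * (eta * t) - 25 * eta ^+ 2) by ring.
rewrite mulr_ge0 ?sqr_ge0//; move: eta4; rewrite ler_norml => /andP[h1 h2].
have : eta * t <= 1 / 4 by nra.
have : eta ^+ 2 <= 1 / 16 by nra.
by lra.
Qed.

(** Signed vertical distance to the line y = l0 + l1 x, in units of e. The constants are written
    with [cst] to match the rules for [gradient]. *)
Definition height (z : R * R) : R := (z.2 + (cst (- l0) z + cst (- l1) z * z.1)) * cst e^-1 z.

Definition cutoff (z : R * R) : R := hump 1 (z.1 * cst M^-1 z) * hump 1 (z.2 * cst M^-1 z).

Definition bonnesen_field (z : R * R) : R * R :=
  (cutoff z * hcomp z.1, cutoff z * (vcomp z.1 * ramp (height z))).

Definition bonnesen_div (z : R * R) : R :=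
  dhcomp z.1 + vcomp z.1 * (dramp (height z) * e^-1).

Lemma gradient_height : exists hx hy, gradient height hx hy /\ forall z, hy z = e^-1.
Proof.
have g := gradientM (gradientD (@gradient_snd R) (gradientD (gradient_cst (- l0))
  (gradientM (gradient_cst (- l1)) (@gradient_fst R)))) (gradient_cst e^-1).
by do 2 eexists; split; [exact: g|move=> z /=; ring].
Qed.

Lemma gradient_cutoff : exists cx cy, gradient cutoff cx cy /\
  forall z, `|z.1| <= M -> `|z.2| <= M -> [/\ cutoff z = 1, cx z = 0 & cy z = 0].
Proof.
have [d1' c1'] := C1R_hump (1 : R).
have g1 := gradient_comp d1' c1' (gradientM (@gradient_fst R) (gradient_cst M^-1)).
have g2 := gradient_comp d1' c1' (gradientM (@gradient_snd R) (gradient_cst M^-1)).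
do 2 eexists; split; first exact: (gradientM g1 g2).
move=> z h1 h2.
have m (t : R) : `|t| <= M -> `|t * M^-1| <= 1 + 1.
  move=> tM; rewrite normrM normfV (gtr0_norm M0) ler_pdivrMr//.
  by have := normr_ge0 t; have := M0; lra.
have [e1 e2] := hump1 ltr01 (m _ h1); have [e3 e4] := hump1 ltr01 (m _ h2).
by rewrite /cutoff /= e1 e2 e3 e4; split; ring.
Qed.

Lemma bonnesen_fieldP : C1 bonnesen_field /\ forall z, `|z.1| <= M -> `|z.2| <= M ->
  divergence bonnesen_field z = bonnesen_div z.
Proof.
have [hx [hy [gh hyE]]] := gradient_height.
have [cx [cy [gc cE]]] := gradient_cutoff.
have [dh ch] := C1R_hcomp; have [dv cv] := C1R_vcomp; have [dr cr] := C1R_ramp R.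
have gf1 := gradientM gc (gradient_comp dh ch (@gradient_fst R)).
have gf2 := gradientM gc (gradientM (gradient_comp dv cv (@gradient_fst R))
  (gradient_comp dr cr gh)).
have [Cf divE] := gradient_pair gf1 gf2.
split; first exact: Cf.
move=> z h1 h2; rewrite /bonnesen_field divE.
have [-> -> ->] := cE z h1 h2.
by rewrite /bonnesen_div hyE /=; ring.
Qed.

(** The length is at most 1 because hcomp^2 + vcomp^2 = 1, while [ramp] and [cutoff] are at most 1
    in modulus. *)
Lemma test_bonnesen_field : test_field bonnesen_field.
Proof.
split; first exact: bonnesen_fieldP.1.
- rewrite /compactly_supported.
  apply: (@subclosed_compact _ _ (box (3 * M) (3 * M))); [exact: closed_closure|exact: compact_box|].
  have cl : closed (box (3 * M) (3 * M)).
    by apply: compact_closed; [exact: norm_hausdorff|exact: compact_box].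
  rewrite [X in _ `<=` X](closure_id _).1//; apply: closure_subset => -[x y] /= f0.
  have out (t : R) : ~~ (- (3 * M) <= t <= 3 * M) -> hump 1 (t * M^-1) = 0.
    move=> ht; apply: hump0 => //; rewrite normrM normfV (gtr0_norm M0) ler_pdivlMr//.
    move: ht; rewrite -ler_norml -ltNge; have := M0; lra.
  split; apply: contraNT f0; rewrite /= in_itv/= => /out h;
    by rewrite /bonnesen_field /cutoff /= h ?mul0r ?mulr0 ?mul0r.
- move=> z; rewrite enorm_le ?ler01// expr1n /=.
  rewrite -(hcomp_vcomp z.1).
  rewrite [(_ * hcomp _) ^+ 2]exprMn [(_ * (vcomp _ * _)) ^+ 2]exprMn [(vcomp _ * _) ^+ 2]exprMn.
  have /andP[b0 b1] : 0 <= cutoff z <= 1.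
    have /andP[p0 p1] := hump_itv 1 (z.1 * cst M^-1 z).
    have /andP[q0 q1] := hump_itv 1 (z.2 * cst M^-1 z).
    by rewrite /cutoff mulr_ge0//= mulr_ile1.
  have c2 : 0 <= cutoff z ^+ 2 <= 1 by rewrite sqr_ge0 expr_le1.
  have r2 : ramp (height z) ^+ 2 <= 1.
    by have /andP[] := ramp_itv (height z); nra.
  case/andP: c2 => c20 c21.
  have := sqr_ge0 (hcomp z.1); have := sqr_ge0 (vcomp z.1); have := sqr_ge0 (ramp (height z)).
  move: (cutoff z ^+ 2) (hcomp z.1 ^+ 2) (vcomp z.1 ^+ 2) (ramp (height z) ^+ 2) c20 c21 r2 => c h v r.
  move=> c0 c1 r1 rr vv hh; apply: lerD; first by nra.
  have : c * v <= v by nra.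
  by move=> cv; rewrite mulrA (le_trans _ cv)// ler_piMr// mulr_ge0.
Qed.

End BonnesenField.

(** * The flux of the test field through a convex set *)

Section BonnesenBound.
Variable R : realType.
Local Notation mu := (@lebesgue_measure R).

Lemma height_continuous (e l0 l1 : R) : continuous (height e l0 l1).
Proof. by have [hx [hy [/gradient_continuous]]] := gradient_height e l0 l1. Qed.

Lemma compact_strip (a e l0 l1 : R) : compact (region (- a) a
  (fun x => l0 + l1 * x - e) (fun x => l0 + l1 * x + e)).
Proof.
have cf1 : continuous (fun z : R * R => z.1) by move=> z; exact: cvg_fst.
have cf2 : continuous (fun z : R * R => z.2) by move=> z; exact: cvg_snd.
have cl : continuous (fun z : R * R => z.2 + - (l0 + l1 * z.1)).
  apply: continuous_add => //; apply: continuous_neg; apply: continuous_add.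
    exact: continuous_const.
  by apply: continuous_mul => //; exact: continuous_const.
have -> : region (- a) a (fun x => l0 + l1 * x - e) (fun x => l0 + l1 * x + e) =
    (fun z : R * R => z.1) @^-1` `[- a, a] `&`
    (fun z : R * R => z.2 + - (l0 + l1 * z.1)) @^-1` `[- e, e].
  apply/seteqP; split => -[x y]; rewrite /region /= !in_itv/=.
    by move=> [-> /andP[h1 h2]]; split => //; apply/andP; split; lra.
  by move=> [-> /andP[h1 h2]]; split => //; apply/andP; split; lra.
apply: (@closed_bounded_compact_plane _ _ (`|a| + (`|l0| + `|l1| * `|a| + `|e|))).
  apply: closedI; apply: closed_comp => [z _|]; [exact: cf1|exact: itv_closed|exact: cl|exact: itv_closed].
move=> [x y] /=; rewrite !in_itv/= -!ler_norml => -[hx hy].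
have h1 : `|x| <= `|a| by rewrite (le_trans hx)// ler_norm.
have h2 : `|y| <= `|l0| + `|l1| * `|a| + `|e|.
  have -> : y = (l0 + l1 * x) + (y + - (l0 + l1 * x)) by ring.
  rewrite (le_trans (ler_normD _ _))// lerD//; last by rewrite (le_trans hy)// ler_norm.
  by rewrite (le_trans (ler_normD _ _))// lerD2l normrM ler_wpM2l.
have nx := normr_ge0 x; have ny := normr_ge0 y.
rewrite enorm_le; last by lra.
rewrite /= -(real_normK (num_real x)) -(real_normK (num_real y)).
by nra.
Qed.

(** The vertical part of the divergence is nonnegative and concentrated in a strip contained in E.
    Across the strip [ramp] climbs from -1 to 1, so each vertical line contributes exactly 2
    [vcomp], independently of E. *)
Lemma bonnesen_aux (E : set (R * R)) (eta a d e l0 l1 : R) :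
  compact E -> `|eta| <= 1 / 4 -> 0 < a -> 0 < d -> d <= 1 -> 0 < e ->
  (forall z, E z -> `|z.1| <= (1 + d) * a) ->
  region (- a) a (fun x => l0 + l1 * x - e) (fun x => l0 + l1 * x + e) `<=` E ->
  (\int[@area R]_(z in E) ((1 + 7 * d)^-1 * a^-1 * (1 - 2 * eta * (z.1 / a)))%:E +
    (a * pi * (1 - 5 * eta ^+ 2))%:E <= perimeter E)%E.
Proof.
move=> cE eta4 a0 d0 d1 e0 Ea SE.
have [M M0 EM] := compact_bounded_plane cE.
have tf := @test_bonnesen_field R eta a d e l0 l1 M eta4 d0 d1 M0.
apply: le_trans (perimeter_ge E tf).
have [_ divE] := @bonnesen_fieldP R eta a d e l0 l1 M eta4 d0 d1 M0.
have ch : continuous (height e l0 l1) by exact: height_continuous.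
have cf1 : continuous (fun z : R * R => z.1) by move=> z; exact: cvg_fst.
have cP : continuous (fun z : R * R => (1 + 7 * d)^-1 * a^-1 * (1 - 2 * eta * (z.1 / a))).
  apply: continuous_mul; first exact: continuous_const.
  apply: continuous_add; first exact: continuous_const.
  apply: continuous_neg; apply: continuous_mul; first exact: continuous_const.
  by apply: continuous_mul => //; exact: continuous_const.
have cv : continuous (vcomp eta a d) := C1R_continuous (C1R_vcomp a eta4 d0 d1).
have [dramp' cdr] := C1R_ramp R.
have cQ : continuous (fun z : R * R => vcomp eta a d z.1 * (dramp (height e l0 l1 z) * e^-1)).
  apply: continuous_mul; first exact: continuous_after cf1 cv.
  by apply: continuous_mul; [exact: continuous_after ch cdr|exact: continuous_const].
have mE := compact_measurable_plane cE.
have -> : (\int[@area R]_(z in E) (divergence (bonnesen_field eta a d e l0 l1 M) z)%:E =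
  \int[@area R]_(z in E) ((1 + 7 * d)^-1 * a^-1 * (1 - 2 * eta * (z.1 / a)))%:E +
  \int[@area R]_(z in E) (vcomp eta a d z.1 * (dramp (height e l0 l1 z) * e^-1))%:E)%E.
  rewrite -[RHS](integralD_EFin mE (continuous_compact_integrable_plane cE cP)
    (continuous_compact_integrable_plane cE cQ)).
  apply: eq_integral => z; rewrite inE => Ez; congr EFin.
  have [h1 h2] := EM z Ez; rewrite (divE z h1 h2) /bonnesen_div.
  by rewrite (dhcompE eta a0 d0 (Ea z Ez)).
apply: leeD => //.
have cS := @compact_strip a e l0 l1.
set S := region _ _ _ _ in SE cS *.
have Q0 z : 0 <= vcomp eta a d z.1 * (dramp (height e l0 l1 z) * e^-1).
  by rewrite mulr_ge0 ?vcomp_ge0// mulr_ge0 ?dramp_ge0// invr_ge0 ltW.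
(* Nothing negative is lost by integrating over the strip instead of E. *)
apply: (@le_trans _ _ (\int[@area R]_(z in S)
   (vcomp eta a d z.1 * (dramp (height e l0 l1 z) * e^-1))%:E)%E); last first.
  apply: ge0_subset_integral => //.
  - exact: compact_measurable_plane cS.
  - by apply/measurable_EFinP/measurable_funTS; exact: continuous_measurable_plane cQ.
  - by move=> z _; rewrite lee_fin.
rewrite integral_region//.
have inner x : (\int[mu]_(y in `[(l0 + l1 * x - e)%R, (l0 + l1 * x + e)%R])
    (vcomp eta a d x * (dramp (height e l0 l1 (x, y)) * e^-1))%:E)%E = (2 * vcomp eta a d x)%:E.
  have Cy := C1R_mul (C1R_add (@C1R_id R) (C1R_cst (- l0 + - l1 * x))) (C1R_cst e^-1).
  have [dF cF] := C1R_mul (C1R_cst (vcomp eta a d x)) (C1R_comp (C1R_ramp R) Cy).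
  transitivity (vcomp eta a d x * ramp ((l0 + l1 * x + e + (- l0 + - l1 * x)) * e^-1) -
     vcomp eta a d x * ramp ((l0 + l1 * x - e + (- l0 + - l1 * x)) * e^-1))%:E; last first.
    rewrite (_ : (l0 + l1 * x + e + _) * _ = 1); last by field; rewrite gt_eqF.
    rewrite (_ : (l0 + l1 * x - e + _) * _ = -1); last by field; rewrite gt_eqF.
    by rewrite ramp1 rampN1; congr EFin; ring.
  rewrite -(integral_deriveT _ dF cF); last by lra.
  by apply: eq_integral => y _; congr EFin; rewrite /height /=; ring.
rewrite [leRHS](_ : _ = (\int[mu]_(x in `[(- a)%R, a]) (2 * vcomp eta a d x)%:E)%E); last first.
  by apply: eq_integral => x _; exact: inner.
have -> : (a * pi * (1 - 5 * eta ^+ 2) = 2 * (1 - 5 * eta ^+ 2) * a * (pi / 2) :> R) by field.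
rewrite -(integral_semicircle _ (- (2 * eta / a)) a0).
have cs : continuous (fun x : R => semicircle (x / a)).
  apply: (continuous_after (f := fun x : R => x / a)); last exact: semicircle_continuous.
  by apply: continuous_mul; [exact: continuous_idR|exact: continuous_const].
apply: le_integral => //.
- apply: continuous_itv_integrable; apply: continuous_mul => //.
  apply: continuous_add; first exact: continuous_const.
  by apply: continuous_mul; [exact: continuous_const|exact: continuous_idR].
- by apply: continuous_itv_integrable; apply: continuous_mul => //; exact: continuous_const.
- move=> x; rewrite inE/= in_itv/= -ler_norml => xa; rewrite lee_fin.
  have := vcomp_ge eta4 a0 d0 xa.
  have -> : semicircle (x / a) * (2 * (1 - 5 * eta ^+ 2) + - (2 * eta / a) * x) =
     2 * (semicircle (x / a) * (1 - 5 * eta ^+ 2 - eta * (x / a))) by ring.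
  by lra.
Qed.

Definition cvx (E : set (R * R)) := forall x y t, E x -> E y -> 0 <= t -> t <= 1 ->
  E ((1 - t) *: x + t *: y).

(** The chord joining the contact points may lie in the boundary of E, leaving no room for a strip.
    It is therefore mixed, with weight d / (1 + d), with a vertical segment of E at x = 0: by
    convexity a strip of positive height over half-width a / (1 + d) fits in E. Then d tends to
    0. *)
Lemma bonnesen (E : set (R * R)) (eta a h y0 yA yB : R) :
  compact E -> cvx E -> `|eta| <= 1 / 4 -> 0 < a -> 0 < h ->
  (forall z, E z -> `|z.1| <= a) -> E (- a, yA) -> E (a, yB) ->
  (forall y, `|y - y0| <= h -> E (0, y)) ->
  (\int[@area R]_(z in E) (a^-1 * (1 - 2 * eta * (z.1 / a)))%:E +
    (a * pi * (1 - 5 * eta ^+ 2))%:E <= perimeter E)%E.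
Proof.
move=> cE xE eta4 a0 h0 Ea EA EB EO.
set I := (\int[@area R]_(z in E) _)%E.
have cf1 : continuous (fun z : R * R => z.1) by move=> z; exact: cvg_fst.
have mE := compact_measurable_plane cE.
have clin (k : R) : continuous (fun z : R * R => k * z.1).
  by apply: continuous_mul => //; exact: continuous_const.
have i1 : (@area R).-integrable E (EFin \o (fun=> 1)).
  by apply: continuous_compact_integrable_plane => //; exact: continuous_const.
have i2 : (@area R).-integrable E (EFin \o (fun z => z.1)).
  exact: continuous_compact_integrable_plane.
have aff (k l : R) : (\int[@area R]_(z in E) (k + l * z.1)%:E =
    (k * fine (\int[@area R]_(z in E) 1%:E) + l * fine (\int[@area R]_(z in E) (z.1)%:E))%:E)%E.
  have j1 : (@area R).-integrable E (EFin \o (fun=> k)).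
    by apply: continuous_compact_integrable_plane => //; exact: continuous_const.
  have j2 : (@area R).-integrable E (EFin \o (fun z => l * z.1)).
    exact: continuous_compact_integrable_plane.
  rewrite [LHS](integralD_EFin mE j1 j2) EFinD !EFinM; congr (_ + _)%E.
    rewrite fineK; last exact: integrable_fin_num i1.
    rewrite -integralZl//; apply: eq_integral => z _.
    by rewrite /= mule1.
  rewrite fineK; last exact: integrable_fin_num i2.
  by rewrite -integralZl.
set m := fine _ in aff; set m1 := fine _ in aff.
(* The bound of [bonnesen_aux] for the half-width a / (1 + d); m and m1 are the area and the first
   moment of E, and g 0 is the bound to be proved. *)
pose g (d : R) := (1 + 7 * d)^-1 * (a * (1 + d)^-1)^-1 * (m - 2 * eta * (a * (1 + d)^-1)^-1 * m1)
   + (a * (1 + d)^-1) * pi * (1 - 5 * eta ^+ 2).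
have IE : (I + (a * pi * (1 - 5 * eta ^+ 2))%:E = (g 0)%:E)%E.
  transitivity ((\int[@area R]_(z in E) (a^-1 + - (2 * eta * a^-1 * a^-1) * z.1)%:E)%E +
    (a * pi * (1 - 5 * eta ^+ 2))%:E)%E.
    by congr (_ + _)%E; apply: eq_integral => z _; congr EFin; ring.
  by rewrite aff -EFinD /g; congr EFin; rewrite mulr0 !addr0 invr1 !mulr1; ring.
rewrite IE.
have step d : 0 < d -> d <= 1 -> ((g d)%:E <= perimeter E)%E.
  move=> d0 d1; pose a' := a * (1 + d)^-1; pose t := d * (1 + d)^-1.
  have dp : 0 < 1 + d by lra.
  have dn : 1 + d != 0 by rewrite gt_eqF.
  have a'0 : 0 < a' by rewrite mulr_gt0// invr_gt0.
  have t0 : 0 < t by rewrite mulr_gt0// invr_gt0.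
  have t1 : t <= 1 by rewrite ler_pdivrMr// mul1r; lra.
  pose l1 := (yB - yA) / (2 * a).
  pose l0 := (1 - t) * ((yA + yB) / 2) + t * y0.
  have Ea' z : E z -> `|z.1| <= (1 + d) * a'.
    by move=> /Ea h1; rewrite /a' mulrCA mulfV// mulr1.
  have strip : region (- a') a' (fun x => l0 + l1 * x - t * h) (fun x => l0 + l1 * x + t * h) `<=` E.
    move=> [x y]; rewrite /region /= => -[/andP[x1 x2] /andP[y1 y2]].
    pose s := (x / a' + 1) / 2.
    have xa : -1 <= x / a' <= 1.
      by rewrite ler_pdivrMr// ler_pdivlMr// mulN1r mul1r x1 x2.
    have s0 : 0 <= s by case/andP: xa => ? ?; rewrite /s; lra.
    have s1 : s <= 1 by case/andP: xa => ? ?; rewrite /s; lra.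
    have ES := xE _ _ s EA EB s0 s1.
    pose k := y0 + (y - (l0 + l1 * x)) / t.
    have EK : E (0, k).
      apply: EO; rewrite /k addrAC subrr add0r normrM normfV (gtr0_norm t0) ler_pdivrMr//.
      by rewrite mulrC ler_norml; apply/andP; split; lra.
    have := xE _ _ t ES EK (ltW t0) t1.
    congr E; apply: injective_projections; rewrite /= /GRing.scale /=.
      rewrite /s /a' /t; field; rewrite ?dn ?gt_eqF//.
    rewrite /k /l0 /l1 /s /a' /t; field; rewrite ?dn ?gt_eqF//.
  have th : 0 < t * h by rewrite mulr_gt0.
  have := bonnesen_aux cE eta4 a'0 d0 d1 th Ea' strip.
  apply: le_trans; rewrite le_eqVlt; apply/orP; left; apply/eqP; symmetry.
  transitivity ((\int[@area R]_(z in E) ((1 + 7 * d)^-1 * a'^-1 +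
    - ((1 + 7 * d)^-1 * a'^-1 * (2 * eta * a'^-1)) * z.1)%:E)%E +
    (a' * pi * (1 - 5 * eta ^+ 2))%:E)%E.
    by congr (_ + _)%E; apply: eq_integral => z _; congr EFin; ring.
  by rewrite aff -EFinD /g -/a'; congr EFin; ring.
have [->|Pfin] := eqVneq (perimeter E) +oo%E; first by rewrite leey.
have Pr : perimeter E \is a fin_num.
  rewrite fin_numE Pfin andbT; apply/eqP => PN.
  by have := step 1 ltr01 (lexx 1); rewrite PN.
rewrite -(fineK Pr) lee_fin leNgt; apply/negP => lt.
have cg : {for 0, continuous g}.
  have n1 : (1 + 7 * 0 : R) != 0 by rewrite mulr0 addr0 oner_eq0.
  have n2 : (1 + 0 : R) != 0 by rewrite addr0 oner_eq0.
  have c1 : (1 + 7 * d)^-1 @[d --> (0 : R)] --> (1 + 7 * 0 : R)^-1.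
    by apply: cvgV => //; apply: cvgD; [exact: cvg_cst|apply: cvgM; [exact: cvg_cst|exact: cvg_id]].
  have c2 : a * (1 + d)^-1 @[d --> (0 : R)] --> a * (1 + 0 : R)^-1.
    apply: cvgM; first exact: cvg_cst.
    by apply: cvgV => //; apply: cvgD; [exact: cvg_cst|exact: cvg_id].
  have c3 : (a * (1 + d)^-1)^-1 @[d --> (0 : R)] --> (a * (1 + 0 : R)^-1)^-1.
    by apply: cvgV => //; rewrite mulf_neq0 ?invr_neq0// gt_eqF.
  apply: cvgD; last by apply: cvgM; [apply: cvgM => //; exact: cvg_cst|exact: cvg_cst].
  apply: cvgM; first exact: cvgM.
  apply: cvgB; first exact: cvg_cst.
  by apply: cvgM; [apply: cvgM => //; exact: cvg_cst|exact: cvg_cst].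
have near0 : \forall d \near (0 : R)^'+, fine (perimeter E) < g d.
  by apply: (cvgr_gt (g 0)) lt; exact: cvg_at_right_filter.
near (0 : R)^'+ => d; have hd : fine (perimeter E) < g d by near: d.
have d0 : 0 < d by near: d; exact: nbhs_right_gt.
have d1 : d <= 1 by near: d; exact: nbhs_right_le.
by have := step d d0 d1; rewrite -(fineK Pr) lee_fin leNgt hd.
Unshelve. all: by end_near. Qed.

End BonnesenBound.

(** * Stability of the disc *)

Section Stability.
Variable R : realType.
Implicit Types (E F : set (R * R)) (x y z : R * R).

Lemma convex_setP E : convex_set (E : set (convex_lmodType (R * R)%type)) <-> cvx E.
Proof.
split=> [cE x y t Ex Ey t0 t1|cE x y t].
  have u0 : 0 <= 1 - t by rewrite subr_ge0.
  have u1 : 1 - t <= 1 by rewrite gerBl.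
  have := cE x y (@Itv01 R (1 - t) u0 u1); rewrite !inE => /(_ Ex Ey).
  rewrite /conv /=; congr E; congr (_ + _ *: _).
  by rewrite /unstable.onem; ring.
rewrite !inE => Ex Ey.
have t0 : 0 <= t%:num by [].
have t1 : t%:num <= 1 by [].
by have := cE y x t%:num Ey Ex t0 t1; rewrite addrC.
Qed.

Lemma perimeter_rigid_eq c s b E : c ^+ 2 + s ^+ 2 = 1 -> compact E ->
  perimeter (rigid c s b @^-1` E) = perimeter E.
Proof.
move=> cs1 cE; apply/eqP; rewrite eq_le; apply/andP; split; last exact: perimeter_rigid.
have cs1' : c ^+ 2 + (- s) ^+ 2 = 1 by rewrite sqrrN.
have cE' : compact (rigid c s b @^-1` E) by exact: compact_rigid_preimage.
have := perimeter_rigid (rotation c (- s) (- b)) cs1' cE'.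
rewrite (_ : rigid c (- s) _ @^-1` (rigid c s b @^-1` E) = E)//.
apply/seteqP; split => x; rewrite /preimage /=; rewrite -rigidVE rigidVK//.
Qed.

Lemma enorm0 : enorm (0 : R * R) = 0.
Proof. by rewrite /enorm /edot /= mulr0 addr0 sqrtr0. Qed.

Lemma rigidB c s b x y : rigid c s b x - rigid c s b y = rotation c s (x - y).
Proof. by apply: injective_projections; rewrite /rigid /rotation /=; ring. Qed.

(** Here a is a half-width and d the offset of the centroid. For eta = 0, (a - 1)^2 <= a s^2 / 2,
    whence a <= 5/4 and |a - 1| <= s. For eta = s and eta = - s, using a + 1 / a >= 2, 2 s |d| / a^2
    <= s^2 / 2 + 5 a s^2 <= 7 s^2, whence |d| <= (7/2) (25/16) s <= 6 s. *)
Lemma bonnesen_numeric (a s d : R) : 0 < a -> 0 < s -> s <= 1 / 4 ->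
  (forall eta, `|eta| <= 1 / 4 ->
    a^-1 * (1 - 2 * eta * d / a) + a * (1 - 5 * eta ^+ 2) <= 2 + s ^+ 2 / 2) ->
  `|a - 1| <= s /\ `|d| <= 6 * s.
Proof.
move=> a0 s0 s4 h; have an : a != 0 by rewrite gt_eqF.
have b0 : 0 < a^-1 by rewrite invr_gt0.
have ab : a * a^-1 = 1 by rewrite mulfV.
have h0 : a^-1 + a <= 2 + s ^+ 2 / 2.
  have := h 0; rewrite normr0 => /(_ ltac:(lra)).
  by rewrite mulr0 !mul0r subr0 mulr1 expr0n/= mulr0 subr0 mulr1.
have s2 : s ^+ 2 <= 1 / 16 by nra.
have h1 : (a - 1) ^+ 2 <= a * (s ^+ 2 / 2).
  have : a * (a^-1 + a) <= a * (2 + s ^+ 2 / 2) by rewrite ler_pM2l.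
  by rewrite mulrDr ab; lra.
have a5 : a <= 5 / 4.
  rewrite leNgt; apply/negP => a5.
  have : 0 < (a - 5 / 4) * (a - 4 / 5) by rewrite mulr_gt0; lra.
  have : a * (s ^+ 2 / 2) <= a * (1 / 32) by rewrite ler_pM2l//; lra.
  by move: h1; lra.
have h2 : `|a - 1| <= s.
  rewrite -ler_sqr ?nnegrE//; last exact: ltW.
  rewrite real_normK ?num_real//; have := sqr_ge0 s; nra.
split=> //.
have b45 : 4 / 5 <= a^-1 by nra.
have bb : 16 / 25 <= a^-1 ^+ 2 by nra.
have ba2 : 2 <= a^-1 + a.
  have : 0 <= a^-1 * (a - 1) ^+ 2 by rewrite mulr_ge0 ?sqr_ge0// ltW.
  have -> : a^-1 * (a - 1) ^+ 2 = a^-1 + a - 2 by field.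
  by lra.
have side eta : eta ^+ 2 = s ^+ 2 -> `|eta| <= 1 / 4 -> - (2 * eta * d * a^-1 ^+ 2) <= 7 * s ^+ 2.
  move=> es /h; have -> : a^-1 * (1 - 2 * eta * d / a) = a^-1 - 2 * eta * d * a^-1 ^+ 2 by ring.
  rewrite es; have : a * (5 * s ^+ 2) <= 5 / 4 * (5 * s ^+ 2).
    by rewrite ler_wpM2r// mulr_ge0// sqr_ge0.
  by have := sqr_ge0 s; lra.
have sa : `|s| <= 1 / 4 by rewrite gtr0_norm.
have sp := side s erefl sa.
have sn := side (- s) (sqrrN s) ltac:(by rewrite normrN).
have key : `|d| * a^-1 ^+ 2 <= 7 / 2 * s.
  have [d0|d0] := lerP 0 d.
    rewrite ger0_norm// -(ler_pM2l s0); move: sn; move: (a^-1 ^+ 2) => q; lra.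
  rewrite ltr0_norm// -(ler_pM2l s0); move: sp; move: (a^-1 ^+ 2) => q; lra.
by have := normr_ge0 d; nra.
Qed.

Definition centroid E : R * R :=
  (fine (\int[@area R]_(z in E) z.1%:E) / pi, fine (\int[@area R]_(z in E) z.2%:E) / pi).

Lemma integral_affine E (k l m : R) : compact E -> @area R E = pi%:E ->
  (\int[@area R]_(z in E) (k + l * z.1 + m * z.2)%:E =
   (pi * (k + l * (centroid E).1 + m * (centroid E).2))%:E)%E.
Proof.
move=> cE aE; have mE := compact_measurable_plane cE.
have pi0 : pi != 0 :> R by rewrite gt_eqF// pi_gt0.
have cf1 : continuous (fun z : R * R => z.1) by move=> z; exact: cvg_fst.
have cf2 : continuous (fun z : R * R => z.2) by move=> z; exact: cvg_snd.
have clin (q : R) (f : R * R -> R) : continuous f -> continuous (fun z : R * R => q * f z).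
  by move=> cf; apply: continuous_mul => //; exact: continuous_const.
have i0 : (@area R).-integrable E (EFin \o (fun=> k)).
  by apply: continuous_compact_integrable_plane => //; exact: continuous_const.
have i1 := continuous_compact_integrable_plane cE cf1.
have i2 := continuous_compact_integrable_plane cE cf2.
have j1 := continuous_compact_integrable_plane cE (clin l _ cf1).
have j2 := continuous_compact_integrable_plane cE (clin m _ cf2).
have j01 : (@area R).-integrable E (EFin \o (fun z => k + l * z.1)).
  apply: continuous_compact_integrable_plane => //.
  by apply: continuous_add; [exact: continuous_const|exact: clin].
rewrite [LHS](integralD_EFin mE j01 j2) [X in (X + _)%E](integralD_EFin mE i0 j1).
rewrite [X in (X + _ + _)%E](_ : _ = (k * pi)%:E); last first.
  by rewrite [LHS](integral_cst (@area R) mE (k%:E)) aE EFinM.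
rewrite [X in (_ + X + _)%E](_ : _ = (l * fine (\int[@area R]_(z in E) z.1%:E))%:E); last first.
  by rewrite EFinM fineK ?(integrable_fin_num mE i1)// -integralZl.
rewrite [X in (_ + X)%E](_ : _ = (m * fine (\int[@area R]_(z in E) z.2%:E))%:E); last first.
  by rewrite EFinM fineK ?(integrable_fin_num mE i2)// -integralZl.
have e (q w : R) : pi * (q * (w / pi)) = q * w by rewrite mulrCA [pi * _]mulrC divfK.
rewrite -!EFinD; congr EFin.
transitivity (pi * k + pi * (l * (centroid E).1) + pi * (m * (centroid E).2)); last by ring.
by congr (_ + _ + _); [exact: mulrC|exact/esym/e|exact/esym/e].
Qed.

(** The projection of E on the direction n is the interval of centre c and half-width a. The
    inscribed disc makes a positive and, by convexity, supplies the vertical segment over the middle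
    of the slab that [bonnesen] asks for. *)
Lemma direction_bonnesen E (n1 n2 r : R) O : compact E -> cvx E -> @area R E = pi%:E ->
  n1 ^+ 2 + n2 ^+ 2 = 1 -> 0 < r -> cball O r `<=` E ->
  exists a c : R, [/\ 0 < a,
    forall z, E z -> n1 * z.1 + n2 * z.2 <= c + a,
    exists2 z, E z & n1 * z.1 + n2 * z.2 = c + a &
    forall eta, `|eta| <= 1 / 4 ->
      ((pi * (a^-1 * (1 - 2 * eta * (n1 * (centroid E).1 + n2 * (centroid E).2 - c) / a) +
        a * (1 - 5 * eta ^+ 2)))%:E <= perimeter E)%E].
Proof.
move=> cE xE aE n12 r0 OE.
pose l z := n1 * z.1 + n2 * z.2.
have cl : continuous l.
  apply: continuous_add; apply: continuous_mul => z; try exact: cvg_cst.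
  - exact: cvg_fst.
  - exact: cvg_snd.
have EO : E O by apply: OE; rewrite /cball /= subrr enorm0 ltW.
have E0 : E !=set0 by exists O.
have [zM EzM hM] := compact_EVT_max E0 cE (continuous_subspaceT cl).
have [zm Ezm hm] := compact_EVT_min E0 cE (continuous_subspaceT cl).
rewrite inE in EzM; rewrite inE in Ezm.
pose c := (l zM + l zm) / 2; pose a := (l zM - l zm) / 2.
have En (e : R) : e ^+ 2 = 1 -> E (O + (e * r * n1, e * r * n2)).
  move=> e1; apply: OE; rewrite /cball /= addrC addKr enorm_le ?(ltW r0)//=.
  by rewrite !exprMn -mulrDr n12 e1 mul1r mulr1.
have ar : r <= a.
  have h1 := hM _ (mem_set (En 1 (expr1n _ 2))).
  have h2 := hm _ (mem_set (En (-1) ltac:(by rewrite sqrrN expr1n))).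
  have : l (O + (1 * r * n1, 1 * r * n2)) - l (O + (-1 * r * n1, -1 * r * n2)) = 2 * r.
    by rewrite /l /=; transitivity (2 * r * (n1 ^+ 2 + n2 ^+ 2)); [ring|rewrite n12 mulr1].
  by rewrite /a; lra.
have a0 : 0 < a by exact: lt_le_trans ar.
exists a, c; split=> //.
- by move=> z Ez; have := hM z (mem_set Ez); rewrite /c /a -/(l z); lra.
- by exists zM => //; rewrite /c /a -/(l zM); lra.
(* In the new frame n is the first axis and the slab containing E is |x| <= a. *)
move=> eta eta4; rewrite -(perimeter_rigid_eq (c * n1, c * n2) n12 cE).
set U := rigid n1 n2 (c * n1, c * n2); set E' := U @^-1` E.
have lU w : l (U w) = w.1 + c.
  rewrite /l /U /rigid /rotation /=.
  by transitivity ((w.1 + c) * (n1 ^+ 2 + n2 ^+ 2)); [ring|rewrite n12 mulr1].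
have UV := rigidVK (c * n1, c * n2) n12; rewrite -/U in UV.
set V := rigidV _ _ _ in UV.
have cE' : compact E' by exact: compact_rigid_preimage.
have xE' : cvx E'.
  move=> x y t Ex Ey t0 t1; rewrite /E' /preimage /=.
  have := xE _ _ _ Ex Ey t0 t1; congr E.
  by apply: injective_projections; rewrite /U /rigid /rotation /= /GRing.scale /=; ring.
have E'a w : E' w -> `|w.1| <= a.
  move=> Ew; have := hM _ (mem_set Ew); have := hm _ (mem_set Ew).
  rewrite !lU ler_norml /a /c => h1 h2; apply/andP; split; lra.
have V1 z : (V z).1 = l z - c by rewrite -[in RHS](UV z) lU addrK.
have EA : E' (- a, (V zm).2).
  have -> : (- a, (V zm).2) = V zm.
    by apply: injective_projections => //; rewrite [RHS]V1 /a /c /=; lra.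
  by rewrite /E' /preimage /= UV.
have EB : E' (a, (V zM).2).
  have -> : (a, (V zM).2) = V zM.
    by apply: injective_projections => //; rewrite [RHS]V1 /a /c /=; lra.
  by rewrite /E' /preimage /= UV.
have EO' (y : R) : `|y - (V O).2| <= r -> E' ((V O).1, y).
  move=> yr; apply: OE; rewrite /cball /= -[X in _ - X]UV /U rigidB enorm_rot//.
  rewrite enorm_le ?(ltW r0)//= subrr expr0n/= add0r -real_normK ?num_real//.
  by rewrite ler_pXn2r// ?nnegrE// ltW.
have /andP[vl vr] : - a <= (V O).1 <= a by rewrite -ler_norml; apply: E'a; rewrite /E' /preimage /= UV.
have [h [y0 [h0 Eh]]] : exists h y0 : R, 0 < h /\ forall y : R, `|y - y0| <= h -> E' (0, y).
  (* Slide the vertical segment through the centre of the ball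
     towards one of the two contact points. *)
  have slide (b yb : R) : E' (b, yb) -> forall t, 0 <= t -> t < 1 ->
      (1 - t) * (V O).1 + t * b = 0 ->
      exists h y0 : R, 0 < h /\ forall y : R, `|y - y0| <= h -> E' (0, y).
    move=> Eb t t0 t1 tb; exists ((1 - t) * r), ((1 - t) * (V O).2 + t * yb).
    have u0 : 0 < 1 - t by lra.
    split; first by rewrite mulr_gt0.
    move=> y hy; pose k := (y - t * yb) / (1 - t).
    have Ek : E' ((V O).1, k).
      apply: EO'; have -> : k - (V O).2 = (y - ((1 - t) * (V O).2 + t * yb)) / (1 - t).
        by rewrite /k; field; rewrite gt_eqF.
      by rewrite normrM normfV (gtr0_norm u0) ler_pdivrMr// [r * _]mulrC.
    have := xE' _ _ _ Ek Eb t0 (ltW t1); congr E'.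
    apply: injective_projections; rewrite /= /GRing.scale /=; first exact: tb.
    by rewrite /k; field; rewrite gt_eqF.
  have [vo|vo] := lerP (V O).1 0.
    apply: (slide _ _ EB (- (V O).1 / (a - (V O).1))).
    - by rewrite divr_ge0//; lra.
    - by rewrite ltr_pdivrMr ?mul1r; lra.
    - by field; rewrite gt_eqF//; lra.
  apply: (slide _ _ EA ((V O).1 / (a + (V O).1))).
  - by rewrite divr_ge0//; lra.
  - by rewrite ltr_pdivrMr ?mul1r; lra.
  - by field; rewrite gt_eqF//; lra.
have := bonnesen cE' xE' eta4 a0 h0 E'a EA EB Eh.
apply: le_trans; rewrite le_eqVlt; apply/orP; left; apply/eqP; symmetry.
have apU := @area_preserving_rigid R n1 n2 (c * n1, c * n2) n12.
pose H z := a^-1 * (1 - 2 * eta * ((l z - c) / a)).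
have cH : continuous H.
  apply: continuous_mul; first exact: continuous_const.
  apply: continuous_add; first exact: continuous_const.
  apply: continuous_neg; apply: continuous_mul; first exact: continuous_const.
  apply: continuous_mul; last exact: continuous_const.
  by apply: continuous_add => //; exact: continuous_const.
have -> : (\int[@area R]_(z in E') (a^-1 * (1 - 2 * eta * (z.1 / a)))%:E =
    \int[@area R]_(z in E) (H z)%:E)%E.
  rewrite -(area_preserving_integral apU cE cE' cH).
  by apply: eq_integral => z _; congr EFin; rewrite /H -/U lU addrK.
transitivity ((\int[@area R]_(z in E) (a^-1 * (1 + 2 * eta * c / a) +
   (- (2 * eta * a^-1 * a^-1) * n1) * z.1 + (- (2 * eta * a^-1 * a^-1) * n2) * z.2)%:E)%E +
   (a * pi * (1 - 5 * eta ^+ 2))%:E)%E.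
  by congr (_ + _)%E; apply: eq_integral => z _; congr EFin; rewrite /H /l; ring.
by rewrite integral_affine// -EFinD; congr EFin; ring.
Qed.

(** The isoperimetric inequality, read off from a single direction with eta = 0, since a + 1 / a >=
    2. *)
Lemma perimeter_ge_2pi E (r : R) O : compact E -> cvx E -> @area R E = pi%:E ->
  0 < r -> cball O r `<=` E -> ((2 * pi)%:E <= perimeter E)%E.
Proof.
move=> cE xE aE r0 OE.
have n10 : (1 : R) ^+ 2 + 0 ^+ 2 = 1 by ring.
have [a [c [a0 _ _ h]]] := direction_bonnesen cE xE aE n10 r0 OE.
apply: le_trans (h 0 _); last by rewrite normr0; lra.
rewrite lee_fin mulrC ler_pM2l ?pi_gt0// mulr0 !mul0r subr0 expr0n/= mulr0 subr0 !mulr1.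
have : 0 <= a^-1 * (a - 1) ^+ 2 by rewrite mulr_ge0 ?sqr_ge0// invr_ge0 ltW.
have -> : a^-1 * (a - 1) ^+ 2 = a^-1 + a - 2 by field; rewrite gt_eqF.
by lra.
Qed.

(** The support function equals c + a; the half-width a is within s of 1 and c within 6 s of the
    projected centroid, which gives 7 s. *)
Lemma direction_estimate E (n1 n2 r s : R) O : compact E -> cvx E -> @area R E = pi%:E ->
  n1 ^+ 2 + n2 ^+ 2 = 1 -> 0 < r -> cball O r `<=` E ->
  0 < s -> s <= 1 / 4 -> (perimeter E <= (2 * pi + s ^+ 2)%:E)%E ->
  let g := n1 * (centroid E).1 + n2 * (centroid E).2 in
  (forall z, E z -> n1 * z.1 + n2 * z.2 <= g + 1 + 7 * s) /\
  exists2 z, E z & g + 1 - 7 * s <= n1 * z.1 + n2 * z.2.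
Proof.
move=> cE xE aE n12 r0 OE s0 s4 Ps g.
have [a [c [a0 hM [zM EzM zME] h]]] := direction_bonnesen cE xE aE n12 r0 OE.
have [|a1 gc] := @bonnesen_numeric a s (g - c) a0 s0 s4.
  move=> eta /h /le_trans /(_ Ps); rewrite lee_fin => hP.
  have pi0 := pi_gt0 R; have pi2 := pi_ge2 R.
  rewrite -(ler_pM2l pi0) (le_trans hP)//.
  (* Division by pi turns the excess s^2 into s^2 / pi, at most s^2 / 2 because pi >= 2. *)
  have : s ^+ 2 * 2 <= s ^+ 2 * pi by rewrite ler_wpM2l// sqr_ge0.
  by lra.
move: a1 gc; rewrite !ler_norml => /andP[a1 a2] /andP[g1 g2].
split; last by exists zM => //; rewrite zME; lra.
by move=> z /hM; lra.
Qed.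

End Stability.

(** * Hausdorff distance and the stability estimate *)

Section HausdorffDistance.
Variable R : realType.
Implicit Types (E F : set (R * R)) (x y z w : R * R).

Lemma edot_le x y : edot x y <= enorm x * enorm y.
Proof.
rewrite (le_trans (ler_norm _))// -ler_sqr ?nnegrE ?mulr_ge0 ?enorm_ge0//.
rewrite real_normK ?num_real// exprMn !enorm_sqr /edot.
have := sqr_ge0 (x.1 * y.2 - x.2 * y.1); move: x y => [a b] [c d] /=; lra.
Qed.

Lemma enorm_triangle x y : enorm (x + y) <= enorm x + enorm y.
Proof.
have x0 := enorm_ge0 x; have y0 := enorm_ge0 y.
rewrite -ler_sqr ?nnegrE ?enorm_ge0 ?addr_ge0//.
have := edot_le x y; have := enorm_sqr x; have := enorm_sqr y => h1 h2 h3.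
rewrite [leLHS]enorm_sqr sqrrD; move: h1 h2 h3; rewrite /edot /=.
by move: (enorm x) (enorm y) => p q; move: x y x0 y0 => [a b] [c d] /=; lra.
Qed.

Lemma enormN x : enorm (- x) = enorm x.
Proof. by rewrite /enorm /edot /= !mulrNN. Qed.

Lemma enormB x y : enorm (x - y) = enorm (y - x).
Proof. by rewrite -enormN opprB. Qed.

Lemma enormZ t x : 0 <= t -> enorm (t *: x) = t * enorm x.
Proof.
move=> t0; rewrite /enorm /edot /= /GRing.scale /=.
rewrite (_ : _ + _ = t ^+ 2 * (x.1 * x.1 + x.2 * x.2)); last by ring.
by rewrite sqrtrM ?sqr_ge0// sqrtr_sqr ger0_norm.
Qed.

Lemma enorm_eq0 x : enorm x = 0 -> x = 0.
Proof.
move=> x0; have := enorm_sqr x; rewrite x0 expr0n/= => h.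
have := sqr_ge0 x.1; have := sqr_ge0 x.2 => h2 h1.
have : x.1 ^+ 2 = 0 by lra.
have : x.2 ^+ 2 = 0 by lra.
move=> /eqP; rewrite sqrf_eq0 => /eqP e2 /eqP; rewrite sqrf_eq0 => /eqP e1.
by apply: injective_projections.
Qed.

Lemma enorm_gt0 x : x != 0 -> 0 < enorm x.
Proof.
by move=> x0; rewrite lt_neqAle enorm_ge0 andbT eq_sym; apply: contra x0 => /eqP/enorm_eq0->.
Qed.

Lemma enorm_subtriangle x y z : enorm (x - z) <= enorm (x - y) + enorm (y - z).
Proof. by rewrite (_ : x - z = (x - y) + (y - z)) ?enorm_triangle// addrA subrK. Qed.

(** Hausdorff bounds are handled through witnesses at distance at most t. A strict bound is needed
    to extract witnesses, since the infima need not be attained. *)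
Definition cthick E t : set (R * R) := [set x | exists2 y, E y & enorm (x - y) <= t].

Lemma edist_set_le x E t : cthick E t x -> (edist_set x E <= t%:E)%E.
Proof.
move=> [y Ey xy]; apply: (@le_trans _ _ (enorm (x - y))%:E); last by rewrite lee_fin.
by apply: ereal_inf_lbound; exists y.
Qed.

Lemma edist_set_lt x E t : (edist_set x E < t%:E)%E -> exists2 y, E y & enorm (x - y) < t.
Proof.
move=> /ereal_inf_lt[_ [y Ey <-]]; rewrite lte_fin => xy.
by exists y.
Qed.

Lemma hausdorff_dist_le E F t : F `<=` cthick E t -> E `<=` cthick F t ->
  (hausdorff_dist E F <= t%:E)%E.
Proof.
move=> FE EF; rewrite /hausdorff_dist ge_max; apply/andP; split;
  apply: ge_ereal_sup => _ [x hx <-]; apply: edist_set_le; [exact: FE|exact: EF].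
Qed.

Lemma hausdorff_dist_lt E F t : (hausdorff_dist E F < t%:E)%E ->
  F `<=` cthick E t /\ E `<=` cthick F t.
Proof.
rewrite /hausdorff_dist gt_max => /andP[h1 h2]; split => x hx.
  have [|y Ey xy] := @edist_set_lt x E t; last by exists y => //; exact: ltW.
  by apply: le_lt_trans h1; apply: ereal_sup_ubound; exists x.
have [|y Ey xy] := @edist_set_lt x F t; last by exists y => //; exact: ltW.
by apply: le_lt_trans h2; apply: ereal_sup_ubound; exists x.
Qed.

Lemma eqradius1 E : @area R E = pi%:E -> eqradius E = 1.
Proof. by move=> aE; rewrite /eqradius aE /= divff ?sqrtr1// gt_eqF// pi_gt0. Qed.

Lemma dive1 (u : \bar R) : (u / 1%:E)%E = u.
Proof. by rewrite inver oner_eq0 invr1 mule1. Qed.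

Lemma lambdaH_le E z t : @area R E = pi%:E ->
  cball z 1 `<=` cthick E t -> E `<=` cthick (cball z 1) t -> (lambdaH E <= t%:E)%E.
Proof.
move=> aE h1 h2; apply: le_trans (hausdorff_dist_le h1 h2).
by rewrite /lambdaH eqradius1//; apply: ereal_inf_lbound; exists z => //; rewrite dive1.
Qed.

Lemma lambdaH_lt E t : @area R E = pi%:E -> (lambdaH E < t%:E)%E ->
  exists z, cball z 1 `<=` cthick E t /\ E `<=` cthick (cball z 1) t.
Proof.
move=> aE; rewrite /lambdaH eqradius1// => /ereal_inf_lt[_ [z _ <-]].
by rewrite dive1 => /hausdorff_dist_lt h; exists z.
Qed.

Lemma lambdaH_ge0 E : E !=set0 -> @area R E = pi%:E -> (0 <= lambdaH E)%E.
Proof.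
move=> [x Ex] aE; apply: le_ereal_inf_tmp => _ [z _ <-]; rewrite eqradius1// dive1.
rewrite /hausdorff_dist le_max; apply/orP; right.
apply: (@le_trans _ _ (edist_set x (cball z 1))); last by apply: ereal_sup_ubound; exists x.
by apply: le_ereal_inf_tmp => _ [y _ <-]; rewrite lee_fin enorm_ge0.
Qed.

(** The point y of E nearest to x; if some z made an acute angle, moving from y towards z would come
    closer to x. *)
Lemma cvx_projection E x : compact E -> cvx E -> E !=set0 ->
  exists2 y, E y & forall z, E z -> edot (x - y) (z - y) <= 0.
Proof.
move=> cE xE E0.
have cf : continuous (fun y : R * R => edot (x - y) (x - y)).
  apply: (continuous_after (f := fun y : R * R => x - y) (g := fun z => edot z z)); last exact: edot_continuous.
  by move=> y; apply: cvgB; [exact: cvg_cst|exact: cvg_id].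
have [y Ey hy] := compact_EVT_min E0 cE (continuous_subspaceT cf).
rewrite inE in Ey; exists y => // z Ez; rewrite leNgt; apply/negP => p0.
set p := edot _ _ in p0; pose q := edot (z - y) (z - y).
have q0 : 0 <= q by exact: edot_ge0.
have pq : 0 < p + q by lra.
(* Moving by the fraction t changes the squared distance by - t (2 p - t q), and for this t one has
   2 p - t q = p + t p > 0. *)
pose t := p / (p + q).
have t0 : 0 < t by rewrite divr_gt0.
have t1 : t <= 1 by rewrite ler_pdivrMr// mul1r; lra.
have := hy _ (mem_set (xE y z t Ey Ez (ltW t0) t1)).
have -> : edot (x - ((1 - t) *: y + t *: z)) (x - ((1 - t) *: y + t *: z)) =
    edot (x - y) (x - y) - t * (2 * p - t * q).
  by rewrite /p /q /edot /= /GRing.scale /=; ring.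
have tq : t * (p + q) = p by rewrite /t divfK// gt_eqF.
have tp0 : 0 < t * p by rewrite mulr_gt0.
have : 0 < 2 * p - t * q by move: tq tp0 p0; rewrite mulrDr; lra.
by move=> /(mulr_gt0 t0); lra.
Qed.

(** The disc is centred at the centroid. For x in the disc with projection y on E, the direction of
    x - y separates: the support of E there is attained at y, and its lower bound gives |x - y| <= 7
    s. A point of E outside the disc is moved radially, and the upper bound in its own direction
    applies. *)
Lemma stability E (r s : R) O : compact E -> cvx E -> @area R E = pi%:E ->
  0 < r -> cball O r `<=` E -> 0 < s -> s <= 1 / 4 ->
  (perimeter E <= (2 * pi + s ^+ 2)%:E)%E -> (lambdaH E <= (7 * s)%:E)%E.
Proof.
move=> cE xE aE r0 OE s0 s4 Ps.
have EO : E O by apply: OE; rewrite /cball /= subrr enorm0 ltW.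
have dir (n : R * R) : enorm n = 1 ->
    (forall z, E z -> edot n z <= edot n (centroid E) + 1 + 7 * s) /\
    exists2 z, E z & edot n (centroid E) + 1 - 7 * s <= edot n z.
  move=> n1; have n12 : n.1 ^+ 2 + n.2 ^+ 2 = 1 by rewrite -enorm_sqr n1 expr1n.
  exact: (direction_estimate cE xE aE n12 r0 OE s0 s4 Ps).
have unit z : z != 0 -> enorm ((enorm z)^-1 *: z) = 1.
  move=> z0; have n0 := enorm_gt0 z0.
  by rewrite enormZ ?invr_ge0 ?ltW// mulVf// gt_eqF.
have edotZ t x y : edot (t *: x) y = t * edot x y by rewrite /edot /= /GRing.scale /=; ring.
have edotB x y z : edot x (y - z) = edot x y - edot x z by rewrite /edot /=; ring.
have edotnn z : edot z z = enorm z * enorm z by rewrite -expr2 enorm_sqr /edot !expr2.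
apply: (@lambdaH_le _ (centroid E)) => //.
- move=> x; rewrite /cball /= => xc.
  have [y Ey hy] := cvx_projection x cE xE (ex_intro _ O EO).
  exists y => //; have [->|xy] := eqVneq x y; first by rewrite subrr enorm0 mulr_ge0// ltW.
  have d0 : x - y != 0 by rewrite subr_eq0.
  have n0 := enorm_gt0 d0; have u1 := unit _ d0.
  have [_ [z Ez]] := dir _ u1; set u := _ *: (x - y) in u1 *.
  have hz : edot u z <= edot u y.
    by rewrite -subr_le0 -edotB /u edotZ pmulr_rle0 ?invr_gt0//; exact: hy.
  have hx : edot u x - edot u y = enorm (x - y).
    by rewrite -edotB /u edotZ edotnn mulKf// gt_eqF.
  have := edot_le u (x - centroid E); rewrite u1 mul1r edotB; lra.
- move=> y Ey; have [yc|yc] := lerP (enorm (y - centroid E)) 1.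
    by exists y => //; rewrite subrr enorm0 mulr_ge0// ltW.
  set v := y - centroid E in yc *.
  have v0 : v != 0.
    by apply: contraTN yc => /eqP ->; rewrite enorm0 -leNgt.
  have n0 := enorm_gt0 v0; have u1 := unit _ v0.
  have [/(_ y Ey) h _] := dir _ u1.
  have hv : enorm v <= 1 + 7 * s.
    have : edot ((enorm v)^-1 *: v) y - edot ((enorm v)^-1 *: v) (centroid E) = enorm v.
      by rewrite -edotB edotZ -/v edotnn mulKf// gt_eqF.
    by lra.
  exists (centroid E + (enorm v)^-1 *: v).
    by rewrite /cball /= addrC addKr u1.
  have -> : y - (centroid E + (enorm v)^-1 *: v) = (1 - (enorm v)^-1) *: v.
    by rewrite scalerBl scale1r opprD addrA.
  have iv : (enorm v)^-1 <= 1 by rewrite invf_le1// ltW.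
  rewrite enormZ ?subr_ge0// mulrBl mul1r mulVf ?gt_eqF//; lra.
Qed.

End HausdorffDistance.

(** * Compactness of convex sets *)

Section Blaschke.
Variable R : realType.
Implicit Types (E F : set (R * R)) (x y z w : R * R).

Lemma enorm_fst x : `|x.1| <= enorm x.
Proof.
rewrite -ler_sqr ?nnegrE ?enorm_ge0// real_normK ?num_real// enorm_sqr.
by have := sqr_ge0 x.2; lra.
Qed.

Lemma enorm_snd x : `|x.2| <= enorm x.
Proof.
rewrite -ler_sqr ?nnegrE ?enorm_ge0// real_normK ?num_real// enorm_sqr.
by have := sqr_ge0 x.1; lra.
Qed.

(** The topology comes from the sup norm; this lemma and the next translate between it and Euclidean
    discs. *)
Lemma nbhs_enorm_lt x (e : R) : 0 < e -> nbhs x [set y | enorm (y - x) < e].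
Proof.
move=> e0.
have cf : continuous (fun y : R * R => enorm (y - x)).
  apply: (continuous_after (f := fun y : R * R => y - x) (g := @enorm R)).
    by move=> y; apply: cvgB; [exact: cvg_id|exact: cvg_cst].
  exact: enorm_continuous.
have /cvgr_lt h := cf x; apply: h; by rewrite subrr enorm0.
Qed.

Lemma nbhs_enorm x (A : set (R * R)) : nbhs x A ->
  exists2 e : R, 0 < e & forall y, enorm (y - x) < e -> A y.
Proof.
move=> /nbhs_ballP[e /= e0 eA]; exists e => // y yx; apply: eA.
by split; rewrite /ball /= distrC; apply: le_lt_trans yx;
  [exact: (enorm_fst (y - x))|exact: (enorm_snd (y - x))].
Qed.

(** The image of an ultrafilter under a choice of points in a compact set converges; this takes the
    place of extracting subsequences. *)
Lemma ultra_select (T : Type) (U : set_system T) (K : set (R * R))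
    (P : T -> R * R -> Prop) : UltraFilter U -> compact K ->
  U [set t | exists2 x, K x & P t x] ->
  exists (f : T -> R * R) x, [/\ K x, f @ U --> x & U [set t | K (f t) /\ P t (f t)]].
Proof.
move=> uU cK UP.
(* The default value 0 is taken only outside a member of U. *)
pose f t := xget 0 [set x | K x /\ P t x].
have Uf : U [set t | K (f t) /\ P t (f t)].
  apply: filterS UP => t [x Kx Px]; rewrite /f.
  exact: (@xgetPex _ 0 [set x | K x /\ P t x]) (ex_intro _ x (conj Kx Px)).
have fK : U (f @^-1` K) by apply: filterS Uf => t [].
have [x [Kx cx]] := cK (f @ U) _ fK.
exists f, x; split => // A Ax.
have [//|UA] := in_ultra_setVsetC (f @^-1` A) uU.
by have [y [/= nAy Ay]] := cx (~` A) A UA Ax.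
Qed.

Lemma cvg_enorm (T : Type) (U : set_system T) (f : T -> R * R) x (e : R) :
  f @ U --> x -> 0 < e -> U [set t | enorm (f t - x) < e].
Proof. by move=> fx e0; exact: fx (nbhs_enorm_lt x e0). Qed.

(* The Kuratowski limit of the sets along the filter. *)
Definition ulimit (U : set_system (set (R * R))) : set (R * R) :=
  [set x | forall e : R, 0 < e -> U [set E | exists2 y, E y & enorm (y - x) < e]].

(* Hausdorff closeness in a multiplicative form, which controls the areas too. *)
Definition scale_close (d : R) E F :=
  (forall x, E x -> F ((1 + d)^-1 *: x)) /\ (forall x, F x -> E ((1 + d)^-1 *: x)).

(** The normalised class: all later estimates depend on r and C alone. *)
Definition thick (r C : R) E :=
  [/\ closed E, cvx E, cball 0 r `<=` E & E `<=` cball 0 C].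

Lemma thick_compact r C E : thick r C E -> compact E.
Proof.
case=> cE _ _ EC; apply: (@closed_bounded_compact_plane R E C) => // z /EC.
by rewrite /cball /= subr0.
Qed.

(** x / (1 + d) is the convex combination of y and (x - y) / d with weights 1 / (1 + d) and d / (1 +
    d), and the second point lies in the inner disc. *)
Lemma cvx_scale_close (r d : R) E F : 0 < d -> cvx F -> cball 0 r `<=` F ->
  (forall x, E x -> exists2 y, F y & enorm (x - y) < d * r) ->
  forall x, E x -> F ((1 + d)^-1 *: x).
Proof.
move=> d0 xF rF h x /h[y Fy xy].
have d1 : 0 < 1 + d by lra.
have Fz : F (d^-1 *: (x - y)).
  apply: rF; rewrite /cball /= subr0 enormZ ?invr_ge0 ?(ltW d0)//.
  by rewrite mulrC ler_pdivrMr// mulrC ltW.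
have := xF y _ (d / (1 + d)) Fy Fz; rewrite divr_ge0 ?(ltW d0) ?(ltW d1)//.
rewrite ler_pdivrMr// mul1r lerDr ler01 => /(_ isT isT).
congr (F _); apply: injective_projections; rewrite /= /GRing.scale /=; field;
  by rewrite (gt_eqF d0) (gt_eqF d1).
Qed.

Section Limit.
Variable U : set_system (set (R * R)).
Hypothesis uU : UltraFilter U.
Variables r C : R.
Hypothesis r0 : 0 < r.
Hypothesis UT : U [set E | thick r C E].

Let E0 := ulimit U.

Lemma ulimit_closed : closed E0.
Proof.
move=> x clx e e0.
have e20 : 0 < e / 2 by rewrite divr_gt0.
have [z [E0z zx]] := clx _ (nbhs_enorm_lt x e20).
apply: filterS (E0z _ e20) => E [y Ey yz]; exists y => //.
by rewrite (le_lt_trans (enorm_subtriangle y z x))//; rewrite /= in zx; lra.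
Qed.

Lemma ulimit_cvx : cvx E0.
Proof.
move=> x y t Ex Ey t0 t1 e e0.
apply: filterS (filterI UT (filterI (Ex _ e0) (Ey _ e0))).
move=> E [[_ xE _ _] [[x' Ex' xx'] [y' Ey' yy']]].
exists ((1 - t) *: x' + t *: y'); first exact: xE.
have -> : (1 - t) *: x' + t *: y' - ((1 - t) *: x + t *: y) =
    (1 - t) *: (x' - x) + t *: (y' - y).
  by apply: injective_projections; rewrite /= /GRing.scale /=; ring.
apply: le_lt_trans (enorm_triangle _ _) _; rewrite !enormZ//; last by lra.
have [->|tn0] := eqVneq t 0; first by rewrite subr0 mul0r addr0 mul1r.
have t00 : 0 < t by rewrite lt_neqAle eq_sym tn0.
have h1 : t * enorm (y' - y) < t * e by rewrite ltr_pM2l.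
have h2 : (1 - t) * enorm (x' - x) <= (1 - t) * e.
  by apply: ler_wpM2l; [lra|exact: ltW].
by lra.
Qed.

Lemma ulimit_ball : cball 0 r `<=` E0.
Proof.
move=> x rx e e0; apply: filterS UT => E [_ _ rE _].
by exists x; [exact: rE|rewrite subrr enorm0].
Qed.

Lemma ulimit_bounded : E0 `<=` cball 0 C.
Proof.
move=> x E0x; rewrite /cball /= subr0; apply/ler_addgt0Pr => e e0.
have [E [[_ _ _ EC] [y Ey yx]]] := filter_ex (filterI UT (E0x e e0)).
have := EC _ Ey; rewrite /cball /= subr0 => yC.
have := enorm_triangle (x - y) y; rewrite subrK enormB; lra.
Qed.

Lemma ulimit_thick : thick r C E0.
Proof. by split; [exact: ulimit_closed|exact: ulimit_cvx|exact: ulimit_ball|exact: ulimit_bounded]. Qed.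

(** Otherwise U-many sets E have a point at distance at least e from E0; a limit of such points
    along U lies in E0, a contradiction. *)
Lemma ulimit_upper (e : R) : 0 < e ->
  U [set E | forall x, E x -> exists2 y, E0 y & enorm (x - y) < e].
Proof.
move=> e0; have [//|UN] := in_ultra_setVsetC
  [set E | forall x, E x -> exists2 y, E0 y & enorm (x - y) < e] uU.
have UN' : U [set E | exists2 x, cball 0 C x & E x /\ forall y, E0 y -> e <= enorm (x - y)].
  apply: filterS (filterI UT UN) => E [[_ _ _ EC] /= /existsNP[x /not_implyP[Ex nx]]].
  exists x; first exact: EC.
  split => // y E0y; rewrite leNgt; apply/negP => xy.
  by apply: nx; exists y.
have [f [x [_ fx Uf]]] := ultra_select uU (@compact_cball0 R C) UN'.
have E0x : E0 x.
  move=> d d0; apply: filterS (filterI Uf (cvg_enorm fx d0)).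
  by move=> E [[_ [Ef _]] h]; exists (f E).
have [E [[_ [_ h1]] h2]] := filter_ex (filterI Uf (cvg_enorm fx e0)).
by have := h1 _ E0x; rewrite leNgt h2.
Qed.

(** Otherwise points of E0 stay at distance at least e from U-many E, and so does, up to e / 2,
    their limit in E0, which by definition is approached by U-many E. *)
Lemma ulimit_lower (e : R) : 0 < e ->
  U [set E | forall x, E0 x -> exists2 y, E y & enorm (x - y) < e].
Proof.
move=> e0; have e20 : 0 < e / 2 by rewrite divr_gt0.
have [//|UN] := in_ultra_setVsetC
  [set E | forall x, E0 x -> exists2 y, E y & enorm (x - y) < e] uU.
have UN' : U [set E | exists2 x, E0 x & forall y, E y -> e <= enorm (x - y)].
  apply: filterS UN => E /= /existsNP[x /not_implyP[Ex nx]].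
  exists x => // y E0y; rewrite leNgt; apply/negP => xy.
  by apply: nx; exists y.
have [f [x [E0x fx Uf]]] := ultra_select uU (thick_compact ulimit_thick) UN'.
have [E [[[_ h1] h2] [y Ey h3]]] :=
  filter_ex (filterI (filterI Uf (cvg_enorm fx e20)) (E0x _ e20)).
have h4 : enorm (f E - x) < e / 2 by [].
have := h1 _ Ey; have := enorm_subtriangle (f E) x y; rewrite (enormB x y); lra.
Qed.

Lemma ulimit_close (d : R) : 0 < d -> U [set E | scale_close d E E0].
Proof.
move=> d0; have dr : 0 < d * r by rewrite mulr_gt0.
apply: filterS (filterI UT (filterI (ulimit_upper dr) (ulimit_lower dr))).
move=> E [[_ xE rE _] [hu hl]]; split.
  exact: (cvx_scale_close d0 ulimit_cvx ulimit_ball hu).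
exact: (cvx_scale_close d0 xE rE hl).
Qed.

End Limit.

Lemma scale_close_near (d C : R) E F x : 0 < d -> F `<=` cball 0 C -> 0 <= C ->
  scale_close d E F -> E x -> E `<=` cball 0 C -> exists2 y, F y & enorm (x - y) <= C * d.
Proof.
move=> d0 FC C0 [h _] Ex EC; exists ((1 + d)^-1 *: x); first exact: h.
have d1 : 0 < 1 + d by lra.
have -> : x - (1 + d)^-1 *: x = (d / (1 + d)) *: x.
  by apply: injective_projections; rewrite /= /GRing.scale /=; field; rewrite gt_eqF.
rewrite enormZ ?divr_ge0 ?(ltW d0) ?(ltW d1)// mulrC.
have := EC _ Ex; rewrite /cball /= subr0 => xC.
apply: ler_pM => //; rewrite ?enorm_ge0 ?divr_ge0 ?(ltW d0) ?(ltW d1)//.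
by rewrite ler_pdivrMr// mulrDr mulr1 lerDl mulr_ge0// ltW.
Qed.

(** The convex hull of z and the inner disc contains the disc of radius (1 - t) r about t z. *)
Lemma thick_interior (r C t : R) E z : 0 < r -> thick r C E -> E z -> 0 <= t -> t < 1 ->
  E^° (t *: z).
Proof.
move=> r0 [_ xE rE _] Ez t0 t1.
have tr : 0 < (1 - t) * r by rewrite mulr_gt0// subr_gt0.
apply: filterS (nbhs_enorm_lt (t *: z) tr) => y /= yt.
have t1' : 0 < 1 - t by rewrite subr_gt0.
have Ew : E ((1 - t)^-1 *: (y - t *: z)).
  apply: rE; rewrite /cball /= subr0 enormZ ?invr_ge0 ?(ltW t1')//.
  by rewrite mulrC ler_pdivrMr// mulrC ltW.
have := xE _ _ t Ew Ez t0 (ltW t1).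
by rewrite scalerA mulfV ?gt_eqF// scale1r subrK.
Qed.

(** The last point of E on the ray through x exists by compactness and cannot be interior. *)
Lemma thick_ray (r C : R) E x : 0 < r -> thick r C E -> x != 0 ->
  exists2 t : R, 0 <= t & boundary E (t *: x).
Proof.
move=> r0 tE x0; have [cE xE rE EC] := tE.
have nx := enorm_gt0 x0.
pose A : set R := [set t | 0 <= t /\ E (t *: x)].
have cZ : continuous (fun t : R => t *: x).
  by move=> t; apply: cvgZr_tmp; exact: cvg_id.
have clA : closed A.
  have -> : A = `[0, +oo[%classic `&` (fun t : R => t *: x) @^-1` E.
    by apply/seteqP; split => t; rewrite /A /= in_itv /= andbT.
  apply: closedI; first exact: interval_closed.
  by apply: closed_comp => // t _; exact: cZ.
have bA : A `<=` `[0, C / enorm x]%classic.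
  move=> t [t0 /EC]; rewrite /cball /= subr0 enormZ// in_itv /= t0 /=.
  by rewrite ler_pdivlMr.
have cA : compact A.
  by apply: subclosed_compact clA _ bA; exact: segment_compact.
have A0 : A !=set0.
  exists 0; split => //; rewrite scale0r; apply: rE.
  by rewrite /cball /= subrr enorm0 ltW.
have [t tA tmax] := compact_EVT_max A0 cA (continuous_subspaceT (fun t => @cvg_id _ (nbhs t))).
rewrite inE in tA; have [t0 Et] := tA.
exists t => //; split; first exact: subset_closure.
move=> /nbhs_enorm[e e0 he].
(* The point s x is at distance e / 2 from t x. *)
pose s := t + e / (2 * enorm x).
have ts : t < s by rewrite ltrDl divr_gt0// mulr_gt0.
have sA : A s.
  split; first by rewrite (le_trans t0)// ltW.
  apply: he; rewrite -scalerBl /s addrAC subrr add0r enormZ.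
    by rewrite invfM mulrA -(mulrA (e / 2)) mulVf ?gt_eqF// mulr1 ltr_pdivrMr//; lra.
  by rewrite divr_ge0 ?mulr_ge0// ltW.
by have := tmax s (mem_set sA); rewrite leNgt ts.
Qed.

End Blaschke.

(** * Continuity of area, deviation, perimeter and cone condition along the ultrafilter *)

Section Limits.
Variable R : realType.
Implicit Types (E F : set (R * R)) (x y z w : R * R) (r C d : R).

Lemma enormZ_norm (t : R) x : enorm (t *: x) = `|t| * enorm x.
Proof.
have [t0|/ltW t0] := leP 0 t; first by rewrite ger0_norm// enormZ.
by rewrite ler0_norm// -enormN -scaleNr enormZ// oppr_ge0.
Qed.

Lemma le_linear_limit (p q K : R) :
  (forall d, 0 < d -> d <= 1 -> p <= q + K * d) -> p <= q.
Proof.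
move=> h; apply/ler_addgt0Pr => e e0.
have K1 : 0 < `|K| + 1 by rewrite ltr_wpDl.
pose d := Num.min 1 (e / (`|K| + 1)).
have d0 : 0 < d by rewrite lt_min ltr01 divr_gt0.
have d1 : d <= 1 by rewrite ge_min lexx.
apply: le_trans (h d d0 d1) _; rewrite lerD2l.
apply: (@le_trans _ _ ((`|K| + 1) * d)).
  by rewrite ler_pM2r// (le_trans (ler_norm _))// lerDl.
by rewrite mulrC -ler_pdivlMr// ge_min lexx orbT.
Qed.

Lemma area_preimage_scale E d : compact E -> 0 < d -> @area R E = pi%:E ->
  @area R [set x | E ((1 + d)^-1 *: x)] = ((1 + d) ^+ 2 * pi)%:E.
Proof.
move=> cE d0 aE; have d1 : 0 < 1 + d by lra.
have t0 : 0 < (1 + d)^-1 by rewrite invr_gt0.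
have := area_scale t0 (compact_measurable_plane cE).
rewrite aE => h; rewrite EFinM h muleA -EFinM -exprMn divff ?gt_eqF// expr1n mul1e.
by [].
Qed.

Lemma compact_preimage_scale E d : compact E -> 0 < d ->
  compact [set x | E ((1 + d)^-1 *: x)].
Proof.
move=> cE d0; have d1 : 0 < 1 + d by lra.
have -> : [set x | E ((1 + d)^-1 *: x)] = [set (1 + d) *: x | x in E].
  apply/seteqP; split => x /=.
    by move=> Ex; exists ((1 + d)^-1 *: x) => //; rewrite scalerA divff ?gt_eqF// scale1r.
  by move=> [y Ey <-]; rewrite scalerA mulVf ?gt_eqF// scale1r.
apply: continuous_compact => //; apply: continuous_subspaceT => x.
by apply: cvgZl_tmp; exact: cvg_id.
Qed.

(** F lies in the dilate S of E by 1 + d. Adding M makes the integrand nonnegative on S, so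
    enlarging F to S is harmless; on S minus E, of area at most 3 pi d, the integrand is at most 2
    M. Because E and F have equal area, the two shifts by M cancel. *)
Lemma integral_scale_close r C d (M : R) E F (g : R * R -> R) :
  0 < d -> d <= 1 -> thick r C E -> thick r C F -> 0 < r ->
  @area R E = pi%:E -> @area R F = pi%:E -> continuous g ->
  (forall x, cball 0 (2 * C) x -> `|g x| <= M) -> 0 <= M ->
  scale_close d F E ->
  (\int[@area R]_(x in F) (g x)%:E <= \int[@area R]_(x in E) (g x)%:E + (6 * M * pi * d)%:E)%E.
Proof.
move=> d0 d1 tE tF r0 aE aF cg gM M0 [FE _].
have d10 : 0 < 1 + d by lra.
have cE := thick_compact tE; have cF := thick_compact tF.
pose S := [set x | E ((1 + d)^-1 *: x)].
have cS : compact S by exact: compact_preimage_scale.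
have aS : @area R S = ((1 + d) ^+ 2 * pi)%:E by exact: area_preimage_scale.
have [_ xE rE EC] := tE.
have ES : E `<=` S.
  move=> x Ex; rewrite /S /=.
  have E0 : E 0 by apply: rE; rewrite /cball /= subr0 enorm0 ltW.
  have := xE _ _ (1 + d)^-1 E0 Ex; rewrite scaler0 add0r; apply; first by rewrite invr_ge0 ltW.
  by rewrite invf_le1//; lra.
have FS : F `<=` S by move=> x /FE.
have SC : S `<=` cball 0 (2 * C).
  move=> x /EC; rewrite /cball /= !subr0 enormZ ?invr_ge0 ?(ltW d10)//.
  rewrite mulrC ler_pdivrMr// => h; apply: le_trans h _; rewrite mulrC ler_wpM2r//; last by lra.
  have := EC 0; rewrite /cball /= subr0 enorm0; apply; apply: rE.
  by rewrite /cball /= subr0 enorm0 ltW.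
have mE := compact_measurable_plane cE; have mF := compact_measurable_plane cF.
have mS := compact_measurable_plane cS.
have cgM : continuous (fun x => g x + M) by move=> x; apply: cvgD; [exact: cg|exact: cvg_cst].
have shift A : compact A -> (\int[@area R]_(x in A) (g x + M)%:E =
    \int[@area R]_(x in A) (g x)%:E + M%:E * @area R A)%E.
  move=> cA; have mA := compact_measurable_plane cA.
  rewrite -(integral_cst _ mA) -integralD//.
  - exact: (continuous_compact_integrable_plane cA cg).
  - exact: (continuous_compact_integrable_plane (g := fun=> M) cA (fun x => @cvg_cst _ _ _ _ _)).
have h0 x : S x -> (0 <= (g x + M)%:E)%E.
  move=> Sx; rewrite lee_fin; have := gM _ (SC _ Sx); rewrite ler_norml => /andP[h _].
  by rewrite -lerBlDr sub0r.
have msg A : measurable A -> measurable_fun A (fun x => (g x + M)%:E).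
  move=> mA; apply/measurable_EFinP; apply: measurable_funS (@measurableT _ _) _ _ => //.
  exact: continuous_measurable_plane.
have h1 : (\int[@area R]_(x in F) (g x + M)%:E <= \int[@area R]_(x in S) (g x + M)%:E)%E.
  by apply: ge0_subset_integral => //; exact: msg.
have h2 : (\int[@area R]_(x in S) (g x + M)%:E <=
    \int[@area R]_(x in E) (g x + M)%:E + (6 * M * pi * d)%:E)%E.
  have mD : measurable (S `\` E : set (measurableTypeR R * measurableTypeR R)) by exact: measurableD.
  rewrite -{1}(setDUK ES) ge0_integral_setU//; last 3 first.
  - by rewrite setDUK//; exact: msg.
  - by rewrite setDUK.
  - by apply/disj_setPS => x [Ex []].
  rewrite leeD2l//.
  apply: (@le_trans _ _ (\int[@area R]_(x in S `\` E) (2 * M)%:E)%E).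
    apply: ge0_le_integral => //.
    - by move=> x [Sx _]; exact: h0.
    - exact: msg.
    - move=> x [Sx _]; rewrite lee_fin; have := gM _ (SC _ Sx); rewrite ler_norml => /andP[_ h].
      by lra.
  have aD : @area R (S `\` E) = (((1 + d) ^+ 2 * pi) - pi)%:E.
    rewrite measureD; [|exact: mS|exact: mE|exact: area_compact_lty cS].
    by rewrite (setIidr ES) EFinB; congr (_ - _)%E; [exact: aS|exact: aE].
  rewrite integral_cst// aD -EFinM lee_fin.
  rewrite (_ : 2 * M * _ = M * pi * (4 * d + 2 * d ^+ 2)); last by ring.
  rewrite (_ : 6 * M * pi * d = M * pi * (6 * d)); last by ring.
  rewrite ler_wpM2l ?mulr_ge0 ?pi_ge0//.
  have : d ^+ 2 <= d by rewrite expr2 ler_piMl// ltW.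
by lra.
have := le_trans h1 h2; rewrite !shift// aE aF addeAC -!EFinM.
by rewrite leeD2rE.
Qed.

Lemma lambdaH_close r C d E F l : 0 < d -> 0 <= C -> thick r C E -> thick r C F ->
  @area R E = pi%:E -> @area R F = pi%:E -> scale_close d E F -> lambdaH F = l%:E ->
  (lambdaH E <= (l + C * d)%:E)%E.
Proof.
move=> d0 C0 [_ _ _ EC] [_ _ _ FC] aE aF EF lF; have [EF1 EF2] := EF.
apply/lee_addgt0Pr => e e0.
have : (lambdaH F < (l + e)%:E)%E by rewrite lF lte_fin ltrDl.
move=> /(lambdaH_lt aF)[z [h1 h2]].
rewrite -EFinD; apply: (@lambdaH_le _ _ z) => // x.
  move=> /h1[y Fy xy].
  have [y' Ey' yy'] := scale_close_near d0 EC C0 (conj EF2 EF1) Fy FC.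
  by exists y' => //; have := enorm_subtriangle x y y'; lra.
move=> Ex; have [y Fy xy] := scale_close_near d0 FC C0 EF Ex EC.
have [z' zz' yz'] := h2 _ Fy.
by exists z' => //; have := enorm_subtriangle x y z'; lra.
Qed.

(** Comparison with the unit disc at the origin: 0 lies in both sets, so it serves as the witness
    for every point. *)
Lemma lambdaH_fin r C E : 0 < r -> 0 <= C -> thick r C E -> @area R E = pi%:E ->
  exists2 l : R, 0 <= l & lambdaH E = l%:E.
Proof.
move=> r0 C0 [cE xE rE EC] aE.
have E0 : E 0 by apply: rE; rewrite /cball /= subr0 enorm0 ltW.
have l0 := lambdaH_ge0 (ex_intro _ 0 E0) aE.
have lC : (lambdaH E <= (1 + C)%:E)%E.
  apply: (@lambdaH_le _ _ 0) => // x.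
    by rewrite /cball /= => x1; exists 0 => //; lra.
  move=> /EC; rewrite /cball /= => xC; exists 0; last by lra.
  by rewrite /= subrr enorm0.
by case: (lambdaH E) l0 lC => [l||]//= l0 _; exists l.
Qed.

(** The infimum over centres must be shown to be attained at the value 0. Nearly optimal centres
    stay within 2 of the origin, because 0 belongs to E, so they converge along an ultrafilter, and
    E is the unit disc about the limit. *)
Lemma lambdaH_eq0 r C E : 0 < r -> 0 <= C -> thick r C E -> @area R E = pi%:E ->
  lambdaH E = 0%E -> is_cball E.
Proof.
move=> r0 C0 [cE xE rE EC] aE l0.
have E0 : E 0 by apply: rE; rewrite /cball /= subr0 enorm0 ltW.
(* An ultrafilter finer than the right neighbourhoods of 0 replaces a sequence of tolerances tending
   to 0. *)
have [U [uU Usub]] := ultraFilterLemma (at_right_proper_filter (0 : R)).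
pose P (t : R) z := cball z 1 `<=` cthick E t /\ E `<=` cthick (cball z 1) t.
have small e : 0 < e -> U [set t : R | 0 < t < e].
  by move=> e0; apply: Usub; near=> t; rewrite /=; apply/andP; split.
have UP : U [set t | exists2 z, cball 0 2 z & P t z].
  apply: filterS (small _ ltr01) => t /andP[t0 t1].
  have : (lambdaH E < t%:E)%E by rewrite l0 lte_fin.
  move=> /(lambdaH_lt aE)[z Pz]; exists z => //.
  have [_ /(_ _ E0)[y]] := Pz; rewrite /cball /= subr0 => yz ty.
  by have := enorm_triangle (z - y) y; rewrite subrK (enormB z y) (enormB 0) subr0 in ty *; lra.
have [f [z [_ fz Uf]]] := ultra_select uU (@compact_cball0 R 2) UP.
exists z, 1; split => //; apply/seteqP; split => x.
  move=> Ex; rewrite /cball /=; apply/ler_addgt0Pr => e e0.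
  have e20 : 0 < e / 2 by rewrite divr_gt0.
  have [t [[h1 [_ [_ h2]]] /andP[_ te]]] :=
    filter_ex (filterI (filterI (cvg_enorm fz e20) Uf) (small _ e20)).
  have [y yf xy] := h2 _ Ex.
  have h1' : enorm (f t - z) < e / 2 := h1; have yf' : enorm (y - f t) <= 1 := yf.
  have := enorm_subtriangle x y z; have := enorm_subtriangle y (f t) z; lra.
move=> zx; apply: cE => A /nbhs_enorm[e e0 eA].
have e20 : 0 < e / 2 by rewrite divr_gt0.
have [t [[h1 [_ [h2 _]]] /andP[_ te]]] :=
  filter_ex (filterI (filterI (cvg_enorm fz e20) Uf) (small _ e20)).
have h1' : enorm (f t - z) < e / 2 := h1.
(* Translation by f t - z carries the disc centred at z to the one centred at f t, to which the
   approximation applies. *)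
have [|y Ey xy] := h2 (x + (f t - z)).
  rewrite /cball /= (_ : x + (f t - z) - f t = x - z)//.
  by apply: injective_projections => /=; ring.
exists y; split => //; apply: eA.
have := enorm_subtriangle y (x + (f t - z)) x.
rewrite (enormB y (x + (f t - z))) (_ : x + (f t - z) - x = f t - z); first by lra.
by apply: injective_projections => /=; ring.
Unshelve. all: by end_near.
Qed.

Section UltraLimit.
Variable U : set_system (set (R * R)).
Hypothesis uU : UltraFilter U.
Variables r C : R.
Hypotheses (r0 : 0 < r) (C0 : 0 <= C).
Hypothesis UT : U [set E | thick r C E /\ @area R E = pi%:E].

Let E0 := ulimit U.

Let UT' : U [set E | thick r C E].
Proof. by apply: filterS UT => E []. Qed.

Let tE0 : thick r C E0.
Proof. exact: (ulimit_thick uU UT'). Qed.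

Lemma scale_close_area d E F : 0 < d -> d <= 1 -> compact E -> compact F ->
  @area R F = pi%:E -> scale_close d E F -> (@area R E <= (pi + 3 * pi * d)%:E)%E.
Proof.
move=> d0 d1 cE cF aF [EF _]; have mE := compact_measurable_plane cE.
have mS := compact_measurable_plane (compact_preimage_scale cF d0).
apply: (@le_trans _ _ (@area R [set x | F ((1 + d)^-1 *: x)])).
  by apply: le_measure; rewrite ?inE.
rewrite area_preimage_scale// lee_fin.
rewrite (_ : _ * pi = pi * (1 + 2 * d + d ^+ 2)); last by ring.
rewrite (_ : pi + _ = pi * (1 + 3 * d)); last by ring.
rewrite ler_wpM2l ?pi_ge0//.
have : d ^+ 2 <= d by rewrite expr2 ler_piMl// ltW.
by lra.
Qed.

(** Each of E0 and E lies in the dilate of the other by 1 + d, which multiplies areas by (1 + d)^2;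
    then d tends to 0. *)
Lemma ulimit_area : @area R E0 = pi%:E.
Proof.
have cE0 := thick_compact tE0; have mE0 := compact_measurable_plane cE0.
have fin := area_compact_lty cE0.
have [a aE] : exists a, @area R E0 = a%:E.
  by exists (fine (@area R E0)); rewrite fineK// ge0_fin_numE// measure_ge0.
rewrite aE; congr EFin; apply/eqP; rewrite eq_le; apply/andP; split.
  apply: (@le_linear_limit _ _ (3 * pi)) => d d0 d1.
  have [E [[tE arE] [cl1 cl2]]] := filter_ex (filterI UT (ulimit_close uU r0 UT' d0)).
  have := scale_close_area d0 d1 cE0 (thick_compact tE) arE (conj cl2 cl1).
  by rewrite aE lee_fin.
apply: (@le_linear_limit _ _ (3 * a)) => d d0 d1.
have [E [[tE arE] [cl1 cl2]]] := filter_ex (filterI UT (ulimit_close uU r0 UT' d0)).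
have t0 : 0 < (1 + d)^-1 by rewrite invr_gt0; lra.
have := area_scale t0 mE0; rewrite aE => hs.
have cE := thick_compact tE; have mE := compact_measurable_plane cE.
have mS := compact_measurable_plane (compact_preimage_scale cE0 d0).
have : (@area R E <= @area R [set x | E0 ((1 + d)^-1 *: x)])%E.
  by apply: le_measure; rewrite ?inE.
rewrite arE; move: hs; rewrite -[X in @area R X]/[set x | E0 ((1 + d)^-1 *: x)].
case: (@area R _) => [b||]; rewrite ?lee_fin.
- move=> [hb] pb; apply: le_trans pb _.
  have -> : b = (1 + d) ^+ 2 * a.
    by rewrite hb mulrA -exprMn divff ?expr1n ?mul1r// gt_eqF//; lra.
  have a0 : 0 <= a by rewrite -lee_fin -aE measure_ge0.
  have : a * d ^+ 2 <= a * d by rewrite ler_wpM2l// expr2 ler_piMl// ltW.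
  by lra.
- by rewrite gt0_muley// lte_fin exprn_gt0.
- by [].
Qed.

(** For a fixed test field the fluxes through E and E0 differ by a multiple of d, the divergence
    being bounded on a large disc; the bound passes to the limit field by field, hence to the
    supremum. *)
Lemma ulimit_perimeter (q : R) : U [set E | (perimeter E <= q%:E)%E] ->
  (perimeter E0 <= q%:E)%E.
Proof.
move=> Uq; apply: perimeter_le => f tf.
have [Cf _ _] := tf; have cd := divergence_continuous Cf.
have cE0 := thick_compact tE0.
have [M M0 hM] : exists2 M, 0 <= M & forall x, cball 0 (2 * C) x -> `|divergence f x| <= M.
  have cn : continuous (fun x => `|divergence f x|).
    by move=> x; apply: cvg_norm; exact: cd.
  have K0 : cball (0 : R * R) (2 * C) !=set0.
    by exists 0; rewrite /cball /= subr0 enorm0 mulr_ge0.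
  have [y _ hy] := compact_EVT_max K0 (@compact_cball0 R (2 * C)) (continuous_subspaceT cn).
  exists `|divergence f y|; first exact: normr_ge0.
  by move=> x Kx; apply: hy; rewrite inE.
have int0 := continuous_compact_integrable_plane cE0 cd.
have [i hi] : exists i : R, (\int[@area R]_(x in E0) (divergence f x)%:E = i%:E)%E.
  have mE0 := compact_measurable_plane cE0.
  by have := integrable_fin_num mE0 int0; move/fineK => <-; eexists; reflexivity.
rewrite hi lee_fin; apply: (@le_linear_limit _ _ (6 * M * pi)) => d d0 d1.
have [E [[[tE arE] [cl1 cl2]] Pq]] :=
  filter_ex (filterI (filterI UT (ulimit_close uU r0 UT' d0)) Uq).
have := integral_scale_close d0 d1 tE tE0 r0 arE ulimit_area cd hM M0 (conj cl2 cl1).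
rewrite hi => h; rewrite -lee_fin EFinD; apply: le_trans h _.
by rewrite leeD2r// (le_trans (perimeter_ge _ tf)).
Qed.

(** For x in the boundary of E0, the ray through x meets the boundary of E at t x with t close to 1,
    and the cone axes at these points converge along U to some v. Since the inequalities defining a
    sector are strict, a point of the sector at x with axis v lies in the sectors at t x for U-many
    E. *)
Lemma ulimit_cone (rho theta : R) : 0 < rho ->
  U [set E | interior_cone rho theta E] -> interior_cone rho theta E0.
Proof.
move=> rho0 Uc x bx.
have [cE0 _ rE0 E0C] := tE0.
have x0 : x != 0.
  apply/negP => /eqP x0; case: bx => _; apply; rewrite x0.
  apply: filterS (nbhs_enorm_lt 0 r0) => y /= yr; apply: rE0; exact: ltW.
have E0x : E0 x by apply: cE0; case: bx.
have xC : enorm x <= C by have := E0C _ E0x; rewrite /cball /= subr0.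
pose P E v := exists t : R, [/\ 0 <= t, boundary E (t *: x) & sector (t *: x) v theta rho `<=` E].
pose K : set (R * R) := [set v | enorm v = 1].
have cK : compact K.
  apply: (@closed_bounded_compact_plane R K 1); last by move=> z ->.
  have -> : K = @enorm R @^-1` [set 1] by [].
  by apply: closed_comp; [move=> z _; exact: enorm_continuous|exact: closed_eq].
have UP : U [set E | exists2 v, K v & P E v].
  apply: filterS (filterI UT' Uc) => E [tE icE].
  have [t t0 bt] := thick_ray r0 tE x0.
  by have [v [v1 vE]] := icE _ bt; exists v => //; exists t.
have [w [v [v1 wv Uw]]] := ultra_select uU cK UP.
exists v; split => // y [yx ya] e e0.
set c := cos (theta / 2) in ya.
have c1 : `|c| <= 1 by exact: cos_max.
set a := enorm (y - x) in yx ya; pose g := edot (y - x) v - c * a.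
have g0 : 0 < g by rewrite subr_gt0.
(* The margins of y in the two strict inequalities are g and rho - a. Of g, one quarter is spent on
   the change of axis, and less than one quarter on each of the two effects of moving the apex. *)
pose m := Num.min (g / 4) (rho - a).
have m0 : 0 < m by rewrite lt_min divr_gt0//= subr_gt0.
have mg : m <= g / 4 by rewrite ge_min lexx.
have ma : m <= rho - a by rewrite ge_min lexx orbT.
pose d := m / (C + 1).
have C1 : 0 < C + 1 by rewrite ltr_wpDl.
have d0 : 0 < d by rewrite divr_gt0.
have dC : C * d < m.
  by rewrite /d mulrA ltr_pdivrMr// mulrC ltr_pM2l//; lra.
have e10 : 0 < g / (4 * rho) by rewrite divr_gt0// mulr_gt0.
apply: filterS (filterI (filterI UT' (ulimit_close uU r0 UT' d0)) (filterI Uw (cvg_enorm wv e10))).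
move=> E [[tE [cl1 cl2]] [[w1 [t [t0 bt sE]]] wclose]].
exists y; last by rewrite subrr enorm0.
have d1 : 0 < 1 + d by lra.
have cE : closed E by case: tE.
have Etx : E (t *: x) by apply: cE; case: bt.
(* For t > 1 + d, x would be a proper contraction of a point of E0, hence interior to E0. The lower
   bound on t is obtained in the same way inside E. *)
have t1 : t <= 1 + d.
  rewrite leNgt; apply/negP => dt; have tp : 0 < t by lra.
  have h : E0 ((t / (1 + d)) *: x) by have := cl1 _ Etx; rewrite scalerA mulrC.
  have : E0^° (((1 + d) / t) *: ((t / (1 + d)) *: x)).
    apply: (thick_interior r0 tE0 h); first by rewrite divr_ge0// ltW.
    by rewrite ltr_pdivrMr// mul1r.
  rewrite scalerA mulrA divfK ?gt_eqF// divff ?gt_eqF// scale1r => ix.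
  by case: bx.
have t2 : (1 + d)^-1 <= t.
  rewrite leNgt; apply/negP => td.
  have : E^° ((t * (1 + d)) *: ((1 + d)^-1 *: x)).
    apply: (thick_interior r0 tE (cl2 _ E0x)); first by rewrite mulr_ge0// ltW.
    by rewrite -ltr_pdivlMr// mul1r.
  rewrite scalerA -mulrA divff ?gt_eqF// mulr1 => ix.
  by case: bt.
have td : `|1 - t| <= d.
  rewrite ler_norml; apply/andP; split; first by lra.
  have h : 1 - (1 + d)^-1 <= d.
    have -> : 1 - (1 + d)^-1 = d / (1 + d) by field; rewrite gt_eqF.
    by rewrite ler_pdivrMr// ler_peMr//; lra.
  by lra.
have tx : enorm (x - t *: x) <= C * d.
  have -> : enorm (x - t *: x) = `|1 - t| * enorm x.
    by rewrite -[X in X - _]scale1r -scalerBl enormZ_norm.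
  by rewrite mulrC; apply: ler_pM => //; exact: enorm_ge0.
have ytx : enorm (y - t *: x) <= a + C * d.
  by have := enorm_subtriangle y x (t *: x); rewrite -/a; lra.
apply: sE; split; first by lra.
rewrite -/c.
have w1' : enorm (w E) = 1 := w1.
have -> : edot (y - t *: x) (w E) = edot (y - x) v - edot (y - x) (v - w E)
   - edot (t *: x - x) (w E) by rewrite /edot /=; ring.
have h1 := edot_le (y - x) (v - w E).
have h2 := edot_le (t *: x - x) (w E).
rewrite w1' mulr1 (enormB (t *: x)) in h2.
rewrite -/a (enormB v) in h1.
have h3 : a * enorm (w E - v) <= g / 4.
  have ha : a * enorm (w E - v) <= rho * (g / (4 * rho)).
    apply: ler_pM; rewrite ?enorm_ge0//; exact: ltW.
  apply: le_trans ha _; rewrite (_ : rho * _ = g / 4)//.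
  by field; rewrite gt_eqF.
have h4 : c * enorm (y - t *: x) <= c * a + C * d.
  have hn : `|c * (enorm (y - t *: x) - a)| <= C * d.
    rewrite normrM -[leRHS]mul1r; apply: ler_pM => //.
    rewrite ler_norml; apply/andP; split; last by lra.
    have := enorm_subtriangle y (t *: x) x; rewrite -/a (enormB (t *: x)); lra.
  by have := le_trans (ler_norm _) hn; rewrite mulrBr; lra.
by rewrite /g in g0 mg h3; lra.
Qed.

End UltraLimit.
End Limits.

(** * The class of admissible sets *)

Section Normalisation.
Variable R : realType.
Implicit Types (E F : set (R * R)) (x y z v w : R * R) (r C d rho : R).

Lemma cos_pi4 : 0 < cos (pi / 2 / 2 : R) /\ cos (pi / 2 / 2 : R) ^+ 2 = 1 / 2.
Proof.
set p := pi / 2 / 2; have h := @cos_pihalf R.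
rewrite (_ : pi / 2 = p + p) ?cosD -?expr2 in h; last by rewrite -splitr.
have h1 := cos2Dsin2 p; split; last by lra.
by have := @pi_gt0 R => p0; apply: cos_gt0_pihalf; rewrite /p; apply/andP; split; lra.
Qed.

Lemma cos_pi4_lt : cos (pi / 2 / 2 : R) < 3 / 4.
Proof.
have [_ c2] := cos_pi4; rewrite ltNge; apply/negP => h.
have : (3 / 4) ^+ 2 <= cos (pi / 2 / 2 : R) ^+ 2 by rewrite ler_sqr ?nnegrE; lra.
by lra.
Qed.

(** On the disc |y - x| <= 11 rho / 20 and the component along v is at least 9 rho / 20; since cos
    (pi / 4) < 3/4 and (3/4) 11 < 9, both sector conditions hold. *)
Lemma sector_ball x v rho : 0 < rho -> enorm v = 1 ->
  cball (x + (rho / 2) *: v) (rho / 20) `<=` sector x v (pi / 2) rho.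
Proof.
move=> rho0 v1 y; rewrite /cball /=; set u := y - _ => hu.
have e : y - x = (rho / 2) *: v + u by rewrite /u [RHS]addrC opprD addrA subrK.
have hv : enorm ((rho / 2) *: v) = rho / 2 by rewrite enormZ ?v1 ?mulr1// divr_ge0// ltW.
have h1 : enorm (y - x) <= rho / 2 + rho / 20.
  by rewrite e (le_trans (enorm_triangle _ _))// hv lerD2l.
have h2 : rho / 2 - rho / 20 <= edot (y - x) v.
  have := edot_le (- u) v; rewrite v1 enormN mulr1 => h.
  have -> : edot (y - x) v = (rho / 2) * enorm v ^+ 2 - edot (- u) v.
    by rewrite e enorm_sqr /edot /= /GRing.scale /=; ring.
  by rewrite v1 expr1n mulr1; lra.
split; first by lra.
apply: lt_le_trans h2; have := cos_pi4_lt; set c := cos _ => c34.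
have n0 := enorm_ge0 (y - x).
have h3 : c * enorm (y - x) <= 3 / 4 * enorm (y - x) by rewrite ler_wpM2r// ltW.
by lra.
Qed.

(** The last point of E on a segment from a point of E to a point outside is a boundary point. *)
Lemma boundary_nonempty E : closed E -> E !=set0 -> ~` E !=set0 -> boundary E !=set0.
Proof.
move=> cE [x Ex] [y nEy].
pose g (t : R) := (1 - t) *: x + t *: y.
have cg : continuous g.
  move=> t; apply: cvgD; apply: cvgZr_tmp; last exact: cvg_id.
  by apply: cvgB; [exact: cvg_cst|exact: cvg_id].
have g0 : g 0 = x by rewrite /g subr0 scale1r scale0r addr0.
have g1 : g 1 = y by rewrite /g subrr scale1r scale0r add0r.
pose A : set R := `[0, 1]%classic `&` g @^-1` E.
have clA : closed A.
  apply: closedI; first exact: interval_closed.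
  by apply: closed_comp => // t _; exact: cg.
have sA : A `<=` `[0, 1]%classic by move=> t [].
have cA : compact A by apply: subclosed_compact clA _ sA; exact: segment_compact.
have A0 : A !=set0 by exists 0; split; rewrite /= ?in_itv /= ?lexx ?ler01// g0.
have [t tA tmax] := compact_EVT_max A0 cA (continuous_subspaceT (fun t => @cvg_id _ (nbhs t))).
rewrite inE in tA; have [] := tA; rewrite /= in_itv /= => /andP[t0 t1] Et.
exists (g t); split; first exact: subset_closure.
move=> gi; have t1' : t < 1.
  rewrite lt_neqAle t1 andbT; apply/negP => /eqP t1'.
  by apply: nEy; rewrite -g1 -t1'.
have /nbhs_ballP[e /= e0 he] := cg t _ gi.
pose s := Num.min 1 (t + e / 2).
have ts : t < s by rewrite lt_min t1' ltrDl divr_gt0.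
have As : A s.
  split; first by rewrite /= in_itv /= (le_trans t0 (ltW ts)) /= ge_min lexx.
  apply: he; rewrite /ball /= ltr_norml.
  have h : s <= t + e / 2 by rewrite ge_min lexx orbT.
  by apply/andP; split; lra.
by have := tmax s (mem_set As); rewrite leNgt ts.
Qed.

Lemma KR1_ball rho E : 0 < rho -> KR1 rho E -> exists z, cball z (rho / 20) `<=` E.
Proof.
move=> rho0 [cE _ aE icE].
have [x bx] : boundary E !=set0.
  apply: boundary_nonempty => //.
    apply/set0P/eqP => E0; have := @pi_gt0 R.
    by have := aE; rewrite E0 measure0 => -[<-]; rewrite ltxx.
  apply/set0P/eqP => /(congr1 (@setC _)); rewrite setCK setC0 => E1.
  (* The plane contains a rectangle of area 2 pi, so E is not the whole plane. *)
  pose B : set (R * R) := `[0, 2] `*` `[0, pi].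
  have : (@area R B <= @area R E)%E.
    apply: le_measure; rewrite ?inE.
    - by apply: measurableX; exact: measurable_itv.
    - exact: closed_measurable_plane.
    - by rewrite E1.
  rewrite aE /B area_rect ?pi_ge0// !subr0 lee_fin.
  by have := @pi_gt0 R; lra.
have [v [v1 vE]] := icE _ bx.
exists (x + (rho / 2) *: v); by move=> y hy; apply: vE; exact: sector_ball rho0 v1 _ hy.
Qed.

(** With d = |x - z|, the convex hull of x and the disc contains a rectangle of sides d / 2 and r,
    so d r / 2 <= pi. *)
Lemma cvx_bounded E z r x : closed E -> cvx E -> @area R E = pi%:E ->
  0 < r -> cball z r `<=` E -> E x -> enorm (x - z) <= 2 * pi / r.
Proof.
move=> cE xE aE r0 zE Ex.
have [->|xz] := eqVneq x z.
  by rewrite subrr enorm0 divr_ge0 ?mulr_ge0 ?pi_ge0// ltW.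
have dz : x - z != 0 by rewrite subr_eq0.
have d0 := enorm_gt0 dz; set d := enorm (x - z) in d0 *.
pose c := (x - z).1 / d; pose s := (x - z).2 / d.
have cs : c ^+ 2 + s ^+ 2 = 1.
  rewrite /c /s !expr_div_n -mulrDl -enorm_sqr -/d divff// expf_neq0// gt_eqF//.
pose T := rigid c s z.
have [cT aT] := area_preserving_rigid z cs.
have mE := closed_measurable_plane cE.
have cE' : closed (T @^-1` E) by apply: closed_comp => // w _; exact: cT.
have aE' : @area R (T @^-1` E) = pi%:E by rewrite aT.
have sub : `[0, d / 2] `*` `[- (r / 2), r / 2] `<=` T @^-1` E.
  move=> [a u] [] /=; rewrite !in_itv /= => /andP[a0 ad] /andP[u1 u2].
  pose t := a / d.
  have t0 : 0 <= t by rewrite divr_ge0// ltW.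
  have t12 : t <= 1 / 2 by rewrite /t ler_pdivrMr//; lra.
  have t1 : 0 < 1 - t by lra.
  have Ez : E (z + (u / (1 - t)) *: (- s, c)).
    apply: zE; rewrite /cball /= addrC addKr enormZ_norm.
    rewrite (_ : enorm (- s, c) = 1); last first.
      by rewrite /enorm /edot /= mulrNN -!expr2 addrC cs sqrtr1.
    rewrite mulr1 normrM normfV (gtr0_norm t1) ler_pdivrMr//.
    have : `|u| <= r / 2 by rewrite ler_norml u1 u2.
    have : r * (1 / 2) <= r * (1 - t) by rewrite ler_pM2l//; lra.
    by lra.
  have := xE _ _ t Ez Ex t0; rewrite (le_trans t12)//; last by lra.
  move=> /(_ isT); congr E; rewrite /T /rigid /rotation /c /s /t.
  have tn : 1 - t != 0 by rewrite gt_eqF.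
  have dn : d != 0 by rewrite gt_eqF.
  have dan : d - a != 0 by rewrite gt_eqF//; lra.
  by apply: injective_projections; rewrite /= /GRing.scale /=; field; rewrite dn dan.
pose B : set (R * R) := `[0, d / 2] `*` `[- (r / 2), r / 2].
have : (@area R B <= @area R (T @^-1` E))%E.
  apply: le_measure; rewrite ?inE //.
  - by apply: measurableX; exact: measurable_itv.
  - exact: closed_measurable_plane.
rewrite aE' /B area_rect ?divr_ge0 ?(ltW d0)//; last by lra.
rewrite subr0 lee_fin => h.
by rewrite ler_pdivlMr//; lra.
Qed.

Definition translate z E : set (R * R) := [set w | E (w + z)].

Lemma translateK z E : translate (- z) (translate z E) = E.
Proof. by apply/funext => w; rewrite /translate /= subrK. Qed.

Lemma closed_translate z E : closed E -> closed (translate z E).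
Proof.
move=> cE; apply: closed_comp => // w _.
by apply: cvgD; [exact: cvg_id|exact: cvg_cst].
Qed.

Lemma cvx_translate z E : cvx E -> cvx (translate z E).
Proof.
move=> xE x y t Ex Ey t0 t1; have := xE _ _ _ Ex Ey t0 t1; congr E.
by apply: injective_projections; rewrite /= /GRing.scale /=; ring.
Qed.

Lemma area_translate z E : closed E -> @area R (translate z E) = @area R E.
Proof.
by move=> cE; apply: (area_preserving_shift z).2; exact: closed_measurable_plane.
Qed.

Lemma perimeter_translate z E : compact E -> perimeter (translate z E) = perimeter E.
Proof.
move=> cE; rewrite -(@perimeter_rigid_eq R 1 0 z E)//; last by ring.
congr perimeter; apply/funext => w; rewrite /translate /preimage /=; congr (E _).
by rewrite /rigid /rotation; apply: injective_projections => /=; ring.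
Qed.

Lemma interior_cone_translate rho theta z E : closed E ->
  interior_cone rho theta E -> interior_cone rho theta (translate z E).
Proof.
move=> cE icE x [clx nix].
have Ex : E (x + z) by have := closed_translate cE clx.
have [|v [v1 vE]] := icE (x + z).
  split; first exact: subset_closure.
  move=> /nbhs_enorm[e e0 he]; apply: nix.
  apply: filterS (nbhs_enorm_lt x e0) => y /= yx; apply: he.
  by rewrite (_ : y + z - (x + z) = y - x)// opprD addrACA subrr addr0.
exists v; split => // y [h1 h2]; apply: vE; rewrite /sector /=.
by rewrite (_ : y + z - (x + z) = y - x)// opprD addrACA subrr addr0.
Qed.

Lemma KR1_translate rho z E : KR1 rho E -> KR1 rho (translate z E).
Proof.
move=> [cE /convex_setP xE aE icE]; split.
- exact: closed_translate.
- by apply/convex_setP; exact: cvx_translate.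
- by rewrite area_translate.
- exact: interior_cone_translate.
Qed.

Lemma is_cball_translate z E : is_cball (translate z E) -> is_cball E.
Proof.
move=> [c [r [r0 e]]]; exists (c + z), r; split => //.
rewrite -(translateK z E) e; apply/funext => w; rewrite /translate /cball /=.
by rewrite (_ : w - z - c = w - (c + z))// opprD addrAC addrA.
Qed.

Lemma lambdaH_translate_le z E (l : R) : closed E -> @area R E = pi%:E ->
  lambdaH E = l%:E -> (lambdaH (translate z E) <= l%:E)%E.
Proof.
move=> cE aE lE; apply/lee_addgt0Pr => e e0; rewrite -EFinD.
have : (lambdaH E < (l + e)%:E)%E by rewrite lE lte_fin ltrDl.
move=> /(lambdaH_lt aE)[c [h1 h2]].
apply: (@lambdaH_le _ _ (c - z)); first by rewrite area_translate.
  move=> x xc; have [|y Ey xy] := h1 (x + z).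
    by move: xc; rewrite /cball /= opprB addrA.
  exists (y - z); first by rewrite /translate /= subrK.
  by rewrite opprB addrA.
move=> x Ex; have [y yc xy] := h2 _ Ex.
exists (y - z); last by rewrite opprB addrA.
by move: yc; rewrite /cball /= opprB addrA subrK.
Qed.

Lemma shape_functional_translate r C z E : compact E -> @area R E = pi%:E ->
  0 < r -> 0 <= C -> thick r C (translate z E) ->
  shape_functional (translate z E) = shape_functional E.
Proof.
move=> kE aE r0 C0 tE.
have cE : closed E by exact: compact_closed.
have aE' : @area R (translate z E) = pi%:E by rewrite area_translate.
have [l' l'0 lE'] := lambdaH_fin r0 C0 tE aE'.
have cE' : closed (translate z E) by case: tE.
have h1 : (lambdaH E <= l'%:E)%E.
  by have := lambdaH_translate_le (- z) cE' aE' lE'; rewrite translateK.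
have E0 : E !=set0.
  by exists z; case: tE => _ _ /(_ 0) h _; have := h; rewrite /translate /= add0r; apply; rewrite /cball /= subr0 enorm0 ltW.
have h0 := lambdaH_ge0 E0 aE.
have [l lE] : exists l : R, lambdaH E = l%:E.
  by exists (fine (lambdaH E)); rewrite fineK// ge0_fin_numE// (le_lt_trans h1)// ltry.
have h2 := lambdaH_translate_le z cE aE lE.
have ll : lambdaH (translate z E) = lambdaH E.
  by apply/eqP; rewrite eq_le; apply/andP; split; [rewrite lE|rewrite lE'].
have rr : eqradius (translate z E) = eqradius E by rewrite /eqradius aE aE'.
by rewrite /shape_functional /deficit ll rr (perimeter_translate z kE).
Qed.

(** The inscribed disc is brought to the origin; the resulting radii depend on rho only, which makes
    the whole class precompact up to translation. *)
Lemma KR1_normalise rho E : 0 < rho -> KR1 rho E -> exists z,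
  let E' := translate z E in
  [/\ KR1 rho E', thick (rho / 20) (2 * pi / (rho / 20)) E' &
      shape_functional E' = shape_functional E].
Proof.
move=> rho0 hE; have [z zE] := KR1_ball rho0 hE; exists z => E'.
have [cE /convex_setP xE aE _] := hE.
have r0 : 0 < rho / 20 by rewrite divr_gt0.
have C0 : 0 <= 2 * pi / (rho / 20) by rewrite divr_ge0 ?mulr_ge0 ?pi_ge0// ltW.
have tE' : thick (rho / 20) (2 * pi / (rho / 20)) E'.
  split.
  - exact: closed_translate.
  - exact: cvx_translate.
  - by move=> x xr; apply: zE; move: xr; rewrite /cball /= subr0 addrK.
  - move=> x Ex; have := cvx_bounded cE xE aE r0 zE Ex.
    by rewrite /cball /= subr0 addrK.
have kE : compact E.
  apply: (@closed_bounded_compact_plane R E (2 * pi / (rho / 20) + enorm z)) => //.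
  move=> x Ex; have := cvx_bounded cE xE aE r0 zE Ex.
  by have := enorm_triangle (x - z) z; rewrite subrK; lra.
split; [exact: KR1_translate|exact: tE'|].
exact: (shape_functional_translate kE aE r0 C0 tE').
Qed.

End Normalisation.

(** * Values of the functional, discs and rectangles *)

Section ShapeFunctional.
Variable R : realType.
Implicit Types (E F : set (R * R)) (x y z v w : R * R) (r C d rho l c : R).

Lemma cvx_cball z r : cvx (cball z r).
Proof.
move=> x y t; rewrite /cball /= => xr yr t0 t1.
have -> : (1 - t) *: x + t *: y - z = (1 - t) *: (x - z) + t *: (y - z).
  by apply: injective_projections; rewrite /= /GRing.scale /=; ring.
rewrite (le_trans (enorm_triangle _ _))// !enormZ//; last by lra.
have : (1 - t) * enorm (x - z) <= (1 - t) * r by rewrite ler_wpM2l//; lra.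
have : t * enorm (y - z) <= t * r by rewrite ler_wpM2l.
by lra.
Qed.

Lemma perimeter_cball01 : perimeter (cball (0 : R * R) 1) = (2 * pi)%:E.
Proof.
apply/eqP; rewrite eq_le perimeter_cball01_le /=.
exact: (perimeter_ge_2pi (@compact_cball0 R 1) (@cvx_cball 0 1) (@area_cball01 R)
  ltr01 (@subset_refl _ _)).
Qed.

Lemma shape_functional_fin E (p l : R) : @area R E = pi%:E ->
  perimeter E = p%:E -> lambdaH E = l%:E -> 0 < l ->
  shape_functional E = ((p - 2 * pi) / (2 * pi) / l ^+ 2)%:E.
Proof.
move=> aE pE lE l0; rewrite /shape_functional /deficit (eqradius1 aE) perimeter_cball01.
have p0 := @pi_gt0 R.
rewrite pE lE -EFin_expe !inver !gt_eqF ?mulr_gt0 ?exprn_gt0//.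
Qed.

Lemma shape_functional_pinfty E (l : R) : @area R E = pi%:E ->
  perimeter E = +oo%E -> lambdaH E = l%:E -> 0 < l -> shape_functional E = +oo%E.
Proof.
move=> aE pE lE l0; rewrite /shape_functional /deficit (eqradius1 aE) perimeter_cball01.
have p0 := @pi_gt0 R.
rewrite pE lE -EFin_expe !inver !gt_eqF ?mulr_gt0 ?exprn_gt0// -EFinN addye//.
by rewrite !gt0_mulye// lte_fin invr_gt0 ?mulr_gt0 ?exprn_gt0.
Qed.

Lemma shape_functional_ge0 E (l : R) : @area R E = pi%:E ->
  ((2 * pi)%:E <= perimeter E)%E -> lambdaH E = l%:E -> 0 < l ->
  (0 <= shape_functional E)%E.
Proof.
move=> aE pE lE l0; case hp : (perimeter E) => [p||].
- rewrite (shape_functional_fin aE hp lE l0) lee_fin.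
  rewrite hp lee_fin in pE.
  by rewrite !divr_ge0 ?sqr_ge0 ?mulr_ge0 ?pi_ge0 ?subr_ge0.
- by rewrite (shape_functional_pinfty aE hp lE l0) leey.
- by rewrite hp in pE.
Qed.

(** The working form of bounds on the functional: it contains no quotient, covers infinite
    perimeter, and passes to limits in l and c. *)
Lemma shape_functional_le E (l c : R) : @area R E = pi%:E ->
  ((2 * pi)%:E <= perimeter E)%E -> lambdaH E = l%:E -> 0 < l ->
  (shape_functional E <= c%:E)%E = (perimeter E <= (2 * pi + 2 * pi * c * l ^+ 2)%:E)%E.
Proof.
move=> aE pE lE l0; case hp : (perimeter E) => [p||].
- rewrite (shape_functional_fin aE hp lE l0) !lee_fin.
  have p0 := @pi_gt0 R.
  rewrite ler_pdivrMr ?exprn_gt0// ler_pdivrMr ?mulr_gt0// lerBlDl.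
  by congr (_ <= _ + _); ring.
- by rewrite (shape_functional_pinfty aE hp lE l0) !leye_eq.
- by rewrite hp in pE.
Qed.

Lemma area_cball z r : 0 < r -> @area R (cball z r) = (r ^+ 2 * pi)%:E.
Proof.
move=> r0; have -> : cball z r = translate (- z) (cball 0 r).
  by apply/funext => x; rewrite /translate /cball /= subr0.
rewrite area_translate; last exact: closed_cball.
rewrite (area_scale r0); last by apply: closed_measurable_plane; exact: closed_cball.
rewrite [RHS]EFinM -(@area_cball01 R); congr (_ * area R _)%E.
apply/funext => x; rewrite /preimage /cball /= !subr0 enormZ ?(ltW r0)//.
by rewrite -[X in _ <= X]mulr1 ler_pM2l.
Qed.

Lemma is_cball_lambdaH E : @area R E = pi%:E -> is_cball E -> (lambdaH E <= 0%:E)%E.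
Proof.
move=> aE [z [r [r0 eE]]].
have r1 : r = 1.
  have := aE; rewrite eE area_cball// => -[] /eqP.
  have pi0 : pi != 0 :> R by rewrite gt_eqF ?pi_gt0.
  rewrite -{2}[pi]mul1r (inj_eq (mulIf pi0)).
  by rewrite sqrf_eq1 => /orP[/eqP//|/eqP r1]; move: r0; rewrite r1; lra.
by rewrite r1 in eE; apply: (@lambdaH_le _ _ z) => //; rewrite -eE => x Ex; exists x => //;
  rewrite subrr enorm0.
Qed.

Lemma cvx_box l (w : R) : cvx (box l w).
Proof.
move=> x y t [] /=; rewrite !in_itv /= => /andP[x1 x2] /andP[x3 x4].
move=> [] /=; rewrite !in_itv /= => /andP[y1 y2] /andP[y3 y4] t0 t1.
have key (a b k : R) : - k <= a -> a <= k -> - k <= b -> b <= k ->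
    - k <= (1 - t) * a + t * b <= k.
  move=> a1 a2 b1 b2; have t1' : 0 <= 1 - t by lra.
  have := ler_wpM2l t1' a1; have := ler_wpM2l t1' a2.
  have := ler_wpM2l t0 b1; have := ler_wpM2l t0 b2.
  by move=> *; apply/andP; split; lra.
by split; rewrite /= in_itv /=; exact: key.
Qed.

(** The axis is the diagonal direction pointing, in each coordinate, towards the centre. With
    aperture pi / 2 the sector is then part of a quadrant: for inward coordinates p and q it says |y
    - x| < p + q, which forces p, q > 0, while p, q <= rho <= w keeps y inside. *)
Lemma interior_cone_box l (w rho : R) : 0 < w -> w <= l -> 0 < rho -> rho <= w ->
  interior_cone rho (pi / 2) (box l w).
Proof.
move=> w0 wl rho0 rw x [clx _].
have : box l w x by apply: compact_closed clx; [exact: norm_hausdorff|exact: compact_box].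
have [c0 c2] := @cos_pi4 R; rewrite /interior_cone /sector; set c := cos _ in c0 c2 *.
move=> []; rewrite /= !in_itv /= => /andP[h1 h2] /andP[h3 h4].
pose sg (a : R) : R := if a <= 0 then 1 else -1.
have sg2 a : sg a ^+ 2 = 1 by rewrite /sg; case: ifP; rewrite ?sqrrN expr1n.
have sgP (a e k : R) : 0 < w -> w <= k -> - k <= a -> a <= k -> 0 <= sg a * e -> sg a * e <= w ->
    - k <= a + e <= k.
  by rewrite /sg; case: (leP a 0) => ha k0 *; apply/andP; split; lra.
exists (c * sg x.1, c * sg x.2); split.
  rewrite /enorm /edot /= (_ : _ + _ = c ^+ 2 * (sg x.1 ^+ 2 + sg x.2 ^+ 2)); last by ring.
  by rewrite !sg2 c2 (_ : 1 / 2 * (1 + 1) = 1 ^+ 2) ?sqrtr_sqr ?normr1//; field.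
move=> y; rewrite /= => -[yr yc].
pose p := sg x.1 * (y - x).1; pose q := sg x.2 * (y - x).2.
have n0 := enorm_ge0 (y - x).
have npq : enorm (y - x) ^+ 2 = p ^+ 2 + q ^+ 2.
  by rewrite enorm_sqr /p /q !exprMn !sg2 !mul1r.
have nlt : enorm (y - x) < p + q.
  rewrite -(ltr_pM2l c0); apply: lt_le_trans yc _.
  by rewrite /edot /= /p /q /=; lra.
have pq : 0 < p * q.
  have : enorm (y - x) ^+ 2 < (p + q) ^+ 2 by rewrite ltr_sqr ?nnegrE//; lra.
  by rewrite npq sqrrD; lra.
have p0 : 0 < p.
  rewrite ltNge; apply/negP => p0; have q0 : 0 < q by lra.
  have : p * q <= 0 by rewrite mulr_le0_ge0// ltW.
  by rewrite leNgt pq.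
have q0 : 0 < q by rewrite -(pmulr_rgt0 _ p0).
have pw : p <= w.
  have : `|p| <= enorm (y - x).
    by rewrite -ler_sqr ?nnegrE// real_normK ?num_real// npq lerDl sqr_ge0.
  by have := ler_norm p; lra.
have qw : q <= w.
  have : `|q| <= enorm (y - x).
    by rewrite -ler_sqr ?nnegrE// real_normK ?num_real// npq lerDr sqr_ge0.
  by have := ler_norm q; lra.
have -> : y = (x.1 + (y - x).1, x.2 + (y - x).2).
  by apply: injective_projections => /=; ring.
split; rewrite /= in_itv /=.
  by apply: sgP => //; exact: ltW.
by apply: sgP => //; exact: ltW.
Qed.

Lemma KR1_box l (w rho : R) : 0 < w -> w <= l -> 4 * l * w = pi -> 0 < rho -> rho <= w ->
  KR1 rho (box l w).
Proof.
move=> w0 wl lw rho0 rw; split.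
- by apply: compact_closed; [exact: norm_hausdorff|exact: compact_box].
- apply/convex_setP; exact: cvx_box.
- rewrite /box area_rect; [|lra|lra].
  by congr EFin; rewrite -lw; ring.
- exact: interior_cone_box.
Qed.

Lemma thick_box l (w : R) : 0 < w -> w <= l -> thick w (l + w) (box l w).
Proof.
move=> w0 wl; split.
- by apply: compact_closed; [exact: norm_hausdorff|exact: compact_box].
- exact: cvx_box.
- move=> x; rewrite /cball /= subr0 => xw.
  have := enorm_fst x; have := enorm_snd x; rewrite !ler_norml => h1 h2.
  by split; rewrite /= in_itv /= -ler_norml; have := enorm_fst x; have := enorm_snd x; lra.
- move=> x [] /=; rewrite !in_itv /= => /andP[x1 x2] /andP[x3 x4].
  rewrite /cball /= subr0 enorm_le; last by lra.
  have : x.1 ^+ 2 <= l ^+ 2 by rewrite -real_normK ?num_real// ler_sqr ?nnegrE// ?ler_norml ?x1//; lra.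
  have : x.2 ^+ 2 <= w ^+ 2 by rewrite -real_normK ?num_real// ler_sqr ?nnegrE// ?ler_norml ?x3//; lra.
  have : 0 <= l * w by rewrite mulr_ge0; lra.
  by rewrite sqrrD; lra.
Qed.

(** The points (l, 0) and (- l, 0), at distance 2 l, would both lie within 1 + t of one centre for
    some t < l - 1. *)
Lemma lambdaH_box l (w : R) : 0 < w -> w <= l -> 4 * l * w = pi ->
  exists2 k : R, lambdaH (box l w) = k%:E & l - 1 <= k.
Proof.
move=> w0 wl lw.
have aB : @area R (box l w) = pi%:E.
  rewrite /box area_rect; [|lra|lra].
  by congr EFin; rewrite -lw; ring.
have lw0 : 0 <= l + w by lra.
have [k k0 lk] := lambdaH_fin w0 lw0 (thick_box w0 wl) aB.
exists k => //; rewrite leNgt; apply/negP => kl.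
pose t := (k + l - 1) / 2.
have : (lambdaH (box l w) < t%:E)%E by rewrite lk lte_fin /t; lra.
move=> /(lambdaH_lt aB)[z [_ h]].
have h1 (a : R) : - l <= a -> a <= l -> enorm ((a, 0) - z) <= 1 + t.
  move=> a1 a2; have [|y] := h (a, 0).
    by split; rewrite /= in_itv /=; apply/andP; split; lra.
  by rewrite /cball /= => yz ay; have := enorm_subtriangle (a, 0) y z; lra.
have a1 : enorm ((l, 0) - z) <= 1 + t by apply: h1; lra.
have a2 : enorm ((- l, 0) - z) <= 1 + t by apply: h1; lra.
have := enorm_fst ((l, 0) - z); have := enorm_fst ((- l, 0) - z) => /=.
have := ler_norm (l - z.1); have := ler_norm (- (- l - z.1)); rewrite normrN.
by move: a1 a2; rewrite /t; lra.
Qed.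

End ShapeFunctional.

(** * Existence of minimisers *)

Section Existence.
Variable R : realType.
Implicit Types (E F : set (R * R)).

(** The gap around the disc: for deviation at most 1 and positive, the functional exceeds 1/400,
    because [stability] would otherwise bound the deviation by less than itself. *)
Lemma is_cball_stability (r C c l : R) E : 0 < r -> 0 <= C -> thick r C E ->
  @area R E = pi%:E -> 0 <= c -> c <= 1 / 400 -> lambdaH E = l%:E -> 0 < l -> l <= 1 ->
  (shape_functional E <= c%:E)%E -> False.
Proof.
move=> r0 C0 tE aE c0 c400 lE l0 l1.
have kE := thick_compact tE; have [_ xE rE _] := tE.
have P2 := perimeter_ge_2pi kE xE aE r0 rE.
rewrite (shape_functional_le _ aE P2 lE l0) => Pc.
(* Here 7 s = 140 l / 141 < l, while s^2 > l^2 / 50, the largest excess allowed by 2 pi c l^2 with c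
   <= 1/400 and pi <= 4. *)
pose s := l * (20 / 141).
have s0 : 0 < s by rewrite mulr_gt0.
have s4 : s <= 1 / 4 by rewrite /s; lra.
have Ps : (perimeter E <= (2 * pi + s ^+ 2)%:E)%E.
  apply: le_trans Pc _; rewrite lee_fin lerD2l.
  have h : 2 * pi * c <= 1 / 50.
    have pi4 : pi <= 4 :> R by have := @pihalf_lt2 R; lra.
    have : pi * c <= 4 * c by rewrite ler_wpM2r.
    by lra.
  apply: (@le_trans _ _ (1 / 50 * l ^+ 2)); first by rewrite ler_wpM2r ?sqr_ge0.
  rewrite /s exprMn; have := sqr_ge0 l; lra.
have := stability kE xE aE r0 rE s0 s4 Ps; rewrite lE lee_fin /s; lra.
Qed.

Lemma KR1_lambdaH_gt0 (rho r C : R) E : 0 < r -> 0 <= C -> thick r C E -> KR1 rho E ->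
  ~ is_cball E -> exists2 l : R, lambdaH E = l%:E & 0 < l.
Proof.
move=> r0 C0 tE [_ _ aE _] nE; have [l l0 lE] := lambdaH_fin r0 C0 tE aE.
exists l => //; rewrite lt_neqAle l0 andbT; apply/negP => /eqP l00.
by apply: nE; apply: (lambdaH_eq0 r0 C0 tE aE); rewrite lE -l00.
Qed.

(** The strict inequality on c leaves room for near-minimisers to stay below 1/400, the range where
    sets close to a disc are excluded. *)
Theorem shape_functional_min (c rho : R) E1 : c < 1 / 400 -> 0 < rho ->
  KR1 rho E1 -> ~ is_cball E1 -> (shape_functional E1 <= c%:E)%E ->
  exists E0, [/\ KR1 rho E0, ~ is_cball E0 &
    forall E, KR1 rho E -> ~ is_cball E -> (shape_functional E0 <= shape_functional E)%E].
Proof.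
move=> c400 rho0 K1 n1 F1.
pose r := rho / 20; pose C := 2 * pi / r.
have r0 : 0 < r by rewrite divr_gt0.
have C0 : 0 <= C by rewrite divr_ge0 ?mulr_ge0 ?pi_ge0// ltW.
pose Adm E := KR1 rho E /\ ~ is_cball E.
have normal E : Adm E -> exists E', [/\ Adm E', thick r C E' &
    shape_functional E' = shape_functional E].
  move=> [KE nE]; have [z [K' t' F']] := KR1_normalise rho0 KE.
  exists (translate z E); split; [|exact: t'|exact: F'].
  by split; [exact: K'|move=> h; apply: nE; exact: is_cball_translate h].
clearbody C; clearbody r.
pose m := ereal_inf [set shape_functional E | E in [set E | Adm E]].
have m0 : (0 <= m)%E.
  apply: le_ereal_inf_tmp => _ [E /normal[E' [[K' n'] t' <-]] <-].
  have [l lE l0] := KR1_lambdaH_gt0 r0 C0 t' K' n'; have [_ _ aE _] := K'.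
  apply: (shape_functional_ge0 aE _ lE l0).
  by have [_ xE rE _] := t'; exact: (perimeter_ge_2pi (thick_compact t') xE aE r0 rE).
have mc : (m <= c%:E)%E by apply: le_trans F1; apply: ereal_inf_lbound; exists E1.
have [q qE] : exists q : R, m = q%:E.
  by exists (fine m); rewrite fineK// ge0_fin_numE// (le_lt_trans mc)// ltry.
have q0 : 0 <= q by rewrite -lee_fin -qE.
have qc : q <= c by rewrite -lee_fin -qE.
(* Normalised near-minimisers; an ultrafilter refining the filter based on these sets plays the part
   of a minimising sequence. *)
pose G (e : R) := [set E | [/\ Adm E, thick r C E & (shape_functional E <= (q + e)%:E)%E]].
have fG : Filter (filter_from [set e : R | 0 < e] G).
  apply: filter_from_filter; first by exists 1 => /=.
  move=> e1 e2 /= e10 e20; exists (Num.min e1 e2); first by rewrite /= lt_min e10.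
  move=> E [AE tE FE]; split; split; [exact: AE|exact: tE| |exact: AE|exact: tE|];
    by apply: le_trans FE _; rewrite lee_fin lerD2l ge_min lexx ?orbT.
have pG : ProperFilter (filter_from [set e : R | 0 < e] G).
  apply: filter_from_proper => e /= e0.
  have : (m < (q + e)%:E)%E by rewrite qE lte_fin ltrDl.
  move=> /ereal_inf_lt[_ [E AE <-] FE]; have [E' [AE' tE' F']] := normal E AE.
  by exists E'; split; [exact: AE'|exact: tE'|rewrite F' ltW].
have [U [uU GU]] := ultraFilterLemma pG.
have UG e : 0 < e -> U (G e) by move=> e0; apply: GU; exists e.
have UT : U [set E | thick r C E /\ @area R E = pi%:E].
  by apply: filterS (UG _ ltr01) => E [[[_ _ aE _] _] tE _].
have UT' : U [set E | thick r C E] by apply: filterS UT => E [].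
pose E0 := ulimit U.
have tE0 : thick r C E0 by exact: (ulimit_thick uU UT').
have aE0 : @area R E0 = pi%:E by exact: (ulimit_area uU r0 UT).
have KE0 : KR1 rho E0.
  have [cE0 xE0 _ _] := tE0; split; [exact: cE0|exact/convex_setP|exact: aE0|].
  apply: (ulimit_cone uU r0 C0 UT rho0).
  by apply: filterS (UG _ ltr01) => E [[[]]].
have [l0 l00 lE0] := lambdaH_fin r0 C0 tE0 aE0.
have lclose d E : 0 < d -> thick r C E -> @area R E = pi%:E -> scale_close d E E0 ->
    (lambdaH E <= (l0 + C * d)%:E)%E.
  by move=> d0 tE aE cl; exact: (lambdaH_close d0 C0 tE tE0 aE aE0 cl lE0).
have nE0 : ~ is_cball E0.
  move=> /(is_cball_lambdaH aE0); rewrite lE0 lee_fin => l0le.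
  (* With this d, C d <= 1: if E0 were a disc, then l0 <= 0 and some near-minimiser would have
     deviation at most 1, against [is_cball_stability]. *)
  pose d := (C + 1)^-1; have C1 : 0 < C + 1 by lra.
  have d0 : 0 < d by rewrite invr_gt0.
  pose e := 1 / 400 - c; have e0 : 0 < e by rewrite subr_gt0.
  have [E [[[KE nE] tE FE] cl]] := filter_ex (filterI (UG e e0) (ulimit_close uU r0 UT' d0)).
  have [l lE lgt0] := KR1_lambdaH_gt0 r0 C0 tE KE nE.
  have [_ _ aE _] := KE; have := lclose d E d0 tE aE cl.
  rewrite lE lee_fin => lCd.
  have l1 : l <= 1.
    have : C * d <= 1 by rewrite ler_pdivrMr// mul1r; lra.
    by lra.
  apply: (is_cball_stability r0 C0 tE aE _ _ lE lgt0 l1 FE); last by rewrite /e; lra.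
  by rewrite addr_ge0// ltW.
have [k lk k0] := KR1_lambdaH_gt0 r0 C0 tE0 KE0 nE0.
move: lk; rewrite lE0 => -[lk]; rewrite -{}lk in k0.
have P2 : ((2 * pi)%:E <= perimeter E0)%E.
  by have [_ xE rE _] := tE0; exact: (perimeter_ge_2pi (thick_compact tE0) xE aE0 r0 rE).
exists E0; split; [exact: KE0|exact: nE0|move=> E KE nE].
apply: (@le_trans _ _ m); last by apply: ereal_inf_lbound; exists E.
rewrite qE (shape_functional_le _ aE0 P2 lE0 k0).
(* The quotient is not compared directly: the perimeter bound of near-minimisers, with their
   deviation estimated by that of E0, passes to E0, and only then does e tend to 0. *)
have Pe e : 0 < e -> e <= 1 ->
    (perimeter E0 <= (2 * pi + 2 * pi * (q + e) * (l0 + C * e) ^+ 2)%:E)%E.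
  move=> e0 e1; apply: (ulimit_perimeter uU r0 C0 UT).
  apply: filterS (filterI (UG e e0) (ulimit_close uU r0 UT' e0)) => F [[[KF nF] tF FF] cl].
  have [l lF lgt0] := KR1_lambdaH_gt0 r0 C0 tF KF nF.
  have [_ _ aF _] := KF; have := lclose e F e0 tF aF cl.
  rewrite lF lee_fin => lCe; have [_ xF rF _] := tF.
  have P2F := perimeter_ge_2pi (thick_compact tF) xF aF r0 rF.
  move: FF; rewrite (shape_functional_le _ aF P2F lF lgt0) => /le_trans; apply.
  rewrite lee_fin lerD2l ler_wpM2l ?mulr_ge0 ?pi_ge0 ?addr_ge0 ?(ltW e0)//.
  by rewrite ler_sqr ?nnegrE ?(ltW lgt0)// (le_trans (ltW lgt0)).
have [p pE] : exists p : R, perimeter E0 = p%:E.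
  have := Pe 1 ltr01 (lexx _); move: P2; case: (perimeter E0) => [p||]// _ _.
  by exists p.
rewrite pE lee_fin.
(* The constant collects the terms of (q + e) (l0 + C e)^2 beyond q l0^2, with e^2 <= e. *)
apply: (@le_linear_limit _ _ _ (2 * pi * (q * (2 * l0 * C + C ^+ 2) + (l0 + C) ^+ 2))).
move=> e e0 e1; have := Pe e e0 e1; rewrite pE lee_fin => /le_trans; apply.
rewrite -addrA lerD2l -!mulrA -!mulrDr ler_pM2l// ler_pM2l ?pi_gt0//.
have Ce : C * e <= C by rewrite ler_piMr.
have Ce0 : 0 <= C * e by rewrite mulr_ge0// ltW.
have h1 : e * (l0 + C * e) ^+ 2 <= e * (l0 + C) ^+ 2.
  by rewrite ler_pM2l// ler_sqr ?nnegrE ?addr_ge0// lerD2l.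
have h2 : q * (C ^+ 2 * e ^+ 2) <= q * (C ^+ 2 * e).
  rewrite ler_wpM2l// ler_wpM2l ?sqr_ge0// expr2 ler_piMl// ltW//.
rewrite (_ : (q + e) * _ = q * l0 ^+ 2 + q * (2 * l0 * C) * e + q * (C ^+ 2 * e ^+ 2)
  + e * (l0 + C * e) ^+ 2); last by ring.
by lra.
Qed.

End Existence.

Theorem theorem2p3 (R : realType) :
  exists Rbar : R, 0 < Rbar /\
    forall rho : R, 0 < rho -> rho < Rbar ->
      exists E0 : set (R * R),
        [/\ KR1 rho E0, ~ is_cball E0 &
            forall E : set (R * R), KR1 rho E -> ~ is_cball E ->
              (shape_functional E0 <= shape_functional E)%E].
Proof.
have p2 := @pi_ge2 R; have p4 := @pihalf_lt2 R.
(* Half-lengths with 4 l w = pi. The deviation k is at least l - 1 = 440 and the perimeter at most 4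
   (l + w), about 1764, while 2 pi k^2 / 401 >= 4 (440)^2 / 401 > 1900; hence the functional is
   below 1/401. *)
pose l : R := 441; pose w : R := pi / 1764.
have w0 : 0 < w by rewrite /w; lra.
have w1 : w <= 1 / 441 by rewrite /w; lra.
have wl : w <= l by rewrite /l; lra.
have lw : 4 * l * w = pi by rewrite /l /w; lra.
(* The box satisfies the cone condition for every radius up to its smaller half-length, which
   therefore serves as the bound on rho. *)
exists w; split => // rho rho0 rw.
have K1 := KR1_box w0 wl lw rho0 (ltW rw).
have [_ _ aB _] := K1.
have [k lk hk] := lambdaH_box w0 wl lw.
have k0 : 440 <= k by move: hk; rewrite /l; lra.
apply: (@shape_functional_min R (1 / 401) rho (box l w)) => //.
- by lra.
- by move=> /(is_cball_lambdaH aB); rewrite lk lee_fin; lra.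
have [_ xE rE _] := thick_box w0 wl.
have l0 : 0 < l by rewrite /l; lra.
have k00 : 0 < k by lra.
rewrite (shape_functional_le _ aB (perimeter_ge_2pi (@compact_box R l w) xE aB w0 rE) lk k00).
apply: le_trans (perimeter_box_le l0 w0) _; rewrite lee_fin.
have kk : 440 * k <= k ^+ 2 by rewrite expr2; apply: ler_wpM2r; [exact: ltW|exact: k0].
have pk : 2 * k ^+ 2 <= pi * k ^+ 2 by apply: ler_wpM2r; [exact: sqr_ge0|exact: p2].
by rewrite /l; lra.
Qed.
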